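(* Let $\phi:[0,1)\to[0,1)$ be an increasing concave function such that $\phi(0+)=0$ and let $$\psi(u):=\inf_{1<w<\frac1u}\frac{\phi(uw)}{1+\log(w)},\quad u\in[0,1).$$ Suppose that $$\int_0^u\frac{\psi(t)}{t}\,dt+u\int_u^1\frac{\psi(t)}{t^2}\,dt\le c_{\phi,\psi}\,\phi(u),\quad u\in(0,1),$$ for some constant $c_{\phi,\psi}$. Then $\mathcal{S}_{\Lambda_\phi}=\Lambda_\psi$. Thus, $\Lambda_\psi$ is the optimal symmetric (quasi-)Banach range for the martingale transform $T$ defined on the Lorentz space $\Lambda_\phi$.
   Context: All functions are real-valued measurable functions on $(0,1)$ with Lebesgue measure $m$, identified when equal a.e.; $\log$ is the natural logarithm; $L_1=L_1(0,1)$. Decreasing rearrangement: $\mu(x)=\mu(\cdot;x)$, $\mu(t;x):=\inf\{s\ge 0: m(\{u:|x(u)|>s\})\le t\}$. A (quasi-)Banach symmetric function space on $(0,1)$ is a complete (quasi-)normed space $(E,\|\cdot\|_E)$ of measurable functions on $(0,1)$ such that: if $x\in E$ and $y$ is measurable with $|y|\le|x|$, then $y\in E$ and $\|y\|_E\le\|x\|_E$; if $x\in E$ and $y$ is measurable with $\mu(y)=\mu(x)$, then $y\in E$ and $\|y\|_E=\|x\|_E$. Lorentz space: $\Lambda_\phi=\{x \text{ measurable on }(0,1): \|x\|_{\Lambda_\phi}:=\int_0^1\mu(s;x)\,d\phi(s)<\infty\}$, and $\Lambda_\psi$ is given by the same formula with $\psi$ in place of $\phi$. At $u=0$ the infimum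 defining $\psi$ is over $1<w<\infty$. Calderón operator: $(Sx)(t)=\frac1t\int_0^t x(s)\,ds+\int_t^1\frac{x(s)}{s}\,ds$, $x\in L_1$. $L_{1,\infty}(0,1)$ is the space of measurable $x$ with $\sup_{0<t\le1}t\mu(t;x)<\infty$. For a quasi-Banach symmetric function space $E\subset L_1$ on $(0,1)$ define $\mathcal{S}_E=\{x\in L_{1,\infty}(0,1):\exists y\in E,\ \mu(x)\le S\mu(y)\}$ with $\|x\|_{\mathcal{S}_E}=\inf\{\|y\|_E: y\in E,\ \mu(x)\le S\mu(y)\}$. Martingale transform $T$: let $\mathcal{F}_n$, $n\ge0$, be the standard dyadic filtration on $[0,1]$ ($\mathcal F_n$ is generated by the intervals $((j-1)2^{-n},j2^{-n})$, $1\le j\le 2^n$), $\mathbb{E}_n$ the conditional expectation from $L_1$ onto $\mathcal F_n$, and $\mathbb E_{-1}=0$. Then $Tf=\sum_{m\ge0}(\mathbb{E}_{2m}f-\mathbb{E}_{2m-1}f)$, $f\in L_1$, with convergence in measure. Optimal range: for a linear operator $R$ defined on $E$, a (quasi-)Banach symmetric function space $G$ on $(0,1)$ is the optimal symmetric (quasi-)Banach range for $R$ on $E$ if it is the minimal receptacle of $R$ among (quasi-)Banach symmetric function spaces, i.e. $R:E\to G$ is bounded and $G\subset F$ for every (quasi-)Banach symmetric function space $F$ on $(0,1)$ such that $R:E\to F$ is bounded. *)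

(* Defs.v *)
From HB Require Import structures.
From mathcomp Require Import all_boot all_order all_algebra.
From mathcomp Require Import all_classical all_reals all_analysis.

Set Implicit Arguments.
Unset Strict Implicit.
Unset Printing Implicit Defensive.

Import Order.TTheory GRing.Theory Num.Theory.
Import numFieldNormedType.Exports.

Local Open Scope classical_set_scope.
Local Open Scope ring_scope.

(* A function on (0,1) is a total function R -> R of which only the values on
   (0,1) matter.  Functions are not quotiented by a.e. equality: the spaces
   below are sets of functions and the notions are invariant under a.e.
   equality on (0,1). *)

Section Definitions.
Context {R : realType}.
Implicit Types (x y f g : R -> R) (E : set (R -> R)) (N : (R -> R) -> R).

Local Notation leb := (@lebesgue_measure R).

Definition I01 : set R := `]0, 1[.

Definition L1 : set (R -> R) := [set f | leb.-integrable I01 (EFin \o f)].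

(* Values are in \bar R: drearr x 0 = +oo when x is essentially unbounded
   (ereal_inf set0 = +oo); drearr x t is finite for t > 0 and measurable x. *)
Definition drearr x (t : R) : \bar R :=
  ereal_inf [set s%:E | s in
    [set s : R | 0 <= s /\ (leb [set u | I01 u /\ (s < `|x u|)%R] <= t%:E)%E]].

Record quasi_banach_symmetric E N : Prop := {
  qbs_measurable : forall x, E x -> measurable_fun I01 x;
  qbs_zero : E (cst 0);
  qbs_add : forall x y, E x -> E y -> E (x \+ y);
  qbs_scale : forall (a : R) x, E x -> E (fun t => a * x t);
  qbs_norm_ge0 : forall x, E x -> 0 <= N x;
  qbs_norm_eq0 : forall x, E x -> N x = 0 ->
    {ae leb, forall t, I01 t -> x t = 0};
  qbs_norm_scale : forall (a : R) x, E x -> N (fun t => a * x t) = `|a| * N x;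
  qbs_norm_add : exists K : R, forall x y, E x -> E y ->
    N (x \+ y) <= K * (N x + N y);
  qbs_complete : forall u : nat -> R -> R, (forall n, E (u n)) ->
    (forall e : R, 0 < e -> exists n0 : nat, forall m n : nat,
      (n0 <= m)%N -> (n0 <= n)%N -> N (u m \- u n) < e) ->
    exists2 x, E x & N (u n \- x) @[n --> \oo] --> (0 : R);
  qbs_solid : forall x y, E x -> measurable_fun I01 y ->
    {ae leb, forall t, I01 t -> `|y t| <= `|x t|} -> E y /\ N y <= N x;
  qbs_symmetric : forall x y, E x -> measurable_fun I01 y ->
    (forall t, 0 < t < 1 -> drearr y t = drearr x t) -> E y /\ N y = N x
}.

(* The measure dF on (0,1), for F : [0,1) -> [0,1) nondecreasing.  The library
   builds Lebesgue-Stieltjes measures from bundled nondecreasing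
   right-continuous functions on the whole line, so F is first extended by 0
   on (-oo,0) and by 1 on [1,+oo), then replaced by t |-> inf_(s > t) F s.
   Clamping to [0,1] makes this total in F and is the identity on the
   functions of interest; the atom that may appear at 1 is irrelevant since
   integrals are taken over (0,1).  See stieltjes01_itv. *)
Definition ext01 (F : R -> R) (s : R) : R :=
  if s < 0 then 0 else if s < 1 then Num.max 0 (Num.min 1 (F s)) else 1.

Definition right_reg (F : R -> R) (t : R) : R :=
  inf [set ext01 F s | s in `]t, +oo[].

Lemma ext01_ge0 F s : 0 <= ext01 F s.
Proof. by rewrite /ext01; case: ifP => // _; case: ifP => // _; rewrite le_max lexx. Qed.

Lemma right_reg_lbound F t : has_lbound [set ext01 F s | s in `]t, +oo[].
Proof. by exists 0 => _ [s _ <-]; exact: ext01_ge0. Qed.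

Lemma right_reg_neq0 F t : [set ext01 F s | s in `]t, +oo[] !=set0.
Proof.
by exists (ext01 F (t + 1)); exists (t + 1) => //=; rewrite in_itv/= ltrDl ltr01.
Qed.

Lemma right_reg_le F t s : t < s -> right_reg F t <= ext01 F s.
Proof.
move=> ts; apply: ge_inf; first exact: right_reg_lbound.
by exists s => //=; rewrite in_itv/= ts.
Qed.

Lemma right_reg_nondecreasing F : nondecreasing (right_reg F).
Proof.
move=> a b ab; apply: lb_le_inf; first exact: right_reg_neq0.
move=> _ [s /= + <-]; rewrite in_itv/= andbT => bs.
exact/right_reg_le/(le_lt_trans ab).
Qed.

Lemma right_reg_right_continuous F : right_continuous (right_reg F).
Proof.
move=> a; apply/cvgrPdist_lt => e e0.
have [_ [s /= + <-] sF] :=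
  inf_adherent e0 (conj (right_reg_neq0 F a) (right_reg_lbound F a)).
rewrite in_itv/= andbT => as_.
near=> t.
have at_ : a < t by near: t; exact: nbhs_right_gt.
have ts : t < s by near: t; exact: nbhs_right_lt.
rewrite distrC ger0_norm; last first.
  by rewrite subr_ge0; exact/right_reg_nondecreasing/ltW.
by rewrite ltrBlDl; apply: le_lt_trans sF; exact: right_reg_le.
Unshelve. all: by end_near. Qed.

HB.instance Definition _ (F : R -> R) := isCumulative.Build R _ R (right_reg F)
  (@right_reg_nondecreasing F) (@right_reg_right_continuous F).

Definition stieltjes01 (F : R -> R) := lebesgue_stieltjes_measure (right_reg F).

Lemma right_regE (F : R -> R) (t : R) :
  {in `[0, 1[, forall s, 0 <= F s < 1} ->
  {in `[0, 1[ &, {homo F : a b / a <= b}} ->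
  F s @[s --> t^'+] --> F t -> 0 <= t < 1 -> right_reg F t = F t.
Proof.
move=> F01 Fnd Frc /andP[t0 t1].
have extE s : 0 <= s < 1 -> ext01 F s = F s.
  move=> /andP[s0 s1]; rewrite /ext01 ltNge s0 s1/=.
  have /F01/andP[Fs0 /ltW Fs1] : s \in `[0, 1[ by rewrite in_itv/= s0 s1.
  by rewrite min_r// max_r.
apply/eqP; rewrite eq_le; apply/andP; split; last first.
  apply: lb_le_inf; first exact: right_reg_neq0.
  move=> _ [s /= + <-]; rewrite in_itv/= andbT => ts.
  have s0 := le_trans t0 (ltW ts).
  have [s1|s1] := ltP s 1.
    by rewrite extE ?s0//; apply: Fnd; rewrite ?in_itv/= ?t0 ?s0 ?ltW.
  rewrite /ext01 ltNge s0/= ltNge s1/=.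
  by have /F01/andP[_ /ltW] : t \in `[0, 1[ by rewrite in_itv/= t0.
apply/ler_addgt0Pr => e e0.
near t^'+ => s.
have ts : t < s by near: s; exact: nbhs_right_gt.
have s1 : s < 1 by near: s; exact: nbhs_right_lt.
have Fs : `|F t - F s| < e.
  by near: s; move/cvgrPdist_lt : Frc; exact.
apply: (le_trans (right_reg_le F ts)).
rewrite extE ?s1 ?(le_trans t0 (ltW ts))//.
by move: Fs; rewrite distrC => /(le_lt_trans (ler_norm _)); rewrite ltrBlDl => /ltW.
Unshelve. all: by end_near. Qed.

Lemma stieltjes01_itv (F : R -> R) (a b : R) :
  {in `[0, 1[, forall s, 0 <= F s < 1} ->
  {in `[0, 1[ &, {homo F : s t / s <= t}} ->
  {in `[0, 1[, forall t, F s @[s --> t^'+] --> F t} ->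
  0 <= a -> a <= b -> b < 1 ->
  stieltjes01 F `]a, b] = (F b - F a)%:E.
Proof.
move=> F01 Fnd Frc a0 ab b1.
have a01 : 0 <= a < 1 by rewrite a0 (le_lt_trans ab).
have b01 : 0 <= b < 1 by rewrite b1 (le_trans a0).
rewrite /stieltjes01 /lebesgue_stieltjes_measure /measure_extension/=.
rewrite measurable_mu_extE/=; last exact: is_ocitv.
have -> : wlength (right_reg F) `]a, b] = (right_reg F b - right_reg F a)%:E.
  move: ab; rewrite le_eqVlt => /predU1P[->|ab].
    by rewrite set_itvoc0 wlength0 subrr.
  by rewrite wlength_itv/= lte_fin ab.
by rewrite !right_regE//; apply: Frc; rewrite in_itv.
Qed.

Definition lorentz_int (F : R -> R) x : \bar R :=
  (\int[stieltjes01 F]_(s in I01) drearr x s)%E.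

Definition lorentz (F : R -> R) : set (R -> R) :=
  [set x | measurable_fun I01 x /\ (lorentz_int F x < +oo)%E].

Definition lorentz_norm (F : R -> R) x : R := fine (lorentz_int F x).

(* The range of w is ]1, 1/u[ for u > 0, and ]1, +oo[ for u = 0. *)
Definition psi_of (phi : R -> R) (u : R) : R :=
  inf [set phi (u * w) / (1 + ln w) | w in
    [set w : R | 1 < w /\ (0 < u -> w < u^-1)]].

(* Extended-valued so that it applies to decreasing rearrangements; on a
   real-valued x in L1 it is used as calderon (EFin \o x). *)
Definition calderon (f : R -> \bar R) (t : R) : \bar R :=
  ((t^-1)%:E * \int[leb]_(s in `]0%R, t[) f s
   + \int[leb]_(s in `]t, 1%R[) (f s * (s^-1)%:E))%E.

Definition weak_L1 : set (R -> R) :=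
  [set x | measurable_fun I01 x /\
    (ereal_sup [set t%:E * drearr x t | t in `]0%R, 1%R]] < +oo)%E].

Definition S_majorant E x : set (R -> R) :=
  [set y | E y /\
    forall t : R, 0 < t < 1 -> (drearr x t <= calderon (drearr y) t)%E].

Definition S_space E : set (R -> R) :=
  [set x | weak_L1 x /\ S_majorant E x !=set0].

Definition S_norm E N x : R := inf [set N y | y in S_majorant E x].

(* Equality of quasi-normed function spaces: the same elements, and
   equivalent quasi-norms. *)
Definition same_space E N E' N' : Prop :=
  E = E' /\ exists C : R, forall x, E x -> N x <= C * N' x /\ N' x <= C * N x.

Definition dyadic_itv (n : nat) : set (set R) :=
  [set `](j%:R / 2 ^+ n), (j.+1%:R / 2 ^+ n)[%classic | j in
    [set j : nat | (j < 2 ^ n)%N]].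

(* The sigma-algebra on (0,1) generated by the open dyadic intervals; the
   dyadic points form a null set of it. *)
Definition dyadic_algebra (n : nat) : set (set R) := <<s I01, dyadic_itv n >>.

(* g is a version of the conditional expectation of f given the
   sigma-algebra G on (0,1). *)
Definition is_cond_exp (G : set (set R)) f g : Prop :=
  [/\ L1 g,
      forall B : set R, measurable B -> G (I01 `&` g @^-1` B) &
      forall A : set R, G A ->
        (\int[leb]_(t in A) (g t)%:E = \int[leb]_(t in A) (f t)%:E)%E].

Definition cvg_in_measure (u : nat -> R -> R) g : Prop :=
  forall e : R, 0 < e ->
    leb [set t | I01 t /\ e < `|u n t - g t|] @[n --> \oo] --> 0%E.

(* Operators are given by their graphs, the value being determined up to a.e.
   equality: martingale_transform f g means that f is in L1, that the series
   defining T f converges in measure, and that g is a version of its sum. *)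
Definition martingale_transform f g : Prop :=
  [/\ L1 f, measurable_fun I01 g &
      exists2 e : nat -> R -> R,
        forall n, is_cond_exp (dyadic_algebra n) f (e n) &
        cvg_in_measure (fun n t => \sum_(m < n)
          (e m.*2 t - (if m == 0%N :> nat then 0 else e m.*2.-1 t))) g].

Definition bounded_op (T : (R -> R) -> (R -> R) -> Prop) E N E' N' : Prop :=
  exists C : R, forall f, E f -> exists g, [/\ T f g, E' g & N' g <= C * N f].

Definition optimal_range (T : (R -> R) -> (R -> R) -> Prop) E N G NG : Prop :=
  [/\ quasi_banach_symmetric G NG,
      bounded_op T E N G NG &
      forall F NF, quasi_banach_symmetric F NF -> bounded_op T E N F NF ->
        G `<=` F].

End Definitions.

(* Main.v *)
(* Write d_x(l) = m(|x| > l) and k(v, .) = S 1_(0,v).  By the layer cake formula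
   the norm of [x] in a Lorentz space is the integral over l of F(d_x(l)), and
   S mu(y) is the integral of k(d_y(l), .); so mu(x) <= S mu(y) bounds the
   [psi]-norm of [x] by the [phi]-norm of [y] as soon as this holds for indicators,
   which is the Hardy type hypothesis.  Conversely, given [x] in the [psi]-space,
   choose at each height A 2^n a point v_n nearly attaining the infimum that
   defines psi(d_x(A 2^n)); the supremum of suitable multiples of the functions
   1_(0,v_n) is a [y] with mu(x) <= S mu(y).

   The transform satisfies mu(t; T f) <= 8 (S mu(f))(t): truncate [f] at height
   mu(t; f), use the weak type (1,1) inequality for the unbounded part, and for the
   bounded part test against the sign of T f on the set where it is large, T being
   self-adjoint and a contraction of L2.  Applied to partial sums, the same tools
   show that they are Cauchy in measure.

   For optimality, let Y = mu(y) and let [f] be Y(2^-(2m+1)) on the dyadic block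
   (2^-(2m+1), 2^-2m) and 0 on the other blocks.  Then 0 <= f(t) <= Y(t / 2), whereas
   on the block all even martingale differences of [f] are nonnegative and
   108 T f >= (S Y)(2^-(2m+3)).  Hence every symmetric range of T contains each [x]
   with mu(x) <= S mu(y). *)
Require Import Defs.
From HB Require Import structures.
From mathcomp Require Import all_boot all_order all_algebra.
From mathcomp Require Import all_classical all_reals all_analysis.
From mathcomp Require Import measurable_realfun lra.

Set Implicit Arguments.
Unset Strict Implicit.
Unset Printing Implicit Defensive.

Import Order.TTheory GRing.Theory Num.Theory.
Import numFieldNormedType.Exports.

Local Open Scope classical_set_scope.
Local Open Scope ring_scope.

(** * Measure-theoretic preliminaries *)

(** Where psi comes from: for u < v the value k(v, u) is 1 + log(v / u), so psi(u) is the infimum of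
    phi(v) / k(v, u), the least norm in the [phi]-space of a multiple of an indicator 1_(0,v) whose
    image under S is at least 1 on (0, u). In the other direction k(v, t) = v + int_t^1 min(v, r) /
    r^2 dr; integrated against d psi this gives v times the total mass plus int_0^1 min(v, r) psi(r)
    / r^2 dr, and for v < 1 the last integral is the left side of the hypothesis at v. Two obstacles
    shape the development. As an infimum, psi is only shown to be increasing with psi(t) / t
    decreasing; so the theory of Lorentz spaces rests on [quasi_concave], with a factor 2 in the
    triangle inequality. And phi, psi and the hypothesis say nothing at the point 1, a value that
    distribution functions do take: there the Stieltjes mass of (0, 1) stands in for the missing
    value, and estimates at 1 are recovered from points below 1. *)

Section LayerCake.
Local Open Scope ereal_scope.
Context d (T : measurableType d) (R : realType).
Variable nu : {sigma_finite_measure set T -> \bar R}.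

Local Notation leb := (@lebesgue_measure R).

Lemma lebesgue_below (y : \bar R) : 0 <= y ->
  leb [set l : R | (0 < l)%R /\ l%:E < y] = y.
Proof.
case: y => [r| |//].
- rewrite lee_fin => r0.
  rewrite [X in leb X](_ : _ = `]0%R, r[%classic); last first.
    by apply/seteqP; split => l /=; rewrite in_itv/= lte_fin => /andP.
  rewrite lebesgue_measure_itv/= lte_fin sube0; case: ltP => // r0'.
  by congr EFin; apply/eqP; rewrite eq_le r0 r0'.
- move=> _; rewrite [X in leb X](_ : _ = `]0%R, +oo[%classic); last first.
    apply/seteqP; split => l /=; rewrite in_itv/= andbT; first by case.
    by move=> l0; split => //; rewrite ltry.
  by rewrite lebesgue_measure_itv/= ltry.
Qed.

Let layer (h : T -> \bar R) : set (T * R) := [set z | (0 < z.2)%R /\ z.2%:E < h z.1].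

Let measurable_layer (h : T -> \bar R) : measurable_fun setT h -> measurable (layer h).
Proof.
move=> mh.
have -> : layer h = ([set: T * R] `&` [set z | (0%:E < (z.2)%:E)%E]) `&`
   ([set: T * R] `&` [set z | (z.2)%:E < h z.1]).
  by apply/seteqP; split => z /=; rewrite /layer/= lte_fin; tauto.
have m2 : measurable_fun setT (fun z : T * R => (z.2)%:E).
  by apply/measurable_EFinP; exact: measurable_snd.
apply: measurableI.
  by apply: emeasurable_fun_o_infty.
apply: measurable_lte => //.
by apply: measurableT_comp.
Qed.

Lemma layer_cakeT (h k : T -> \bar R) :
  measurable_fun setT h -> measurable_fun setT k ->
  (forall s, 0 <= h s) -> (forall s, 0 <= k s) ->
  \int[nu]_s (h s * k s) =
  \int[leb]_(l in `]0%R, +oo[) \int[nu]_(s in [set s | l%:E < h s]) k s.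
Proof.
move=> mh mk h0 k0.
pose F (z : T * R) : \bar R := k z.1 * (\1_(layer h) z)%:E.
have mF : measurable_fun setT F.
  apply: emeasurable_funM; first by apply: measurableT_comp.
  by apply/measurable_EFinP/measurable_indic; exact: measurable_layer.
have F0 z : 0 <= F z by rewrite mule_ge0// lee_fin.
transitivity (\int[nu]_s \int[leb]_l F (s, l)).
  apply: eq_integral => s _; rewrite /F/=.
  pose L := [set l : R | (0 < l)%R /\ l%:E < h s].
  have mL : measurable L.
    rewrite [X in measurable X](_ : _ = xsection (layer h) s).
      by apply: measurable_xsection; exact: measurable_layer.
    by apply/seteqP; split => l /=; rewrite /xsection/= inE.
  transitivity (\int[leb]_l (k s * (\1_L l)%:E)); last first.
    by apply: eq_integral => l _; congr (_ * _%:E); rewrite !indicE; congr ((_ : bool)%:R); apply/idP/idP; rewrite !inE.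
  rewrite ge0_integralZl//; last by apply/measurable_EFinP/measurable_indic.
  by rewrite integral_indic// setIT muleC; congr (_ * _); rewrite -[LHS]lebesgue_below.
rewrite (fubini_tonelli (m1 := nu) (m2 := leb) F mF F0).
rewrite [RHS]integral_mkcond; apply: eq_integral => l _.
rewrite patchE; case: ifPn => [|lN].
  rewrite inE/= in_itv/= andbT => l0.
  rewrite [RHS]integral_mkcond; apply: eq_integral => s _.
  rewrite patchE /F indicE/=; case: ifPn; rewrite ?inE/=.
    by move=> ls; rewrite mem_set ?mule1.
  by move/negP; rewrite inE => ls; rewrite memNset ?mule0// => -[].
apply: integral0_eq => s _; rewrite /F indicE memNset ?mule0// => -[/= l0 _].
by move: lN; rewrite notin_setE/= in_itv/= l0.
Qed.

(** The weight [k] becomes [s^-1] in the second half of the Calderon operator and the absolute value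
    of the test function in [lower_pairing]. *)
Lemma layer_cake (D : set T) (h k : T -> \bar R) : measurable D ->
  measurable_fun D h -> measurable_fun D k ->
  (forall s, D s -> 0 <= h s) -> (forall s, D s -> 0 <= k s) ->
  \int[nu]_(s in D) (h s * k s) =
  \int[leb]_(l in `]0%R, +oo[) \int[nu]_(s in D `&` [set s | l%:E < h s]) k s.
Proof.
move=> mD mh mk h0 k0.
have e0 (g : T -> \bar R) : (forall s, D s -> 0 <= g s) -> forall s, 0 <= (g \_ D) s.
  by move=> g0 s; rewrite patchE; case: ifPn => //; rewrite inE => /g0.
rewrite integral_mkcond.
transitivity (\int[nu]_s ((h \_ D) s * (k \_ D) s)).
  by apply: eq_integral => s _; rewrite !patchE; case: ifPn => // _; rewrite mule0.
have mr (g : T -> \bar R) : measurable_fun D g -> measurable_fun setT (g \_ D).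
  by move=> mg; apply/(measurable_restrictT _ mD).
rewrite (layer_cakeT (mr _ mh) (mr _ mk) (e0 _ h0) (e0 _ k0)).
apply: eq_integral => l; rewrite inE/= in_itv/= andbT => l0.
rewrite integral_mkcond [RHS]integral_mkcond; apply: eq_integral => s _.
rewrite !patchE; have [sD|sD] := boolP (s \in D).
  have -> // : (s \in [set s | l%:E < (h \_ D) s]) = (s \in D `&` [set s | l%:E < h s]).
  apply/idP/idP; rewrite !inE/= patchE sD; first by rewrite inE in sD.
  by case.
rewrite if_same (_ : _ \in _ = false)//.
by apply/negbTE/negP; rewrite inE/= => -[/mem_set]; rewrite (negbTE sD).
Qed.

Lemma layer_cake1 (D : set T) (h : T -> \bar R) : measurable D ->
  measurable_fun D h -> (forall s, D s -> 0 <= h s) ->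
  \int[nu]_(s in D) h s =
  \int[leb]_(l in `]0%R, +oo[) nu (D `&` [set s | l%:E < h s]).
Proof.
move=> mD mh h0.
transitivity (\int[nu]_(s in D) (h s * cst 1 s)).
  by apply: eq_integral => s _; rewrite mule1.
rewrite layer_cake//; apply: eq_integral => l _; rewrite integral_cst ?mul1e//.
exact: emeasurable_fun_o_infty.
Qed.

End LayerCake.

Section Primitives.
Context (R : realType).
Local Notation leb := (@lebesgue_measure R).

Lemma integral_is_derive_oo (f F : R -> R) (a b : R) : a <= b ->
  (forall x, a <= x <= b -> {for x, continuous f}) ->
  (forall x, a <= x <= b -> is_derive x 1 F (f x)) ->
  (\int[leb]_(x in `]a, b[) (f x)%:E = (F b - F a)%:E)%E.
Proof.
rewrite le_eqVlt => /predU1P[->|ab] cf dF.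
  by rewrite set_itvoo0 integral_set0 subrr.
have wf : {within `[a, b], continuous f}.
  by apply: continuous_in_subspaceT => x; rewrite inE/= in_itv/=; exact: cf.
have cF x : a <= x <= b -> {for x, continuous F}.
  move=> /dF [dFx _]; apply: differentiable_continuous.
  exact/derivable1_diffP.
have mf : measurable_fun `]a, b[ f.
  apply: (@measurable_funS _ _ _ _ `[a, b]) => //; first exact: subset_itv_oo_cc.
  by apply: subspace_continuous_measurable_fun.
rewrite EFinB -(continuous_FTC2 (f := f) (F := F) ab)//.
- by apply/esym/integral_itv_bndoo; exact/measurable_EFinP.
- split => [x||].
  + by rewrite in_itv/= => /andP[/ltW ax /ltW xb]; case: (dF x); rewrite ?ax.
  + by apply: cvg_at_right_filter; apply: cF; rewrite lexx ltW.
  + by apply: cvg_at_left_filter; apply: cF; rewrite lexx ltW.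
- move=> x; rewrite in_itv/= => /andP[/ltW ax /ltW xb].
  by rewrite derive1E; case: (dF x) => //; rewrite ax.
Qed.

Lemma integral_inv (a b : R) : 0 < a -> a <= b ->
  (\int[leb]_(x in `]a, b[) (x^-1)%:E = (ln b - ln a)%:E)%E.
Proof.
move=> a0 ab; apply: (integral_is_derive_oo (F := @ln R)) => // x /andP[ax _];
  have x0 := lt_le_trans a0 ax.
- by apply: inv_continuous; rewrite gt_eqF.
- exact: is_derive1_ln.
Qed.

Lemma integral_inv_sqr (a b : R) : 0 < a -> a <= b ->
  (\int[leb]_(x in `]a, b[) (x ^- 2)%:E = (a^-1 - b^-1)%:E)%E.
Proof.
move=> a0 ab.
have -> : a^-1 - b^-1 = - b^-1 - - a^-1 by rewrite opprK addrC.
apply: (integral_is_derive_oo (F := fun x => - x^-1)) => // x /andP[ax _];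
  have x0 := lt_le_trans a0 ax.
- by apply: continuousV; [rewrite gt_eqF// exprn_gt0|exact: exprn_continuous].
- have xN0 : x != 0 by rewrite gt_eqF.
  have := @is_deriveV R id x 1 1 xN0 _ => H.
  have := is_deriveN (H (is_derive_id _ _)).
  by rewrite scaleNr opprK [_ *: _]mulr1.
Qed.

End Primitives.

(** * Completeness for convergence in measure *)

Section ConvergenceInMeasure.
Context (R : realType).
Local Notation leb := (@lebesgue_measure R).

Lemma ge0_cvge0P (a : nat -> \bar R) : (forall n, 0 <= a n)%E ->
  a @ \oo --> 0%E <->
  (forall e : R, 0 < e -> exists N, forall n, (N <= n)%N -> (a n <= e%:E)%E).
Proof.
move=> a0; split.
  move=> /fine_cvgP[fa /cvgrPdist_le ca] e /ca ae.
  have [N _ NP] : \forall n \near \oo, a n \is a fin_num /\ `|0 - (fine \o a) n| <= e.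
    by near=> n; split; near: n.
  exists N => n /NP [/fineK <-]; rewrite sub0r normrN lee_fin.
  exact/le_trans/ler_norm.
move=> H; apply/fine_cvgP.
have fa e : 0 < e -> \forall n \near \oo, a n \is a fin_num /\ (a n <= e%:E)%E.
  move=> /H[N NP]; exists N => // n /NP an; split => //.
  by rewrite ge0_fin_numE// (le_lt_trans an)// ltry.
split; first by have [N _ NP] := fa 1 ltr01; exists N => // n /NP [].
apply/cvgrPdist_le => e /fa [N _ NP]; exists N => // n /NP[/fineK an].
rewrite -an lee_fin => ane /=; rewrite sub0r normrN ger0_norm//.
exact/fine_ge0.
Unshelve. all: by end_near. Qed.

Lemma measurable_dev (u v : R -> R) (e : R) :
  measurable_fun I01 u -> measurable_fun I01 v ->
  measurable [set t | I01 t /\ e < `|u t - v t|].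
Proof.
move=> mu mv.
rewrite (_ : [set _ | _] = I01 `&` [set t | (e%:E < (`|u t - v t|)%:E)%E]) //.
apply: emeasurable_fun_o_infty => //; first exact: measurable_itv.
by apply/measurable_EFinP/measurableT_comp => //; exact: measurable_funB.
Qed.

Let half_pow (k : nat) : R := 2 ^- k.

Let half_pow_gt0 k : 0 < half_pow k.
Proof. by rewrite invr_gt0 exprn_gt0. Qed.

Let half_powS k : half_pow k = half_pow k.+1 + half_pow k.+1.
Proof.
have /= := @splitr R (half_pow k); rewrite /half_pow exprS invfM => {1}->.
by rewrite mulrC.
Qed.

Let half_pow_small (e : R) : 0 < e -> exists k, half_pow k < e.
Proof.
move=> e0; have /cvgrPdist_lt /(_ _ e0) [N _ NP] : half_pow n @[n --> \oo] --> (0 : R).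
  rewrite (_ : half_pow = fun n => (2^-1) ^+ n); last first.
    by apply/funext => n; rewrite /half_pow exprVn.
  by apply: cvg_expr; rewrite ger0_norm ?invr_ge0// invf_lt1// ltr1n.
by exists N; have := NP N (leqnn _); rewrite sub0r normrN gtr0_norm.
Qed.

Lemma near_geometric_cvg (v : nat -> R) K :
  (forall k, (K <= k)%N -> `|v k.+1 - v k| <= half_pow k) ->
  exists l : R, v @ \oo --> l /\
    forall k, (K <= k)%N -> `|v k - l| <= half_pow k + half_pow k.
Proof.
move=> vK.
(* The right-hand side is the sum of [half_pow i] for [i] from [k] to [k + j - 1] in closed form, so
   the induction closes exactly. *)
have vd k j : (K <= k)%N -> `|v (k + j)%N - v k| <= (half_pow k + half_pow k) - (half_pow (k + j)%N + half_pow (k + j)%N).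
  move=> Kk; elim: j => [|j IH]; first by rewrite addn0 !subrr normr0.
  have := vK (k + j)%N (leq_trans Kk (leq_addr _ _)).
  have := half_powS (k + j)%N; rewrite addnS => e1 h.
  have -> : v (k + j).+1 - v k = (v (k + j).+1 - v (k + j)%N) + (v (k + j)%N - v k) by lra.
  apply: (le_trans (ler_normD _ _)); lra.
have cv : cvgn v.
  apply/cauchy_cvgP/cauchy_exP => e e0.
  have [k ke] := half_pow_small (divr_gt0 e0 (ltr0n _ 2)).
  exists (v (K + k)%N); exists (K + k)%N => // n /= /subnKC <-.
  rewrite -ball_normE /= distrC; apply: le_lt_trans (vd _ _ (leq_addr _ _)) _.
  have kK : half_pow (K + k)%N <= half_pow k.
    rewrite /half_pow lef_pV2 ?posrE ?exprn_gt0// ler_eXn2l ?ltr1n//.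
    by rewrite leq_addl.
  have := half_pow_gt0 (K + k + (n - (K + k)))%N; lra.
exists (limn v); split => // k Kk.
apply/ler_addgt0Pr => e e0.
have /cvgrPdist_le/(_ _ e0)[N _ NP] := cv.
have := NP (k + N)%N (leq_addl _ _); have := vd k N Kk.
have := half_pow_gt0 (k + N)%N.
have := ler_normD (v k - v (k + N)%N) (v (k + N)%N - limn v).
rewrite addrA subrK [`|v (k + N)%N - v k|]distrC [`|v (k + N)%N - limn v|]distrC; lra.
Qed.

(** Riesz's argument: along the indices [nk k] consecutive terms differ by more than [half_pow k]
    only on a set of measure at most [half_pow k], so off the small tail unions [C K] the
    subsequence converges geometrically. *)
Lemma cauchy_in_measure_cvg (u : nat -> R -> R) :
  (forall n, measurable_fun I01 (u n)) ->
  (forall e : R, 0 < e -> exists N, forall m n, (N <= m)%N -> (N <= n)%N ->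
    (leb [set t | I01 t /\ (e < `|u m t - u n t|)%R] <= e%:E)%E) ->
  exists g : R -> R, measurable_fun I01 g /\ cvg_in_measure u g.
Proof.
move=> mu cu.
have /choice[N NP] : forall k, exists N, forall m n, (N <= m)%N -> (N <= n)%N ->
    (leb [set t | I01 t /\ (half_pow k < `|u m t - u n t|)%R] <= (half_pow k)%:E)%E.
  by move=> k; exact/cu/half_pow_gt0.
(* The sum dominates each [N i] with [i <= k], so both [nk k] and [nk k.+1] are late enough for the
   tolerance [half_pow k]. *)
pose nk k := (\sum_(i < k.+1) N i)%N.
have Nnk k j : (k <= j)%N -> (N k <= nk j)%N.
  by move=> kj; rewrite /nk (bigD1 (Ordinal (kj : k < j.+1)%N)) //= leq_addr.
pose v k := u (nk k).
(* An upper limit is defined and measurable everywhere, including where the subsequence diverges. *)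
pose g t := fine (limn_esup (fun k => (v k t)%:E)).
pose B k := [set t | I01 t /\ half_pow k < `|v k.+1 t - v k t|].
have mB k : measurable (B k) by apply: measurable_dev; exact: mu.
have lB k : (leb (B k) <= (half_pow k)%:E)%E.
  by apply: NP; exact: Nnk.
pose C K := \bigcup_k B (K + k)%N.
have mC K : measurable (C K) by apply: bigcup_measurable => k _.
have lC K : (leb (C K) <= (half_pow K + half_pow K)%:E)%E.
  apply: (@le_trans _ _ (\sum_(0 <= k <oo) leb (B (K + k)%N))%E).
    by apply: measure_sigma_subadditive => [k||]; [exact: mB|exact: mC|].
  have hp0 : 0 <= half_pow K + half_pow K by have := half_pow_gt0 K; lra.
  apply: le_trans (epsilon_trick0 xpredT hp0).
  apply: lee_nneseries => [k _ //|k _]; apply: le_trans (lB _) _; rewrite lee_fin.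
  have -> : (half_pow K + half_pow K) / (2 ^ k.+1)%:R = half_pow K * half_pow k.
    by rewrite (half_powS k) /half_pow natrX mulrDl mulrDr.
  by rewrite /half_pow exprD invfM.
have gC K t : I01 t -> ~ C K t -> forall k, (K <= k)%N -> `|v k t - g t| <= half_pow k + half_pow k.
  move=> It nC.
  have vK k : (K <= k)%N -> `|v k.+1 t - v k t| <= half_pow k.
    move=> Kk; rewrite leNgt; apply/negP => h; apply: nC.
    by exists (k - K)%N => //; rewrite subnKC.
  have [l [vl vkl]] := near_geometric_cvg vK.
  suff -> : g t = l by [].
  rewrite /g; have /cvg_limn_einf_sup[_ ->] // : (v k t)%:E @[k --> \oo] --> l%:E.
  by apply: (@cvg_EFin _ _ _ _ (fun k => (v k t)%:E)) => //; exact: nearW.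
have mg : measurable_fun I01 g.
  apply: (@measurableT_comp _ _ _ _ _ _ (fine : \bar R -> R)) => //.
  by apply: measurable_fun_limn_esup => k; apply/measurable_EFinP; exact: mu.
exists g; split => // e e0; apply/ge0_cvge0P => // d d0.
have [k ke] := half_pow_small (divr_gt0 e0 (ltr0n _ 3)).
have [j jd] := half_pow_small (divr_gt0 d0 (ltr0n _ 3)).
pose K := (k + j)%N.
have [Kk Kj] : half_pow K <= half_pow k /\ half_pow K <= half_pow j.
  by rewrite /half_pow !lef_pV2 ?posrE ?exprn_gt0// !ler_eXn2l ?ltr1n// leq_addl leq_addr.
exists (N K) => n Nn.
have mD : measurable [set t | I01 t /\ half_pow K < `|u n t - v K t|].
  by apply: measurable_dev; exact: mu.
apply: (@le_trans _ _ (leb ([set t | I01 t /\ half_pow K < `|u n t - v K t|] `|` C K))).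
  apply: le_measure; rewrite ?inE; [by apply: measurable_dev => //; exact: mu| |].
    by apply: measurableU; [exact: mD|exact: mC].
  move=> t [It et]; have [CK|nCK] := pselect (C K t); [by right|left; split => //].
  have := gC _ _ It nCK K (leqnn _).
  have := ler_normD (u n t - v K t) (v K t - g t); rewrite addrA subrK; lra.
apply: (@le_trans _ _ ((half_pow K)%:E + (half_pow K + half_pow K)%:E)%E).
  apply: le_trans (measureU2 _ _ _) _; [exact: mD|exact: mC|].
  apply: leeD; last exact: (lC K).
  exact: (NP K n (nk K) Nn (Nnk _ _ (leqnn K))).
rewrite -EFinD lee_fin; lra.
Qed.

End ConvergenceInMeasure.

(* Sealed, like [fundamental] and [rearr_int] below: conversion tests that fail
   on these constants would otherwise unfold the underlying measures. *)
HB.lock Definition distr (R : realType) (x : R -> R) (l : R) : R :=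
  fine (@lebesgue_measure R [set u | I01 u /\ l < `|x u|]).

(** * Distribution functions and rearrangements *)

Section Rearrangement.
Context (R : realType).
Implicit Types (x y Y : R -> R) (l s t : R).
Local Notation leb := (@lebesgue_measure R).

(** A superlevel set of [f] is the trace on [D] of its downward closure, which is an interval. *)
Lemma antitone_emeasurable (D : set R) (f : R -> \bar R) : measurable D ->
  (forall s t, D s -> D t -> s <= t -> (f t <= f s)%E) -> measurable_fun D f.
Proof.
move=> mD fD.
apply: (measurability (@ErealGenOInfty.G R)) => [|/= _ [_ [r ->] <-]].
  exact: ErealGenOInfty.measurableE.
rewrite [X in measurable X](_ : _ =
    D `&` [set s | exists t, [/\ D t, s <= t & (r%:E < f t)%E]]); last first.
  apply/seteqP; split => s /= [Ds].
    by rewrite in_itv/= andbT => h; split => //; exists s.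
  move=> [t [Dt st h]]; split => //; rewrite in_itv/= andbT.
  exact: lt_le_trans h (fD _ _ _ _ _).
apply: measurableI => //; apply: is_interval_measurable => s t /=.
move=> _ [v [Dv tv h]] u /andP[su ut]; exists v; split => //.
exact: le_trans tv.
Qed.

Lemma leb_I01 : leb I01 = 1%E.
Proof. by rewrite lebesgue_measure_itv/= lte_fin ltr01 sube0. Qed.

Lemma measurable_I01 : measurable (I01 : set R).
Proof. exact: measurable_itv. Qed.

Section Measurable.
Variables (x : R -> R) (mx : measurable_fun I01 x).

Lemma measurable_superlevel l : measurable [set u | I01 u /\ l < `|x u|].
Proof.
rewrite (_ : [set _ | _] = I01 `&` [set u | (l%:E < (`|x u|)%:E)%E]) //.
apply: emeasurable_fun_o_infty => //; first exact: measurable_I01.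
by apply/measurable_EFinP/measurableT_comp.
Qed.

Lemma superlevel_le1 l : (leb [set u | (I01 u /\ (l < `|x u|)%R)] <= 1%:E)%E.
Proof.
rewrite -leb_I01; apply: le_measure; rewrite ?inE; last by move=> u [].
  exact: measurable_superlevel.
exact: measurable_I01.
Qed.

Lemma distrE l : leb [set u | I01 u /\ l < `|x u|] = (distr x l)%:E.
Proof.
rewrite distr.unlock fineK// ge0_fin_numE// (le_lt_trans (superlevel_le1 _))//.
exact: ltry.
Qed.

Lemma distr_ge0 l : 0 <= distr x l.
Proof. by rewrite distr.unlock fine_ge0. Qed.

Lemma distr_le1 l : distr x l <= 1.
Proof. by rewrite -lee_fin -distrE superlevel_le1. Qed.

Lemma distr_anti l l' : l <= l' -> distr x l' <= distr x l.
Proof.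
move=> ll'; rewrite -lee_fin -!distrE; apply: le_measure; rewrite ?inE.
- exact: measurable_superlevel.
- exact: measurable_superlevel.
- by move=> u [Iu h]; split => //; exact: le_lt_trans h.
Qed.

(** Continuity of the measure from below along the heights [l + n.+1%:R^-1]. This right continuity
    of [distr x] is what makes [drearr_gtE] exact. *)
Lemma distr_right_open t l : t < distr x l -> exists2 e, 0 < e & t < distr x (l + e).
Proof.
move=> tl; pose F n := [set u | I01 u /\ l + n.+1%:R^-1 < `|x u|].
have UF : \bigcup_n F n = [set u | I01 u /\ l < `|x u|].
  apply/seteqP; split => u.
    move=> [n _ [Iu h]]; split => //; apply: le_lt_trans h.
    by rewrite lerDl invr_ge0.
  move=> [Iu h]; have := h; rewrite -subr_gt0 => /ltr_add_invr[n].
  by rewrite add0r => hn; exists n => //; split => //; rewrite -ltrBrDl.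
have mF n : measurable (F n) by exact: measurable_superlevel.
have nF : {homo F : n m / (n <= m)%N >-> (n <= m)%O}.
  move=> n m nm; apply/subsetPset => u [Iu h]; split => //.
  by apply: le_lt_trans h; rewrite lerD2l lef_pV2 ?posrE// ler_nat.
have cF : leb (F n) @[n --> \oo] --> leb (\bigcup_n F n).
  apply: nondecreasing_cvg_mu => //; rewrite UF; exact: measurable_superlevel.
move: cF; rewrite UF distrE; under eq_fun do rewrite distrE.
move=> /fine_cvg/= /cvgr_gt /(_ _ tl) [n _ /(_ n (leqnn _))] h.
by exists (n.+1%:R^-1).
Qed.

Lemma distr_vanish t : 0 < t -> exists2 s, 0 <= s & distr x s <= t.
Proof.
move=> t0; pose F n := [set u | I01 u /\ n%:R < `|x u|].
have IF : \bigcap_n F n = set0.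
  apply/seteqP; split => u // h; have [_] := h (Num.bound `|x u|) I.
  by move=> /(lt_trans (archi_boundP (normr_ge0 _))); rewrite ltxx.
have mF n : measurable (F n) by exact: measurable_superlevel.
have nF : {homo F : n m / (n <= m)%N >-> (m <= n)%O}.
  move=> n m nm; apply/subsetPset => u [Iu h]; split => //.
  by apply: le_lt_trans h; rewrite ler_nat.
have cF : leb (F n) @[n --> \oo] --> leb (\bigcap_n F n).
  apply: nonincreasing_cvg_mu => //; last by rewrite IF; exact: measurable0.
  by rewrite [ltLHS](distrE 0%:R) ltry.
move: cF; rewrite IF measure0; under eq_fun do rewrite distrE.
move=> /fine_cvg/= /cvgr_lt /(_ _ t0) [n _ /(_ n (leqnn _))] h.
by exists n%:R => //; exact: ltW.
Qed.

End Measurable.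

Section Drearr.
Variables (x : R -> R) (mx : measurable_fun I01 x).

Lemma drearr_ge0 t : (0 <= drearr x t)%E.
Proof. by apply: le_ereal_inf_tmp => _ [s [s0 _] <-]; rewrite lee_fin. Qed.

(** Rearrangement and distribution function form a Galois connection with strict inequalities on
    both sides; rearrangements are compared through it. *)
Lemma drearr_gtE s t : 0 <= s -> (s%:E < drearr x t)%E = (t < distr x s).
Proof.
move=> s0; apply/idP/idP.
  apply: contraTT; rewrite -leNgt -leNgt => h; apply: ereal_inf_lbound.
  by exists s => //; split => //; rewrite distrE// lee_fin.
move=> /(distr_right_open mx)[e e0 te]; apply: (@lt_le_trans _ _ (s + e)%:E).
  by rewrite lte_fin ltrDl.
apply: le_ereal_inf_tmp => _ [r [r0 rt] <-]; rewrite lee_fin leNgt; apply/negP => rse.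
move: rt; rewrite distrE// lee_fin => /le_lt_trans/(_ te); rewrite ltNge.
by rewrite (distr_anti mx (ltW rse)).
Qed.

Lemma drearr_fin t : 0 < t -> drearr x t \is a fin_num.
Proof.
move=> /(distr_vanish mx)[s s0 st]; rewrite ge0_fin_numE ?drearr_ge0//.
by rewrite (@le_lt_trans _ _ s%:E) ?ltry// leNgt drearr_gtE// -leNgt.
Qed.

Lemma drearr_anti s t : s <= t -> (drearr x t <= drearr x s)%E.
Proof.
move=> st; apply: le_ereal_inf_tmp => _ [r [r0 rt] <-].
by apply: ereal_inf_lbound; exists r => //; split => //; apply: le_trans rt _; rewrite lee_fin.
Qed.

Lemma measurable_drearr D : measurable D -> measurable_fun D (drearr x).
Proof. by move=> mD; apply: antitone_emeasurable => // s t _ _; exact: drearr_anti. Qed.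

End Drearr.

Lemma drearr_le x y (mx : measurable_fun I01 x) (my : measurable_fun I01 y) :
  (forall l, 0 <= l -> distr x l <= distr y l) ->
  forall t, (drearr x t <= drearr y t)%E.
Proof.
move=> xy t; apply: le_ereal_inf_tmp => _ [r [r0 rt] <-].
apply: ereal_inf_lbound; exists r => //; split => //; rewrite distrE// lee_fin.
by apply: (le_trans (xy _ r0)); rewrite -lee_fin -distrE.
Qed.

Lemma antitone_measurable Y : (forall s t, I01 s -> I01 t -> s <= t -> Y t <= Y s) ->
  measurable_fun I01 Y.
Proof.
move=> aY; apply/measurable_EFinP; apply: antitone_emeasurable => [|s t Is It st].
  exact: measurable_I01.
by rewrite lee_fin aY.
Qed.

(** A decreasing function and its rearrangement may differ at jumps; the third hypothesis is right
    continuity, in the form that [drearr_gtE] calls for. *)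
Lemma drearr_id Y : (forall s, I01 s -> 0 <= Y s) ->
  (forall s t, I01 s -> I01 t -> s <= t -> Y t <= Y s) ->
  (forall t l, I01 t -> 0 <= l -> l < Y t -> exists s, [/\ I01 s, t < s & l < Y s]) ->
  forall t, I01 t -> drearr Y t = (Y t)%:E.
Proof.
move=> Y0 aY cY t It; have mY := antitone_measurable aY.
have /andP[t0 t1] : 0 < t < 1 by move: It; rewrite /I01/= in_itv.
apply/eqP; rewrite eq_le; apply/andP; split.
  apply: ereal_inf_lbound; exists (Y t) => //; split; first exact: Y0.
  apply: (@le_trans _ _ (leb `]0, t[%classic)); last first.
    by rewrite lebesgue_measure_itv/= lte_fin t0 sube0.
  apply: le_measure; rewrite ?inE; [exact: measurable_superlevel|exact: measurable_itv|].
  move=> u [Iu]; rewrite ger0_norm ?Y0// => h; move: (Iu); rewrite /I01/= !in_itv/=.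
  move=> /andP[-> u1]/=; rewrite ltNge; apply/negP => tu.
  by move: h; rewrite ltNge aY.
rewrite -(fineK (drearr_fin mY t0)) lee_fin leNgt; apply/negP => h.
have d0 : 0 <= fine (drearr Y t) by rewrite fine_ge0// drearr_ge0.
have [s [Is ts ls]] := cY _ _ It d0 h.
have : t < distr Y (fine (drearr Y t)).
  apply: (lt_le_trans ts); rewrite -lee_fin -distrE//.
  have /andP[s0 s1] : 0 < s < 1 by move: Is; rewrite /I01/= in_itv.
  have <- : leb `]0, s]%classic = s%:E.
    by rewrite lebesgue_measure_itv/= lte_fin s0 sube0.
  apply: le_measure; rewrite ?inE; [exact: measurable_itv|exact: measurable_superlevel|].
  move=> u /=; rewrite in_itv/= => /andP[u0 us].
  have Iu : I01 u by rewrite /I01/= in_itv/= u0 (le_lt_trans us).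
  by split => //; rewrite ger0_norm ?Y0//; apply: lt_le_trans ls _; exact: aY.
by rewrite -drearr_gtE// fineK ?ltxx// drearr_fin.
Qed.

(** Lets a symmetric space exchange a function for its decreasing rearrangement, made real-valued by
    [fine]; the rearrangement is finite at every [t > 0]. *)
Lemma drearr_idem x (mx : measurable_fun I01 x) :
  [/\ (forall s, I01 s -> 0 <= fine (drearr x s)),
    (forall s t, I01 s -> I01 t -> s <= t -> fine (drearr x t) <= fine (drearr x s)),
    measurable_fun I01 (fine \o drearr x) &
    forall t, I01 t -> drearr (fine \o drearr x) t = drearr x t].
Proof.
have It0 t : I01 t -> 0 < t /\ t < 1 by rewrite /I01/= in_itv => /andP.
have f0 s : I01 s -> 0 <= fine (drearr x s) by move=> _; rewrite fine_ge0// drearr_ge0.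
have fa s t : I01 s -> I01 t -> s <= t -> fine (drearr x t) <= fine (drearr x s).
  move=> /It0[s0 _] /It0[t0 _] st.
  by rewrite -lee_fin !fineK ?drearr_fin// drearr_anti.
split => //; first exact: antitone_measurable.
move=> t It; have [t0 t1] := It0 _ It.
rewrite drearr_id//=; first by rewrite fineK// drearr_fin.
move=> {t It t0 t1} t l /It0[t0 t1] l0; rewrite -lte_fin fineK ?drearr_fin// drearr_gtE// => h.
have [ts sd] := midf_lt h; set s := (_ / 2) in ts sd.
have s0 := lt_trans t0 ts.
exists s; split => //.
  by rewrite /I01/= in_itv/= s0 (lt_le_trans sd)// distr_le1.
by rewrite -lte_fin fineK ?drearr_fin// drearr_gtE.
Qed.

End Rearrangement.

HB.instance Definition _ (R : realType) (F : R -> R) :=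
  SigmaFiniteMeasure.copy (stieltjes01 F) (lebesgue_stieltjes_measure (right_reg F)).

(** The fundamental function of the Lorentz space: the norm of the indicator of []0, v[]. For
    quasi-concave [F] it agrees with [F] below 1, and at 1 it is the total mass. *)
HB.lock Definition fundamental (R : realType) (F : R -> R) (v : R) : R :=
  fine (stieltjes01 F `]0, v[%classic).

HB.lock Definition rearr_int (R : realType) (F x : R -> R) : \bar R := lorentz_int F x.

HB.lock Definition lorentz_space (R : realType) (F : R -> R) : set (R -> R) := lorentz F.

HB.lock Definition lorentz_size (R : realType) (F x : R -> R) : R := lorentz_norm F x.

(** * Lorentz spaces *)

Section Growth.
Context (R : realType).
Implicit Types (F : R -> R) (u v w : R).

(** The interface shared by [phi] and [psi_of phi]. The third clause, that [F t / t] decreases,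
    replaces concavity, which the infimum defining [psi_of phi] does not visibly inherit. *)
Definition quasi_concave F : Prop :=
  [/\ {in `[0, 1[, forall t, 0 <= F t < 1},
      {in `[0, 1[ &, {homo F : s t / s <= t}},
      forall s t, 0 <= s -> s <= t -> t < 1 -> s * F t <= t * F s,
      F t @[t --> 0^'+] --> (0 : R) &
      forall t, 0 < t < 1 -> 0 < F t].

Section Fundamental.
Variables (F : R -> R) (qF : quasi_concave F).

Let F01 (t : R) : 0 <= t -> t < 1 -> 0 <= F t < 1.
Proof. by case: qF => h _ _ _ _ t0 t1; apply: h; rewrite in_itv/= t0. Qed.

Let Fmono (s t : R) : 0 <= s -> s <= t -> t < 1 -> F s <= F t.
Proof.
case: qF => _ h _ _ _ s0 st t1.
by apply: h; rewrite // in_itv/= ?s0 ?t1 ?(le_trans s0)//= (le_lt_trans st).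
Qed.

Let Fconc (s t : R) : 0 <= s -> s <= t -> t < 1 -> s * F t <= t * F s.
Proof. by case: qF => _ _ h _ _; exact: h. Qed.

Let Fsmall (e : R) : 0 < e -> exists d : R, 0 < d < 1 /\ F d < e.
Proof.
move=> e0; case: qF => _ _ _ cF _.
near (0 : R)^'+ => d.
exists d; split.
  by apply/andP; split; near: d; [exact: nbhs_right_gt|exact: nbhs_right_lt].
by near: d; exact: (cvgr_lt _ cF).
Unshelve. all: by end_near. Qed.

Lemma quasi_concave0 : F 0 = 0.
Proof.
apply/eqP; rewrite eq_le; apply/andP; split; last first.
  by have /andP[] := F01 (lexx 0) ltr01.
apply/ler_addgt0Pr => e /Fsmall[d [/andP[d0 d1] Fd]]; rewrite add0r.
by apply: le_trans (ltW Fd); apply: Fmono => //; exact: ltW.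
Qed.

(** For [t > 0] the third clause gives [F s - F t <= (s - t) / t * F t] when [t < s]. *)
Lemma quasi_concave_right_continuous :
  {in `[0, 1[, forall t : R, F s @[s --> t^'+] --> F t}.
Proof.
move=> t; rewrite in_itv/= => /andP[]; rewrite le_eqVlt => /predU1P[<- _|t0 t1].
  by rewrite quasi_concave0; case: qF.
have /andP[Ft0 Ft1] := F01 (ltW t0) t1.
apply/cvgrPdist_le => e e0; near=> s.
have ts : t < s by near: s; exact: nbhs_right_gt.
have s1 : s < 1 by near: s; exact: nbhs_right_lt.
have st : s < t + t * e by near: s; apply: nbhs_right_lt; rewrite ltrDl mulr_gt0.
rewrite distrC ger0_norm; last by rewrite subr_ge0 Fmono// ltW.
rewrite -(ler_pM2l t0); have := Fconc (ltW t0) (ltW ts) s1; nra.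
Unshelve. all: by end_near. Qed.

Let mu01 (a b : R) : 0 <= a -> a <= b -> b < 1 -> stieltjes01 F `]a, b]%classic = (F b - F a)%:E.
Proof.
by apply: stieltjes01_itv; [case: qF|case: qF|exact: quasi_concave_right_continuous].
Qed.

(** The open right end loses no mass because [F] is also left continuous, again by the third clause:
    [k * F v <= v * F k] for [k < v]. *)
Lemma stieltjes01_oo v : 0 <= v -> v < 1 -> stieltjes01 F `]0, v[%classic = (F v)%:E.
Proof.
rewrite le_eqVlt => /predU1P[<- _|v0 v1].
  by rewrite set_itvoo0 measure0 quasi_concave0.
have le_v : (stieltjes01 F `]0%R, v[%classic <= (F v)%:E)%E.
  have := mu01 (lexx 0) (ltW v0) v1; rewrite quasi_concave0 subr0 => <-.
  by apply: le_measure; rewrite ?inE; [exact: measurable_itv..|exact: subset_itv_oo_oc].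
apply/eqP; rewrite eq_le le_v/=.
have fv : stieltjes01 F `]0, v[%classic \is a fin_num.
  by rewrite ge0_fin_numE// (le_lt_trans le_v)// ltry.
rewrite -(fineK fv) lee_fin; set m := fine _.
have mP u : 0 < u < v -> F u <= m.
  move=> /andP[u0 uv]; rewrite -lee_fin /m fineK//.
  have := mu01 (lexx 0) (ltW u0) (lt_trans uv v1); rewrite quasi_concave0 subr0 => <-.
  apply: le_measure; rewrite ?inE; [exact: measurable_itv..|].
  by move=> s /=; rewrite !in_itv/= => /andP[-> su]; exact: le_lt_trans uv.
have /andP[Fv0 Fv1] := F01 (ltW v0) v1.
apply/ler_addgt0Pr => e e0.
(* Replacing [v] by [k >= v - v * e] on the left of [k * F v <= v * F k] costs at most [v * e],
   since [F v < 1]. The maximum with [v / 2] keeps [k] positive. *)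
pose k := Num.max (v / 2) (v - v * e).
have vv : v / 2 < v by rewrite gtr_pMr// invf_lt1// ltr1n.
have k0 : 0 < k by rewrite lt_max divr_gt0.
have kv : k < v by rewrite gt_max vv/= ltrBlDr ltrDl mulr_gt0.
have vk : v - v * e <= k by rewrite le_max lexx orbT.
have := mP k; rewrite k0 kv => /(_ isT).
have := Fconc (ltW k0) (ltW kv) v1 => h1 h2.
rewrite -(ler_pM2l v0); nra.
Qed.

Lemma stieltjes01_oo1 (B : R) : (forall v, 0 <= v -> v < 1 -> F v <= B) ->
  (stieltjes01 F `]0%R, 1%R[%classic <= B%:E)%E.
Proof.
move=> FB; pose G (n : nat) := `]0%R, (1 - n.+1%:R^-1 : R)]%classic.
have UG : \bigcup_n G n = `]0, 1[%classic.
  apply/seteqP; split => t; rewrite /= in_itv/=.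
    by move=> [n _]; rewrite /G/= in_itv/= => /andP[-> /le_lt_trans]; apply; rewrite ltrBlDr ltrDl.
  move=> /andP[t0]; rewrite -subr_gt0 => /ltr_add_invr[n]; rewrite add0r => h.
  by exists n => //; rewrite /G/= in_itv/= t0/=; move: h; set c := (n.+1%:R)^-1 => h; lra.
have cG : stieltjes01 F (G n) @[n --> \oo] --> stieltjes01 F (\bigcup_n G n).
  apply: nondecreasing_cvg_mu.
  - by move=> i; exact: measurable_itv.
  - by rewrite UG; exact: measurable_itv.
  - move=> n m nm; apply/subsetPset => t; rewrite /G/= !in_itv/= => /andP[-> h] /=.
    by apply: (le_trans h); rewrite lerD2l lerN2 lef_pV2 ?posrE// ler_nat.
rewrite -UG; apply: (cvge_le _ cG); apply: nearW => n.
have n0 : (0 : R) <= 1 - n.+1%:R^-1 by rewrite subr_ge0 invf_le1// ler1n.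
have n1 : 1 - n.+1%:R^-1 < 1 :> R by rewrite ltrBlDr ltrDl.
by rewrite mu01// quasi_concave0 subr0 lee_fin; exact: FB.
Qed.

Lemma fundamentalE v : 0 <= v -> v <= 1 ->
  stieltjes01 F `]0, v[%classic = (fundamental F v)%:E.
Proof.
move=> v0 v1; rewrite fundamental.unlock fineK// ge0_fin_numE//.
apply: (@le_lt_trans _ _ 1%:E); last exact: ltry.
apply: (@le_trans _ _ (stieltjes01 F `]0, 1[%classic)).
  apply: le_measure; rewrite ?inE; [exact: measurable_itv..|].
  exact: subset_itvl.
apply: stieltjes01_oo1 => w w0 w1.
by have /andP[_ /ltW] := F01 w0 w1.
Qed.

Lemma fundamental_lt1 v : 0 <= v -> v < 1 -> fundamental F v = F v.
Proof. by move=> v0 v1; rewrite fundamental.unlock stieltjes01_oo. Qed.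

Lemma fundamental1_le (B : R) : (forall v, 0 <= v -> v < 1 -> F v <= B) ->
  fundamental F 1 <= B.
Proof. by move=> FB; rewrite -lee_fin -fundamentalE//; exact: stieltjes01_oo1. Qed.

Lemma fundamental_mono u v : 0 <= u -> u <= v -> v <= 1 -> fundamental F u <= fundamental F v.
Proof.
move=> u0 uv v1; rewrite -lee_fin -!fundamentalE//; [|exact: le_trans uv|exact: le_trans v1].
apply: le_measure; rewrite ?inE; [exact: measurable_itv..|exact: subset_itvl].
Qed.

Lemma fundamental_ge0 v : 0 <= fundamental F v.
Proof. by rewrite fundamental.unlock fine_ge0. Qed.

Lemma fundamental0 : fundamental F 0 = 0.
Proof. by rewrite fundamental_lt1// quasi_concave0. Qed.

Lemma fundamental_le1 v : 0 <= v -> v <= 1 -> fundamental F v <= 1.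
Proof.
move=> v0 v1; apply: le_trans (fundamental_mono v0 v1 (lexx 1)) _.
by apply: fundamental1_le => w w0 w1; have /andP[_ /ltW] := F01 w0 w1.
Qed.

Lemma fundamental_gt0 v : 0 < v -> v <= 1 -> 0 < fundamental F v.
Proof.
move=> v0 v1; have v2 : v / 2 < v by rewrite gtr_pMr// invf_lt1// ltr1n.
apply: lt_le_trans (fundamental_mono _ (ltW v2) v1); last by rewrite divr_ge0// ltW.
rewrite fundamental_lt1 ?(lt_le_trans v2) ?divr_ge0 ?(ltW v0)//.
by case: qF => _ _ _ _; apply; rewrite divr_gt0//= (lt_le_trans v2).
Qed.

Lemma fundamental_concave u v : 0 <= u -> u <= v -> v <= 1 ->
  u * fundamental F v <= v * fundamental F u.
Proof.
move=> u0 uv; rewrite le_eqVlt => /predU1P[v1|v1]; last first.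
  by rewrite !fundamental_lt1 ?(le_trans u0)// ?(le_lt_trans uv)//; exact: Fconc.
move: u0; rewrite le_eqVlt => /predU1P[<-|u0].
  by rewrite mul0r mulr_ge0 ?fundamental_ge0// v1.
have : u <= 1 by rewrite -v1.
rewrite le_eqVlt => /predU1P[->|u1]; first by rewrite v1.
rewrite v1 mul1r mulrC -ler_pdivlMr//; apply: fundamental1_le => w w0 w1.
rewrite fundamental_lt1 ?(ltW u0)// ler_pdivlMr//.
have Fu0 : 0 <= F u by have /andP[] := F01 (ltW u0) u1.
have [uw|/ltW wu] := leP u w; last first.
  apply: (@le_trans _ _ (F u * u)); first by apply: ler_wpM2r; [exact: ltW|exact: Fmono].
  nra.
rewrite mulrC; apply: (le_trans (Fconc (ltW u0) uw w1)).
by apply: ler_piMl => //; exact: ltW.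
Qed.

(** Write F for [fundamental F]. When [u] and [v] are below [w], add [u * F w <= w * F u] and
    [v * F w <= w * F v], and use [w <= u + v]. *)
Lemma fundamental_subadd u v w : 0 <= u -> u <= 1 -> 0 <= v -> v <= 1 ->
  0 <= w -> w <= 1 -> w <= u + v -> fundamental F w <= fundamental F u + fundamental F v.
Proof.
move=> u0 u1 v0 v1 w0 w1 wuv.
have fu := fundamental_ge0 u; have fv := fundamental_ge0 v.
have [wu|uw] := leP w u; first by have := fundamental_mono w0 wu u1; lra.
have [wv|vw] := leP w v; first by have := fundamental_mono w0 wv v1; lra.
have := fundamental_concave u0 (ltW uw) w1.
have := fundamental_concave v0 (ltW vw) w1.
have wp : 0 < w by exact: le_lt_trans uw.
move=> h1 h2; rewrite -(ler_pM2l wp); have fw := fundamental_ge0 w.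
have : 0 <= (u + v - w) * fundamental F w by apply: mulr_ge0 => //; lra.
lra.
Qed.

Lemma fundamental_dilation (K u w : R) : 1 <= K -> 0 <= u -> u <= 1 -> 0 <= w -> w <= 1 ->
  w <= K * u -> fundamental F w <= K * fundamental F u.
Proof.
move=> K1 u0 u1 w0 w1 wKu; have fu := fundamental_ge0 u.
have [wu|uw] := leP w u; first by have := fundamental_mono w0 wu u1; nra.
have := fundamental_concave u0 (ltW uw) w1.
have up : 0 < u by nra.
move=> h; rewrite -(ler_pM2l up); nra.
Qed.

Lemma fundamental_small (e : R) : 0 < e ->
  exists2 d, 0 < d & forall v, 0 <= v -> v <= d -> v <= 1 -> fundamental F v <= e.
Proof.
move=> /Fsmall[d [/andP[d0 d1] Fd]]; exists d => // v v0 vd v1.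
apply: le_trans (ltW Fd); rewrite -fundamental_lt1 ?(ltW d0)//.
by apply: fundamental_mono => //; exact: ltW.
Qed.

End Fundamental.
End Growth.

Section LorentzInt.
Context (R : realType).
Implicit Types (x y : R -> R).
Local Notation leb := (@lebesgue_measure R).
Variables (F : R -> R) (qF : quasi_concave F).

Lemma below_distr x (mx : measurable_fun I01 x) l (D : set R) : D `<=` I01 -> 0 <= l ->
  D `&` [set s | (l%:E < drearr x s)%E] = D `&` `]0, distr x l[%classic.
Proof.
move=> DI l0; apply/seteqP; split => s /= [Ds].
  rewrite drearr_gtE// => h; split => //; rewrite in_itv/= h andbT.
  by have := DI _ Ds; rewrite /I01/= in_itv/= => /andP[].
by rewrite in_itv/= => /andP[_ h]; split => //; rewrite drearr_gtE.
Qed.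

Lemma rearr_intE x : measurable_fun I01 x ->
  rearr_int F x =
  (\int[leb]_(l in `]0%R, +oo[) (fundamental F (distr x l))%:E)%E.
Proof.
move=> mx; rewrite rearr_int.unlock /lorentz_int.
rewrite (layer_cake1 (stieltjes01 F)); first last.
- by move=> s _; exact: drearr_ge0.
- by apply: measurable_drearr; exact: measurable_I01.
- exact: measurable_I01.
apply: eq_integral => l; rewrite inE/= in_itv/= andbT => l0.
rewrite below_distr ?ltW// -fundamentalE ?distr_ge0 ?distr_le1//.
congr (stieltjes01 F _); apply/setIidPr => s /=; rewrite /I01 /= !in_itv/=.
by move=> /andP[-> /lt_le_trans]; apply; exact: distr_le1.
Qed.

Lemma measurable_fundamental_distr x (mx : measurable_fun I01 x) (D : set R) :
  measurable D -> measurable_fun D (fun l => (fundamental F (distr x l))%:E).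
Proof.
move=> mD; apply: antitone_emeasurable => // s t _ _ st; rewrite lee_fin.
by apply: fundamental_mono; rewrite ?distr_ge0 ?distr_le1//; exact: distr_anti.
Qed.

Lemma rearr_int_ge0 x : (0 <= rearr_int F x)%E.
Proof. by rewrite rearr_int.unlock; apply: integral_ge0 => s _; exact: drearr_ge0. Qed.

End LorentzInt.

Lemma leb_oo (R : realType) (a b : R) : a <= b ->
  lebesgue_measure `]a, b[%classic = (b - a)%:E.
Proof.
move=> ab; rewrite lebesgue_measure_itv/= lte_fin; case: ltP => // ba.
have -> : a = b by apply/eqP; rewrite eq_le ab ba.
by rewrite subrr.
Qed.

Lemma cvg_in_measure_small (R : realType) (u : nat -> R -> R) g (l d : R) :
  cvg_in_measure u g -> 0 < l -> 0 < d -> exists M, forall n, (M <= n)%N ->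
  (lebesgue_measure [set t | I01 t /\ (l < `|u n t - g t|)%R] <= d%:E)%E.
Proof.
move=> ug l0 d0; have [H _] := ge0_cvge0P (fun n =>
  measure_ge0 lebesgue_measure [set t | I01 t /\ l < `|u n t - g t|]).
exact: H (ug _ l0) _ d0.
Qed.

Section LiminfBounds.
Context (R : realType).
Implicit Types (u : nat -> \bar R) (a : \bar R).

Lemma limn_einf_supE u : limn_einf u = ereal_sup (range (einfs u)).
Proof. by rewrite limn_einf_lim; apply/cvg_lim => //; exact: cvg_einfs_sup. Qed.

Lemma limn_einf_ge u a N : (forall n, (N <= n)%N -> (a <= u n)%E) -> (a <= limn_einf u)%E.
Proof.
move=> au; rewrite limn_einf_supE; apply: le_trans (ereal_sup_ubound _); last by exists N.
by apply: le_ereal_inf_tmp => _ [n /= Nn <-]; exact: au.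
Qed.

Lemma limn_einf_le u a N : (forall n, (N <= n)%N -> (u n <= a)%E) -> (limn_einf u <= a)%E.
Proof.
move=> ua; rewrite limn_einf_supE; apply: ge_ereal_sup => _ [n _ <-].
apply: le_trans (ua (n + N)%N (leq_addl _ _)); apply: ereal_inf_lbound.
by exists (n + N)%N => //=; exact: leq_addr.
Qed.

End LiminfBounds.

Section DistributionAlgebra.
Context (R : realType).
Implicit Types (x y : R -> R).
Local Notation leb := (@lebesgue_measure R).

Lemma distr_le x y (mx : measurable_fun I01 x) (my : measurable_fun I01 y) :
  {ae leb, forall t, I01 t -> `|y t| <= `|x t|} ->
  forall l, distr y l <= distr x l.
Proof.
move=> [N [mN N0 NP]] l; rewrite -lee_fin -!distrE//.
apply: (@le_trans _ _ (leb ([set u | I01 u /\ l < `|x u|] `|` N))).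
  apply: le_measure; rewrite ?inE; first exact: measurable_superlevel.
    by apply: measurableU => //; exact: measurable_superlevel.
  move=> u [Iu h]; have [?|nN] := pselect (N u); [by right|left; split => //].
  apply: (lt_le_trans h); apply: contrapT => nh; apply: nN; apply: NP => /=.
  by move=> /(_ Iu).
apply: (@le_trans _ _ (leb [set u | I01 u /\ (l < `|x u|)%R] + leb N)%E).
  by apply: measureU2 => //; exact: measurable_superlevel.
by rewrite [X in (_ + X <= _)%E]N0 adde0.
Qed.

Lemma distr_leW x y (mx : measurable_fun I01 x) (my : measurable_fun I01 y) :
  (forall t, I01 t -> `|y t| <= `|x t|) -> forall l, distr y l <= distr x l.
Proof. by move=> yx; apply: distr_le => //; apply: aeW. Qed.

Lemma distr_add x y (mx : measurable_fun I01 x) (my : measurable_fun I01 y) l m :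
  distr (x \+ y) (l + m) <= distr x l + distr y m.
Proof.
rewrite -lee_fin EFinD -!distrE//; last exact: measurable_funD.
apply: le_trans (measureU2 _ _ _); [|exact: measurable_superlevel..].
apply: le_measure; rewrite ?inE.
- by apply: measurable_superlevel; exact: measurable_funD.
- by apply: measurableU; exact: measurable_superlevel.
- move=> u [Iu h]; have [xl|lx] := leP (`|x u|) l; [right|by left]; split => //.
  by have := ler_normD (x u) (y u); lra.
Qed.

Lemma measurable_scale x (a : R) : measurable_fun I01 x ->
  measurable_fun I01 (fun t => a * x t).
Proof. by move=> mx; exact: measurable_funM. Qed.

Lemma distr_scale x (mx : measurable_fun I01 x) (a l : R) : a != 0 ->
  distr (fun t => a * x t) l = distr x (l / `|a|).
Proof.
move=> a0; rewrite !distr.unlock; congr (fine (leb _)); apply/seteqP; split => u [Iu h];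
  split => //; move: h; rewrite normrM ltr_pdivrMr ?normr_gt0// mulrC //.
Qed.

Lemma eq_of_lt_EFin (a b : \bar R) : (0 <= a)%E -> (0 <= b)%E ->
  (forall s : R, 0 <= s -> (s%:E < a)%E = (s%:E < b)%E) -> a = b.
Proof.
move=> a0 b0 ab; apply/eqP; rewrite eq_le; apply/andP; split; rewrite leNgt; apply/negP => h.
- have bf : b \is a fin_num by rewrite ge0_fin_numE// (lt_le_trans h)// leey.
  by move: h; rewrite -(fineK bf) ab ?fine_ge0// fineK// ltxx.
- have af : a \is a fin_num by rewrite ge0_fin_numE// (lt_le_trans h)// leey.
  by move: h; rewrite -(fineK af) -ab ?fine_ge0// fineK// ltxx.
Qed.

Lemma drearr_scale x (mx : measurable_fun I01 x) (a t : R) : 0 < t ->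
  drearr (fun u => a * x u) t = (`|a|%:E * drearr x t)%E.
Proof.
move=> t0; have max := measurable_scale a mx.
apply: eq_of_lt_EFin; rewrite ?drearr_ge0// ?mule_ge0 ?drearr_ge0// => s s0.
have xf := drearr_fin mx t0.
have [->|aN0] := eqVneq a 0.
  rewrite normr0 mul0e [RHS]ltNge lee_fin s0/= drearr_gtE//; last first.
    by rewrite -(_ : (fun=> 0) = fun u => 0 * x u) //; apply/funext => u; rewrite mul0r.
  rewrite [distr _ _](_ : _ = 0) ?ltNge ?ltW// distr.unlock.
  rewrite (_ : [set _ | _] = set0) ?measure0//.
  by apply/seteqP; split => u // [_]; rewrite mul0r normr0 ltNge s0.
rewrite drearr_gtE// distr_scale// -drearr_gtE//; last by rewrite divr_ge0.
by rewrite -(fineK xf) -EFinM !lte_fin ltr_pdivrMr ?normr_gt0// mulrC.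
Qed.

End DistributionAlgebra.

(** * Quasi-norm and completeness of Lorentz spaces *)

Section LorentzSpace.
Context (R : realType).
Implicit Types (x y z : R -> R).
Local Notation leb := (@lebesgue_measure R).
Variables (F : R -> R) (qF : quasi_concave F).

Let fd x l := fundamental F (distr x l).

Let fd_ge0 x l : 0 <= fd x l. Proof. exact: fundamental_ge0. Qed.

Lemma rearr_int_scale x (mx : measurable_fun I01 x) (a : R) :
  rearr_int F (fun t => a * x t) = (`|a|%:E * rearr_int F x)%E.
Proof.
rewrite rearr_int.unlock /lorentz_int -ge0_integralZl//; first last.
- by move=> t _; exact: drearr_ge0.
- by apply: measurable_drearr; exact: measurable_I01.
- exact: measurable_I01.
apply: eq_integral => t; rewrite inE /I01/= in_itv/= => /andP[t0 _].
exact: drearr_scale.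
Qed.

Lemma rearr_int_le x y (mx : measurable_fun I01 x) (my : measurable_fun I01 y) :
  (forall l, 0 < l -> distr y l <= distr x l) -> (rearr_int F y <= rearr_int F x)%E.
Proof.
move=> yx; rewrite (rearr_intE qF mx) (rearr_intE qF my).
apply: ge0_le_integral => //.
- by move=> l _; rewrite lee_fin; exact: fd_ge0.
- exact: measurable_fundamental_distr.
- exact: measurable_fundamental_distr.
- move=> l /=; rewrite in_itv/= andbT => l0; rewrite lee_fin.
  by apply: fundamental_mono; rewrite ?distr_ge0 ?distr_le1// yx.
Qed.

(** The substitution [l -> 2 l], obtained from homogeneity. At the level [l + l] the distribution
    function of a sum splits by [distr_add]; the factor 2 of the quasi-triangle inequality is the
    one produced here. *)
Lemma rearr_int_half z : measurable_fun I01 z ->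
  rearr_int F z = (2%:E * \int[leb]_(l in `]0%R, +oo[) (fd z (l + l))%:E)%E.
Proof.
move=> mz; have mz2 := measurable_scale 2^-1 mz.
have -> : rearr_int F z = (2%:E * rearr_int F (fun t => (2^-1 * z t)%R))%E.
  rewrite rearr_int_scale// muleA -EFinM ger0_norm ?invr_ge0// mulfV ?pnatr_eq0//.
  by rewrite mul1e.
rewrite (rearr_intE qF mz2).
have e l : distr (fun t => 2^-1 * z t) l = distr z (l + l).
  by rewrite distr_scale ?invr_neq0 ?pnatr_eq0// ger0_norm ?invr_ge0// invrK mulr_natr mulr2n.
by under eq_integral do rewrite e.
Qed.

Lemma measurable_fd_half z (mz : measurable_fun I01 z) :
  measurable_fun (`]0, +oo[ : set R) (fun l => (fd z (l + l))%:E).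
Proof.
apply: antitone_emeasurable => // s t _ _ st; rewrite lee_fin.
by apply: fundamental_mono; rewrite ?distr_ge0 ?distr_le1//; apply: distr_anti => //; lra.
Qed.

Lemma rearr_int_add x y (mx : measurable_fun I01 x) (my : measurable_fun I01 y) :
  (rearr_int F (x \+ y)%R <= 2%:E * (rearr_int F x + rearr_int F y))%E.
Proof.
have mxy : measurable_fun I01 (x \+ y) by exact: measurable_funD.
rewrite rearr_int_half//; apply: lee_pmul => //.
  by apply: integral_ge0 => l _; rewrite lee_fin.
rewrite (rearr_intE qF mx) (rearr_intE qF my) -ge0_integralD//; first last.
- exact: measurable_fundamental_distr.
- by move=> l _; rewrite lee_fin; exact: fd_ge0.
- exact: measurable_fundamental_distr.
- by move=> l _; rewrite lee_fin; exact: fd_ge0.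
apply: ge0_le_integral => //.
- by move=> l _; rewrite lee_fin; exact: fd_ge0.
- exact: measurable_fd_half.
- by apply: emeasurable_funD; exact: measurable_fundamental_distr.
- move=> l _; rewrite -EFinD lee_fin.
  by apply: fundamental_subadd; rewrite ?distr_ge0 ?distr_le1 ?distr_add.
Qed.

Lemma lorentz_chebyshev x (mx : measurable_fun I01 x) (e : R) : 0 <= e ->
  ((e * fd x e)%:E <= rearr_int F x)%E.
Proof.
move=> e0; rewrite (rearr_intE qF mx).
apply: (@le_trans _ _ (\int[leb]_(l in `]0%R, e[) (fd x l)%:E)%E); last first.
  apply: ge0_subset_integral => //; first exact: measurable_fundamental_distr.
    by move=> l _; rewrite lee_fin; exact: fd_ge0.
  by move=> l /=; rewrite !in_itv/= => /andP[->].
apply: (@le_trans _ _ (\int[leb]_(l in `]0%R, e[) (fd x e)%:E)%E).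
  rewrite integral_cst// [X in (_ * X)%E](_ : _ = e%:E); last first.
    by have := leb_oo e0; rewrite subr0.
  by rewrite -EFinM mulrC.
apply: ge0_le_integral => //.
- by move=> l _; rewrite lee_fin.
- exact: measurable_fundamental_distr.
- move=> l /=; rewrite in_itv/= => /andP[_ /ltW le]; rewrite lee_fin.
  by apply: fundamental_mono; rewrite ?distr_ge0 ?distr_le1//; exact: distr_anti.
Qed.

(** Fatou's lemma is applied in the height, not in the variable of the functions: [distr z (l + l)]
    exceeds [distr (zn n) l] by at most the measure of the set where [z - zn n] is larger than [l].
    That measure tends to 0, and [fundamental F] is small near 0. *)
Lemma rearr_int_fatou (zn : nat -> R -> R) z (e : R) :
  measurable_fun I01 z -> (forall n, measurable_fun I01 (zn n)) ->
  cvg_in_measure zn z -> (exists N, forall n, (N <= n)%N -> (rearr_int F (zn n) <= e%:E)%E) ->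
  (rearr_int F z <= 2%:E * e%:E)%E.
Proof.
move=> mz mzn cz [N Ne]; rewrite rearr_int_half//; apply: lee_pmul => //.
  by apply: integral_ge0 => l _; rewrite lee_fin.
apply: (@le_trans _ _ (\int[leb]_(l in `]0%R, +oo[) limn_einf (fun n => (fd (zn n) l)%:E))%E).
  apply: ge0_le_integral => //.
  - by move=> l _; rewrite lee_fin; exact: fd_ge0.
  - exact: measurable_fd_half.
  - rewrite (_ : (fun l => _) = (\- (fun l => limn_esup (fun n => (- (fd (zn n) l)%:E)%E)))%E) //.
    apply: measurableT_comp => //; apply: measurable_fun_limn_esup => n.
    by apply: measurableT_comp => //; exact: measurable_fundamental_distr.
  - move=> l /=; rewrite in_itv/= andbT => l0.
    apply/lee_addgt0Pr => d d0.
    have [b b0 bP] := fundamental_small qF d0.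
    have [M MP] := cvg_in_measure_small cz l0 b0.
    rewrite -leeBlDr// -EFinB; apply: (@limn_einf_ge _ _ _ M) => n Mn.
    rewrite lee_fin lerBlDr.
    have mD : measurable_fun I01 (z \- zn n) by exact: measurable_funB.
    have dz : distr z (l + l) <= distr (zn n) l + distr (z \- zn n) l.
      have := distr_add (mzn n) mD l l; congr (distr _ _ <= _).
      by apply/funext => t /=; rewrite addrC subrK.
    have small : distr (z \- zn n) l <= b.
      rewrite -lee_fin -distrE//; apply: le_trans (MP n Mn).
      by under eq_set do rewrite /= distrC.
    apply: (le_trans (fundamental_subadd qF _ _ _ _ _ _ dz)); rewrite ?distr_ge0 ?distr_le1//.
    by rewrite lerD2l; apply: bP; rewrite ?distr_ge0 ?distr_le1.
apply: le_trans (fatou _ _ _ _) _ => //.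
- by move=> n; exact: measurable_fundamental_distr.
- by move=> n l _; rewrite lee_fin; exact: fd_ge0.
- by apply: (@limn_einf_le _ _ _ N) => n Nn; rewrite -(rearr_intE qF (mzn n)); exact: Ne.
Qed.

Lemma lorentzE x : lorentz_space F x <-> measurable_fun I01 x /\ (rearr_int F x < +oo)%E.
Proof. by rewrite lorentz_space.unlock rearr_int.unlock. Qed.

Lemma lorentz_size_fine x : lorentz_size F x = fine (rearr_int F x).
Proof. by rewrite lorentz_size.unlock rearr_int.unlock. Qed.

Lemma lorentz_measurable x : lorentz_space F x -> measurable_fun I01 x.
Proof. by move=> /lorentzE[]. Qed.

Lemma lorentz_sizeE x : lorentz_space F x -> rearr_int F x = (lorentz_size F x)%:E.
Proof.
move=> /lorentzE[mx xF].
by rewrite lorentz_size_fine fineK// ge0_fin_numE//; exact: rearr_int_ge0.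
Qed.

Lemma lorentz_size_ge0 x : 0 <= lorentz_size F x.
Proof. by rewrite lorentz_size_fine fine_ge0// rearr_int_ge0. Qed.

Lemma lorentz_bound x (b : R) : measurable_fun I01 x -> (rearr_int F x <= b%:E)%E ->
  lorentz_space F x /\ lorentz_size F x <= b.
Proof.
move=> mx h; have Fx : lorentz_space F x.
  by apply/lorentzE; split => //; apply: le_lt_trans h _; exact: ltry.
by split => //; rewrite -lee_fin -lorentz_sizeE.
Qed.

Lemma lorentz_add x y : lorentz_space F x -> lorentz_space F y -> lorentz_space F (x \+ y).
Proof.
move=> /lorentzE[mx xF] /lorentzE[my yF]; apply/lorentzE; split; first exact: measurable_funD.
apply: le_lt_trans (rearr_int_add mx my) _.
by apply: lte_mul_pinfty => //; exact: lte_add_pinfty.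
Qed.

Lemma lorentz_scale (a : R) x : lorentz_space F x -> lorentz_space F (fun t => a * x t).
Proof.
move=> /lorentzE[mx xF]; apply/lorentzE; split; first exact: measurable_scale.
by rewrite rearr_int_scale//; apply: lte_mul_pinfty.
Qed.

Lemma lorentz_le x y : lorentz_space F x -> measurable_fun I01 y ->
  (forall l, 0 < l -> distr y l <= distr x l) ->
  lorentz_space F y /\ lorentz_size F y <= lorentz_size F x.
Proof.
move=> Fx my yx; have mx := lorentz_measurable Fx; apply: lorentz_bound => //.
by rewrite -lorentz_sizeE//; exact: rearr_int_le.
Qed.

Lemma lorentz_sub x y : lorentz_space F x -> lorentz_space F y -> lorentz_space F (x \- y).
Proof.
move=> Fx Fy; rewrite (_ : x \- y = x \+ (fun t => -1 * y t)).
  by apply: lorentz_add => //; exact: lorentz_scale.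
by apply/funext => t /=; rewrite mulN1r.
Qed.

Lemma lorentz_cauchy_in_measure (u : nat -> R -> R) : (forall n, lorentz_space F (u n)) ->
  (forall e : R, 0 < e -> exists n0 : nat, forall m n : nat,
      (n0 <= m)%N -> (n0 <= n)%N -> lorentz_size F (u m \- u n) < e) ->
  forall e : R, 0 < e -> exists N, forall m n, (N <= m)%N -> (N <= n)%N ->
    (leb [set t | I01 t /\ (e < `|u m t - u n t|)%R] <= e%:E)%E.
Proof.
(* Were the measure above [e], Chebyshev would bound the size from below by [e * fundamental F v];
   the minimum keeps [v] in []0, 1]]. *)
move=> Fu cu e e0; pose v := Num.min e 1.
have v0 : 0 < v by rewrite lt_min e0 ltr01.
have v1 : v <= 1 by rewrite ge_min lexx orbT.
have [N NP] := cu (e * fundamental F v) (mulr_gt0 e0 (fundamental_gt0 qF v0 v1)).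
exists N => m n Nm Nn; have Fz := lorentz_sub (Fu m) (Fu n).
have mz := lorentz_measurable Fz.
rewrite [leb _](distrE mz) lee_fin leNgt; apply/negP => h.
have := NP _ _ Nm Nn; rewrite ltNge => /negP; apply.
rewrite -lee_fin -lorentz_sizeE//.
apply: le_trans (lorentz_chebyshev mz (ltW e0)).
rewrite lee_fin ler_pM2l//; apply: fundamental_mono; rewrite ?distr_le1 ?(ltW v0)//.
by rewrite ge_min (ltW h).
Qed.

Lemma lorentz_quasi_banach : quasi_banach_symmetric (lorentz_space F) (lorentz_size F).
Proof.
split.
- by move=> x /lorentz_measurable.
- apply/lorentzE; split; first exact: measurable_cst.
  rewrite (_ : cst 0 = fun t => 0 * cst (0 : R) t); last first.
    by apply/funext => t; rewrite mul0r.
  by rewrite rearr_int_scale ?normr0 ?mul0e//; exact: measurable_cst.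
- exact: lorentz_add.
- exact: lorentz_scale.
- by move=> x _; exact: lorentz_size_ge0.
- move=> x Fx x0; have mx := lorentz_measurable Fx.
  have d0 : distr x 0 = 0.
    apply/eqP; rewrite eq_le distr_ge0 andbT leNgt; apply/negP.
    move=> /(distr_right_open mx)[e e0]; rewrite add0r => d0.
    have := lorentz_chebyshev mx (ltW e0); rewrite lorentz_sizeE// x0 lee_fin.
    by rewrite leNgt mulr_gt0// fundamental_gt0// distr_le1.
  exists [set u | I01 u /\ 0 < `|x u|]; split.
  + exact: measurable_superlevel.
  + by rewrite [LHS]distrE// d0.
  + move=> t /= h; apply: contrapT => nt; apply: h => It; apply: contrapT => xt.
    by apply: nt; split => //; rewrite normr_gt0; exact/eqP.
- move=> a x Fx; have mx := lorentz_measurable Fx.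
  by rewrite !lorentz_size_fine rearr_int_scale// lorentz_sizeE.
- exists 2 => x y Fx Fy.
  rewrite -lee_fin -lorentz_sizeE; last exact: lorentz_add.
  apply: le_trans (rearr_int_add (lorentz_measurable Fx) (lorentz_measurable Fy)) _.
  by rewrite !lorentz_sizeE.
- move=> u Fu cu; have mu n : measurable_fun I01 (u n) := lorentz_measurable (Fu n).
  have [g [mg ug]] := cauchy_in_measure_cvg mu (lorentz_cauchy_in_measure Fu cu).
  (* With [m] fixed and [n] tending to infinity, [rearr_int_fatou] turns the Cauchy condition into a
     bound on [u m - g]; taking [e / 2] absorbs its factor 2. *)
  have main e : 0 < e -> exists N, forall m, (N <= m)%N ->
      lorentz_space F (u m \- g) /\ lorentz_size F (u m \- g) <= e.
    move=> e0; have [N NP] := cu (e / 2) (divr_gt0 e0 (ltr0n _ 2)).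
    exists N => m Nm; have mz : measurable_fun I01 (u m \- g) by exact: measurable_funB.
    apply: lorentz_bound => //.
    rewrite [X in (_ <= X%:E)%E](_ : e = 2 * (e / 2)); last by lra.
    rewrite EFinM; apply: (rearr_int_fatou (zn := fun n => u m \- u n)) => //.
    - by move=> n; exact: measurable_funB.
    - move=> d d0; have := ug _ d0; apply: cvg_trans; apply: near_eq_cvg.
      apply: nearW => n; congr (leb _); apply/seteqP; split => t [It h]; split => //;
        by move: h; rewrite distrC; congr (_ < `|_|) => /=; lra.
    - exists N => n Nn; rewrite lorentz_sizeE; last exact: lorentz_sub.
      by rewrite lee_fin ltW// NP.
  have [N1 NP1] := main 1 ltr01.
  have Fg : lorentz_space F g.
    have [Fz _] := NP1 _ (leqnn _); have := lorentz_sub (Fu N1) Fz.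
    by congr (lorentz_space F _); apply/funext => t /=; lra.
  exists g => //; apply/cvgrPdist_le => e /main[N NP]; exists N => // n Nn.
  by rewrite sub0r normrN ger0_norm ?lorentz_size_ge0//; have [] := NP _ Nn.
- move=> x y Fx my yx; have mx := lorentz_measurable Fx.
  by apply: lorentz_le => // l _; exact: distr_le.
- move=> x y /lorentzE[mx Fx] my yx.
  have e : rearr_int F y = rearr_int F x.
    rewrite rearr_int.unlock.
    by apply: eq_integral => t; rewrite inE /I01/= in_itv/=; exact: yx.
  by split; [apply/lorentzE; split => //; rewrite e|rewrite !lorentz_size_fine e].
Qed.

End LorentzSpace.

Lemma measurable_invr (R : realType) : measurable_fun [set: R] (@GRing.inv R).
Proof.
(* The real power is taken only at the nonnegative base [x * x]; at 0 both sides vanish. *)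
rewrite (_ : GRing.inv = fun x => x * (x * x) `^ (-1)); last first.
  apply/funext => x; rewrite powR_inv1; last by rewrite -expr2 sqr_ge0.
  have [->|x0] := eqVneq x 0; first by rewrite invr0 mul0r.
  by rewrite invfM mulrA mulfV// mul1r.
apply: measurable_funM => //.
by apply: (measurableT_comp (measurable_powR (-1))); exact: measurable_funM.
Qed.

Lemma integral_oo_split (R : realType) (a b c : R) (f : R -> \bar R) :
  a <= b -> b < c -> measurable_fun `]a, c[ f ->
  (forall x, a < x < c -> (0 <= f x)%E) ->
  (\int[lebesgue_measure]_(x in `]a, c[) f x =
   \int[lebesgue_measure]_(x in `]a, b[) f x + \int[lebesgue_measure]_(x in `]b, c[) f x)%E.
Proof.
rewrite le_eqVlt => /predU1P[->|ab] bc mf f0.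
  by rewrite set_itvoo0 integral_set0 add0e.
have e : `]a, c[%classic = `]a, b[%classic `|` `[b, c[%classic.
  apply/seteqP; split => x /=; rewrite !in_itv/=.
    by move=> /andP[ax xc]; have [xb|bx] := ltP x b; [left; rewrite ax|right].
  move=> [/andP[-> xb]|/andP[bx ->]]; first by rewrite (lt_trans xb).
  by rewrite (lt_le_trans ab).
rewrite [X in (_ = _ + X)%E]integral_itv_obnd_cbnd; last first.
  apply: measurable_funS mf => // x /=; rewrite !in_itv/= => /andP[bx ->].
  by rewrite (lt_trans ab bx).
rewrite e; apply: ge0_integral_setU => //.
- by rewrite -e.
- by move=> x; rewrite -e /= in_itv/=; exact: f0.
- apply/disj_setPS => x []; rewrite /= !in_itv/= => /andP[_ xb] /andP[bx _].
  by move: xb; rewrite ltNge bx.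
Qed.

(** * The Calderon operator on rearrangements *)

Section CalderonKernel.
Context (R : realType).
Local Notation leb := (@lebesgue_measure R).
Implicit Types (v t : R).

(* [calderon_kernel v t] is the value at [t] of the Calderon operator applied to
   the indicator function of ]0, v[. *)
Definition calderon_kernel v t : R := Num.min t v / t + ln (Num.max v t / t).

Lemma calderon_kernel_ge0 v t : 0 <= v -> 0 < t -> 0 <= calderon_kernel v t.
Proof.
move=> v0 t0; apply: addr_ge0; first by rewrite divr_ge0 ?le_min ?v0 ?ltW.
by rewrite ln_ge0// ler_pdivlMr// mul1r le_max lexx orbT.
Qed.

(** [Num.min v r / r ^+ 2] is minus the derivative of the kernel in [r], and [v] is the value of the
    kernel at 1. As a tail integral, the kernel is ready for [tonelli_triangle]. *)
Lemma calderon_kernelE v t : 0 < t -> t < 1 -> 0 < v -> v <= 1 ->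
  ((calderon_kernel v t)%:E =
    v%:E + \int[leb]_(r in `]t, 1%R[) (Num.min v r / r ^+ 2)%:E)%E.
Proof.
move=> t0 t1 v0 v1; rewrite /calderon_kernel.
have mk (a b : R) : measurable_fun `]a, b[ (fun r : R => (Num.min v r / r ^+ 2)%:E).
  apply/measurable_EFinP; apply: measurable_funM; first exact: measurable_minr.
  apply: (measurableT_comp (@measurable_invr R)) => //.
have far (s : R) : v <= s -> 0 < s -> s <= 1 ->
    (\int[leb]_(r in `]s, 1%R[) (Num.min v r / r ^+ 2)%:E = (v / s - v)%:E)%E.
  move=> vs s0 s1.
  have -> : (v / s - v)%:E = (v%:E * (s^-1 - 1^-1)%:E)%E.
    by rewrite invr1 -EFinM mulrBr mulr1.
  rewrite -integral_inv_sqr// -ge0_integralZl//; first last.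
  - by rewrite lee_fin ltW.
  - by move=> r _; rewrite lee_fin invr_ge0 sqr_ge0.
  - by apply/measurable_EFinP; apply: (measurableT_comp (@measurable_invr R)).
  apply: eq_integral => r; rewrite inE/= in_itv/= => /andP[sr _].
  by rewrite min_l// (le_trans vs)// ltW.
have [vt|tv] := leP v t.
  rewrite (far _ vt t0 (ltW t1)) -EFinD mulfV ?gt_eqF// ln1 addr0.
  by congr EFin; lra.
rewrite mulfV ?gt_eqF//.
have near_ : (\int[leb]_(r in `]t, v[) (Num.min v r / r ^+ 2)%:E = (ln v - ln t)%:E)%E.
  rewrite -integral_inv ?ltW//; apply: eq_integral => r; rewrite inE/= in_itv/= => /andP[tr rv].
  rewrite min_r ?ltW// expr2 invfM mulrA mulfV ?mul1r// gt_eqF//.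
  exact: lt_trans tr.
move: v1; rewrite le_eqVlt => /predU1P[v1|v1].
  by rewrite -[X in `]_, X[]v1 near_ v1 ln1 -EFinD ln_div ?posrE// ln1.
rewrite (integral_oo_split (ltW tv) v1)//; first last.
- move=> r /andP[tr _]; rewrite lee_fin divr_ge0 ?sqr_ge0// le_min (ltW v0)/=.
  by rewrite (le_trans (ltW t0))// ltW.
rewrite near_ far ?lexx ?(ltW v1)// -!EFinD ln_div ?posrE//.
by rewrite mulfV ?gt_eqF//; congr EFin; lra.
Qed.

End CalderonKernel.

Section CalderonLayers.
Context (R : realType).
Local Notation leb := (@lebesgue_measure R).
Implicit Types (x y : R -> R) (v t l : R).

Lemma calderon_kernel_mono v w t : 0 < t -> v <= w ->
  calderon_kernel v t <= calderon_kernel w t.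
Proof.
move=> t0 vw; apply: lerD; first by rewrite ler_pM2r ?invr_gt0// le_min2.
rewrite ler_ln ?posrE ?divr_gt0 ?lt_max ?t0 ?orbT//.
by rewrite ler_pM2r ?invr_gt0// le_max2.
Qed.

Lemma calderon_kernel0 t : 0 < t -> calderon_kernel 0 t = 0.
Proof.
move=> t0; rewrite /calderon_kernel min_r ?ltW// max_r ?ltW// mul0r add0r.
by rewrite mulfV ?gt_eqF// ln1.
Qed.

Lemma calderonE y (my : measurable_fun I01 y) t : 0 < t -> t < 1 ->
  calderon (drearr y) t =
  (\int[leb]_(l in `]0%R, +oo[) (calderon_kernel (distr y l) t)%:E)%E.
Proof.
move=> t0 t1; rewrite /calderon.
have I0 : `]0, t[%classic `<=` (I01 : set R).
  by move=> s /=; rewrite /I01/= !in_itv/= => /andP[-> /lt_trans]; apply.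
have I1 : `]t, 1[%classic `<=` (I01 : set R).
  by move=> s /=; rewrite /I01/= !in_itv/= => /andP[/(lt_trans t0)->].
rewrite (layer_cake1 leb (D := `]0, t[%classic)); first last.
- by move=> s _; exact: drearr_ge0.
- by apply: measurable_drearr; exact: measurable_itv.
- exact: measurable_itv.
rewrite (layer_cake leb (D := `]t, 1[%classic) (k := fun s => (s^-1)%:E)); first last.
- by move=> s /=; rewrite in_itv/= => /andP[/(lt_trans t0) s0 _]; rewrite lee_fin invr_ge0 ltW.
- by move=> s _; exact: drearr_ge0.
- by apply/measurable_EFinP; apply: measurable_funTS; exact: measurable_invr.
- by apply: measurable_drearr; exact: measurable_itv.
- exact: measurable_itv.
have e1 l : l \in `]0%R, +oo[%classic ->
    leb (`]0, t[%classic `&` [set s | (l%:E < drearr y s)%E]) = (Num.min t (distr y l))%:E.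
  rewrite inE/= in_itv/= andbT => /ltW l0; rewrite below_distr//.
  rewrite (_ : _ `&` _ = `]0, Num.min t (distr y l)[%classic); last first.
    apply/seteqP; split => s /=; rewrite !in_itv/= lt_min.
      by move=> [/andP[-> ->] /andP[_ ->]].
    by move=> /andP[-> /andP[-> ->]].
  by rewrite leb_oo ?subr0// le_min distr_ge0// ltW.
have e2 l : l \in `]0%R, +oo[%classic ->
    (\int[leb]_(s in (`]t, 1%R[%classic `&` [set s | (l%:E < drearr y s)%E])) (s^-1)%:E)%E =
    (ln (Num.max (distr y l) t / t))%:E.
  rewrite inE/= in_itv/= andbT => /ltW l0; rewrite below_distr//.
  rewrite (_ : _ `&` _ = `]t, Num.max (distr y l) t[%classic); last first.
    apply/seteqP; split => s /=; rewrite !in_itv/= lt_max.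
      by move=> [/andP[-> _] /andP[_ ->]].
    move=> /andP[ts]; rewrite [s < t]ltNge (ltW ts) orbF => sd.
    by rewrite ts sd (lt_trans t0 ts) (lt_le_trans sd) ?distr_le1.
  by rewrite integral_inv ?le_max ?lexx ?orbT// ln_div// posrE lt_max t0 orbT.
rewrite [X in (_ * X + _)%E](_ : _ =
  \int[leb]_(l in `]0%R, +oo[) (Num.min t (distr y l))%:E)%E; last exact: eq_integral.
rewrite [X in (_ + X)%E](_ : _ =
  \int[leb]_(l in `]0%R, +oo[) (ln (Num.max (distr y l) t / t))%:E)%E; last exact: eq_integral.
have ml : measurable_fun (`]0, +oo[ : set R) (fun l => (ln (Num.max (distr y l) t / t))%:E).
  apply: antitone_emeasurable => // a b _ _ ab; rewrite lee_fin.
  rewrite ler_ln ?posrE ?divr_gt0 ?lt_max ?t0 ?orbT//.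
  by rewrite ler_pM2r ?invr_gt0// le_max2// distr_anti.
have mm : measurable_fun (`]0, +oo[ : set R) (fun l => (Num.min t (distr y l))%:E).
  apply: antitone_emeasurable => // a b _ _ ab; rewrite lee_fin.
  by rewrite le_min2// distr_anti.
rewrite -ge0_integralZl//; first last.
- by rewrite lee_fin invr_ge0 ltW.
- by move=> l _; rewrite lee_fin le_min distr_ge0 ltW.
rewrite -ge0_integralD//; first last.
- by move=> l _; rewrite lee_fin ln_ge0// ler_pdivlMr// mul1r le_max lexx orbT.
- exact: measurable_funeM.
- by move=> l _; rewrite mule_ge0// lee_fin ?invr_ge0 ?le_min ?distr_ge0 ltW.
by apply: eq_integral => l _; rewrite -EFinM -EFinD mulrC.
Qed.

(** Tonelli on the triangle [0 < t < r < 1]. The initial masses on the right are [psi r] when [nu]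
    is [stieltjes01 psi]. *)
Lemma tonelli_triangle (nu : {sigma_finite_measure set (measurableTypeR R) -> \bar R}) (g : R -> R) :
  measurable_fun I01 g -> (forall r, I01 r -> 0 <= g r) ->
  (\int[nu]_(t in I01) \int[leb]_(r in `]t, 1%R[) (g r)%:E =
   \int[leb]_(r in I01) ((g r)%:E * nu `]0%R, r[%classic))%E.
Proof.
move=> mg g0.
pose A : set (measurableTypeR R * measurableTypeR R) := [set z | 0 < z.1 /\ z.1 < z.2].
pose G := ((EFin \o g) \_ I01)%E.
have mG : measurable_fun setT G.
  by apply/(measurable_restrictT _ (@measurable_I01 R))/measurable_EFinP.
have G0 r : (0 <= G r)%E.
  by rewrite /G patchE; case: ifPn => //; rewrite inE => /g0; rewrite lee_fin.
have mA : measurable A.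
  have -> : A = [set z | ((0:R)%:E < (z.1)%:E)%E] `&` [set z | ((z.1)%:E < (z.2)%:E)%E].
    by apply/seteqP; split => z /=; rewrite /A/= !lte_fin.
  have m1 : measurable_fun setT (fun z : measurableTypeR R * measurableTypeR R => (z.1 : R)%:E).
    by apply/measurable_EFinP; exact: measurable_fst.
  have m2 : measurable_fun setT (fun z : measurableTypeR R * measurableTypeR R => (z.2 : R)%:E).
    by apply/measurable_EFinP; exact: measurable_snd.
  apply: measurableI.
    by rewrite -[X in measurable X]setTI; exact: emeasurable_fun_o_infty.
  by rewrite -[X in measurable X]setTI; exact: measurable_lte.
pose F (z : measurableTypeR R * measurableTypeR R) : \bar R := (G z.2 * (\1_A z)%:E)%E.
have mF : measurable_fun setT F.
  apply: emeasurable_funM; first by apply: measurableT_comp.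
  by apply/measurable_EFinP; exact: measurable_indic.
have F0 z : (0 <= F z)%E by rewrite mule_ge0// lee_fin.
transitivity (\int[nu]_t \int[leb]_r F (t, r))%E.
  rewrite integral_mkcond; apply: eq_integral => t _; rewrite patchE.
  case: ifPn => [|tI].
    rewrite inE /I01/= in_itv/= => /andP[t0 t1]; rewrite integral_mkcond.
    apply: eq_integral => r _; rewrite /F /G/= !patchE indicE.
    have [rI|rI] := boolP (r \in I01).
      move: rI; rewrite inE/= /I01/= in_itv/= => /andP[r0 r1].
      have [tr|rt] := ltP t r.
        by rewrite !mem_set ?mule1//= in_itv/= tr r1.
      rewrite !memNset ?mule0//=; first by rewrite /A/= => -[_]; rewrite ltNge rt.
      by rewrite in_itv/= ltNge rt.
    rewrite mul0e memNset//= => /itvP tr; move/negP: rI; apply; rewrite inE /I01/= in_itv/=.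
    by rewrite tr (lt_trans t0)// tr.
  apply/esym; apply: integral0_eq => r _; rewrite /F/G/= patchE.
  case: ifPn => [|_]; last by rewrite mul0e.
  rewrite inE /I01/= in_itv/= => /andP[r0 r1]; rewrite indicE memNset ?mule0// => -[/= t0 tr].
  by move: tI; rewrite notin_setE /I01/= in_itv/= t0 (lt_trans tr r1).
rewrite (fubini_tonelli (m1 := nu) (m2 := leb) F mF F0) [RHS]integral_mkcond.
apply: eq_integral => r _; rewrite /F/=.
have mr : measurable (`]0, r[%classic : set (measurableTypeR R)) by exact: measurable_itv.
transitivity (G r * \int[nu]_t (\1_(`]0, r[%classic : set R) t)%:E)%E.
  rewrite -ge0_integralZl//; last by apply/measurable_EFinP/measurable_indic.
  apply: eq_integral => t _; congr (_ * _%:E)%E; rewrite !indicE; congr ((_ : bool)%:R).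
  by apply/idP/idP; rewrite !inE/= in_itv/= /A/= => /andP.
rewrite integral_indic// setIT /G !patchE; case: ifPn => // _; rewrite mul0e//.
Qed.

End CalderonLayers.

(** * Hardy type bound for the Calderon operator *)

Section CalderonBound.
Context (R : realType).
Local Notation leb := (@lebesgue_measure R).
Variables (phi psi : R -> R) (c : R).
Hypotheses (qphi : quasi_concave phi) (qpsi : quasi_concave psi).
Hypothesis psi_le : forall u, 0 <= u -> u < 1 -> psi u <= phi u.
Hypothesis hc : forall u : R, 0 < u < 1 ->
    (\int[leb]_(t in `]0%R, u[) (psi t / t)%:E
     + u%:E * \int[leb]_(t in `]u, 1%R[) (psi t / t ^+ 2)%:E
     <= (c * phi u)%:E)%E.

Let psi_ge0 u : 0 <= u -> u < 1 -> 0 <= psi u.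
Proof. by move=> u0 u1; rewrite -(fundamental_lt1 qpsi)//; exact: fundamental_ge0. Qed.

Let mpsi (g : R -> R) (a b : R) : 0 <= a -> b <= 1 -> measurable_fun setT g ->
  measurable_fun (`]a, b[ : set R) (fun t => psi t * g t).
Proof.
move=> a0 b1 mg; apply: measurable_funM; last exact: measurable_funTS.
suff mI : measurable_fun I01 psi.
  apply: measurable_funS mI; first exact: measurable_I01.
  move=> t /=; rewrite /I01/= !in_itv/= => /andP[at_ tb].
  by rewrite (le_lt_trans a0)// (lt_le_trans tb).
rewrite (_ : psi = \- (fun t => - psi t)); last by apply/funext => t /=; rewrite opprK.
apply: measurable_funN.
apply: antitone_measurable => s t; rewrite /I01/= !in_itv/= => /andP[s0 s1] /andP[t0 t1] st.
rewrite lerN2 -(fundamental_lt1 qpsi (ltW s0) s1) -(fundamental_lt1 qpsi (ltW t0) t1).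
by apply: fundamental_mono => //; exact: ltW.
Qed.

Lemma hardy_constant_ge0 : 0 <= c.
Proof.
have h : 0 < (2^-1 : R) < 1 by rewrite invr_gt0 ltr0n/= invf_lt1// ltr1n.
have [_ _ _ _ /(_ _ h) p0] := qphi.
have H : (0 <= (c * phi 2^-1)%:E)%E.
  apply: le_trans (hc h); case/andP: h => h0 h1; apply: adde_ge0.
    apply: integral_ge0 => t /=; rewrite in_itv/= => /andP[t0 t1].
    by rewrite lee_fin divr_ge0 ?psi_ge0 ?ltW// (lt_trans t1).
  apply: mule_ge0; first by rewrite lee_fin ltW.
  apply: integral_ge0 => t /=; rewrite in_itv/= => /andP[t0 t1].
  by rewrite lee_fin divr_ge0 ?psi_ge0 ?sqr_ge0// ltW// (lt_trans h0).
by move: H; rewrite lee_fin pmulr_lge0.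
Qed.

(** The integrand is [psi r / r] below [v] and [v * psi r / r ^+ 2] above, so for [v < 1] the
    integral is the left side of [hc] at [v]. For [v = 1] it is at most twice the left side of [hc]
    at 1/2, since the weight there on the second integral is 1/2. *)
Lemma hardy_sum_le v : 0 < v -> v <= 1 ->
  (\int[leb]_(r in I01) (Num.min v r / r ^+ 2 * psi r)%:E <= (2 * c * fundamental phi v)%:E)%E.
Proof.
move=> v0; have c0 := hardy_constant_ge0.
have mi : measurable_fun setT (fun r : R => r^-1) by exact: measurable_invr.
have mi2 : measurable_fun setT (fun r : R => (r ^+ 2)^-1).
  by apply: (measurableT_comp (@measurable_invr R)).
have mI (w : R) : measurable_fun (`]0, 1[ : set R) (fun r : R => (Num.min w r / r ^+ 2 * psi r)%:E).
  apply/measurable_EFinP; rewrite (_ : (fun r => _) = fun r => psi r * (Num.min w r / r ^+ 2)).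
    apply: mpsi => //; apply: measurable_funM => //.
    exact: measurable_minr.
  by apply/funext => r; rewrite mulrC.
have nI (w r : R) : 0 <= w -> 0 < r < 1 -> (0 <= (Num.min w r / r ^+ 2 * psi r)%:E)%E.
  move=> w0 /andP[r0 r1]; rewrite lee_fin mulr_ge0 ?psi_ge0 ?divr_ge0 ?sqr_ge0 ?le_min ?w0 ?ltW//.
have near0 (w u : R) : u <= w -> u <= 1 -> (\int[leb]_(r in `]0%R, u[) (Num.min w r / r ^+ 2 * psi r)%:E
    = \int[leb]_(r in `]0%R, u[) (psi r / r)%:E)%E.
  move=> uw u1; apply: eq_integral => r; rewrite inE/= in_itv/= => /andP[r0 ru]; congr EFin.
  rewrite min_r; last by rewrite (le_trans (ltW ru)).
  by rewrite expr2 invfM mulrA mulfV ?gt_eqF// mul1r mulrC.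
rewrite le_eqVlt => /predU1P[->|v1].
  have h0 : 0 < (2^-1 : R) by rewrite invr_gt0.
  have h1 : (2^-1 : R) < 1 by rewrite invf_lt1// ltr1n.
  rewrite /I01 (integral_oo_split (ltW h0) h1)//; last by move=> r /(nI 1 r ler01).
  rewrite near0 ?(ltW h1)//.
  apply: (@le_trans _ _ (2%:E * (c * phi 2^-1)%:E)%E); last first.
    rewrite -EFinM lee_fin mulrA ler_wpM2l ?mulr_ge0//.
    rewrite -(fundamental_lt1 qphi (ltW h0) h1).
    by apply: fundamental_mono; rewrite ?(ltW h0) ?(ltW h1).
  have h01 : 0 < (2^-1 : R) < 1 by rewrite h0 h1.
  apply: (@le_trans _ _ (2%:E * (\int[leb]_(t in `]0%R, 2^-1%R[) (psi t / t)%:E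
     + (2^-1)%:E * \int[leb]_(t in `]2^-1%R, 1%R[) (psi t / t ^+ 2)%:E))%E); last first.
    by apply: lee_pmul => //; [|exact: hc]; apply: adde_ge0; [|apply: mule_ge0 => //];
      apply: integral_ge0 => t /=; rewrite in_itv/= => /andP[t0 t1];
      rewrite lee_fin divr_ge0 ?psi_ge0 ?sqr_ge0 ?ltW// ?(lt_trans t1)// (lt_trans h0).
  rewrite muleDr//; last first.
    apply: ge0_adde_def; rewrite inE.
      apply: integral_ge0 => t /=; rewrite in_itv/= => /andP[t0 t1].
      by rewrite lee_fin divr_ge0 ?psi_ge0 ?ltW// (lt_trans t1).
    apply: mule_ge0 => //; apply: integral_ge0 => t /=; rewrite in_itv/= => /andP[t0 t1].
    by rewrite lee_fin divr_ge0 ?psi_ge0 ?sqr_ge0 ?ltW// (lt_trans h0).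
  apply: leeD.
    rewrite -[leLHS]mul1e; apply: lee_pmul => //; last by rewrite lee_fin ler1n.
    apply: integral_ge0 => t /=; rewrite in_itv/= => /andP[t0 t1].
    by rewrite lee_fin divr_ge0 ?psi_ge0 ?ltW// (lt_trans t1).
  rewrite muleA -EFinM mulfV ?pnatr_eq0// mul1e; apply: ge0_le_integral => //.
  - by move=> t /=; rewrite in_itv/= => /andP[t0 t1]; apply: nI => //; rewrite (lt_trans h0).
  - apply: measurable_funS (mI 1) => // t /=; rewrite !in_itv/= => /andP[t0 ->].
    by rewrite (lt_trans h0).
  - by apply/measurable_EFinP; apply: mpsi => //; exact: ltW.
  - move=> t /=; rewrite in_itv/= => /andP[t0 t1].
    have tp : 0 < t := lt_trans h0 t0.
    rewrite lee_fin mulrC ler_wpM2l ?psi_ge0 ?(ltW tp)// ler_piMl ?invr_ge0 ?sqr_ge0//.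
    by rewrite ge_min lexx.
rewrite /I01 (integral_oo_split (ltW v0) v1)//; last by move=> r /nI; apply; exact: ltW.
rewrite near0 ?(ltW v1)//.
have v01 : 0 < v < 1 by rewrite v0 v1.
have -> : (\int[leb]_(r in `]v, 1%R[) (Num.min v r / r ^+ 2 * psi r)%:E =
   v%:E * \int[leb]_(r in `]v, 1%R[) (psi r / r ^+ 2)%:E)%E.
  rewrite -ge0_integralZl//; first last.
  - by rewrite lee_fin ltW.
  - move=> t /=; rewrite in_itv/= => /andP[t0 t1].
    by rewrite lee_fin divr_ge0 ?psi_ge0 ?sqr_ge0// ltW// (lt_trans v0).
  - by apply/measurable_EFinP; apply: mpsi => //; exact: ltW.
  apply: eq_integral => r; rewrite inE/= in_itv/= => /andP[vr r1].
  by rewrite min_l ?ltW// -EFinM -mulrA [_^-1 * _]mulrC.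
apply: (le_trans (hc v01)); rewrite lee_fin -(fundamental_lt1 qphi (ltW v0) v1) -mulrA.
by rewrite ler_peMl ?ler1n// mulr_ge0// fundamental_ge0.
Qed.

(** Integrate [calderon_kernelE] against the measure of [psi]. The tail integral yields [2 * c]; the
    constant term yields [v * fundamental psi 1], which is at most [fundamental phi v] by [psi_le]
    and the decrease of [fundamental phi v / v], hence the summand 1. *)
Lemma calderon_kernel_int v : 0 <= v -> v <= 1 ->
  (\int[stieltjes01 psi]_(t in I01) (calderon_kernel v t)%:E <=
   ((2 * c + 1) * fundamental phi v)%:E)%E.
Proof.
have c0 := hardy_constant_ge0.
rewrite le_eqVlt => /predU1P[<- _|v0 v1].
  rewrite integral0_eq ?lee_fin ?mulr_ge0 ?fundamental_ge0 ?addr_ge0 ?mulr_ge0//.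
  move=> t; rewrite /I01/= in_itv/= => /andP[t0 _].
  by rewrite calderon_kernel0.
have mg : measurable_fun I01 (fun r : R => Num.min v r / r ^+ 2).
  apply: measurable_funTS; apply: measurable_funM; first exact: measurable_minr.
  by apply: (measurableT_comp (@measurable_invr R)).
have g0 r : 0 < r -> 0 <= Num.min v r / r ^+ 2.
  by move=> r0; rewrite divr_ge0 ?sqr_ge0 ?le_min ?(ltW v0) ?ltW.
have tail_ge0 t : 0 < t -> (0 <= \int[leb]_(r in `]t, 1%R[) (Num.min v r / r ^+ 2)%:E)%E.
  move=> t0; apply: integral_ge0 => r /=; rewrite in_itv/= => /andP[tr _].
  by rewrite lee_fin g0// (lt_trans t0).
have -> : (\int[stieltjes01 psi]_(t in I01) (calderon_kernel v t)%:E =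
  \int[stieltjes01 psi]_(t in I01)
   (v%:E + \int[leb]_(r in `]t, 1%R[) (Num.min v r / r ^+ 2)%:E))%E.
  apply: eq_integral => t; rewrite inE /I01/= in_itv/= => /andP[t0 t1].
  exact: calderon_kernelE.
rewrite ge0_integralD//; first last.
- apply: antitone_emeasurable; first exact: measurable_I01.
  move=> s t; rewrite /I01/= !in_itv/= => /andP[s0 _] /andP[t0 _] st.
  apply: ge0_subset_integral => //.
  + apply/measurable_EFinP; apply: measurable_funS mg; first exact: measurable_I01.
    by move=> r /=; rewrite /I01/= !in_itv/= => /andP[/(lt_trans s0)->].
  + by move=> r /=; rewrite in_itv/= => /andP[sr _]; rewrite lee_fin g0// (lt_trans s0).
  + by move=> r /=; rewrite !in_itv/= => /andP[/(le_lt_trans st)->].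
- by move=> t; rewrite /I01/= in_itv/= => /andP[t0 _]; exact: tail_ge0.
- by move=> t _; rewrite lee_fin ltW.
- exact: measurable_I01.
rewrite (tonelli_triangle (stieltjes01 psi))//; last first.
  by move=> r; rewrite /I01/= in_itv/= => /andP[r0 _]; exact: g0.
rewrite integral_cst; last exact: measurable_I01.
rewrite [X in (_ + X <= _)%E](_ : _ =
  \int[leb]_(r in I01) (Num.min v r / r ^+ 2 * psi r)%:E)%E; last first.
  apply: eq_integral => r; rewrite inE /I01/= in_itv/= => /andP[r0 r1].
  by rewrite fundamentalE ?ltW// fundamental_lt1 ?ltW.
rewrite mulrDl mul1r EFinD addeC; apply: leeD; first exact: hardy_sum_le.
rewrite /I01 [X in (_ * X <= _)%E](fundamentalE qpsi ler01 (lexx 1)) -EFinM lee_fin.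
apply: (@le_trans _ _ (v * fundamental phi 1)); last first.
  by have := fundamental_concave qphi (ltW v0) v1 (lexx 1); rewrite mul1r.
rewrite ler_pM2l//; apply: fundamental1_le => // w w0 w1.
apply: (le_trans (psi_le w0 w1)); rewrite -(fundamental_lt1 qphi w0 w1).
by apply: fundamental_mono => //; exact: ltW.
Qed.

(** For one height [l] this is [calderon_kernel_int] at [v = distr y l]; Tonelli sums over the
    heights. The constant [C] will be 1 for majorants and 8 for the transform. *)
Lemma rearr_int_calderon (x y : R -> R) (C : R) : 0 <= C ->
  measurable_fun I01 x -> measurable_fun I01 y ->
  (forall t, 0 < t < 1 -> (drearr x t <= C%:E * calderon (drearr y) t)%E) ->
  (rearr_int psi x <= (C * (2 * c + 1))%:E * rearr_int phi y)%E.
Proof.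
move=> C0 mx my xy; have c0 := hardy_constant_ge0.
pose K (z : measurableTypeR R * measurableTypeR R) := (calderon_kernel (distr y z.2) z.1)%:E.
pose D : set (measurableTypeR R * measurableTypeR R) := [set z | I01 z.1 /\ 0 < z.2].
pose H (z : measurableTypeR R * measurableTypeR R) : \bar R := (K z * (\1_D z)%:E)%E.
have mf : measurable_fun setT (fst : measurableTypeR R * measurableTypeR R -> R).
  exact: measurable_fst.
have mD : measurable D.
  rewrite (_ : D = I01 `*` `]0%R, +oo[%classic).
    by apply: measurableX; exact: measurable_itv.
  by apply/seteqP; split => z; rewrite /D/= in_itv/= andbT.
have mK : measurable_fun setT K.
  have md : measurable_fun setT (fun z : measurableTypeR R * measurableTypeR R => distr y z.2).
    apply: (measurableT_comp (f := distr y)) => //.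
    by apply: nonincreasing_measurable => // a b ab; exact: distr_anti.
  have mV : measurable_fun setT (fun z : measurableTypeR R * measurableTypeR R => (z.1 : R)^-1).
    by apply: (measurableT_comp (@measurable_invr R)).
  apply/measurable_EFinP; apply: measurable_funD.
    by apply: measurable_funM => //; exact: measurable_minr.
  apply: (measurableT_comp (@measurable_ln R)).
  by apply: measurable_funM => //; exact: measurable_maxr.
have mH : measurable_fun setT H.
  by apply: emeasurable_funM => //; apply/measurable_EFinP; exact: measurable_indic.
have H0 z : (0 <= H z)%E.
  rewrite /H indicE; have [|zD] := boolP (z \in D); last by rewrite mule0.
  rewrite inE /D/= /I01/= in_itv/= => -[/andP[t0 _] _]; rewrite mule1 lee_fin.
  exact/calderon_kernel_ge0/t0/distr_ge0.
have calE t : 0 < t < 1 -> calderon (drearr y) t = (\int[leb]_l H (t, l))%E.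
  move=> /andP[t0 t1]; rewrite calderonE// integral_mkcond; apply: eq_integral => l _.
  rewrite patchE /H/= indicE; case: ifPn => [|lN].
    rewrite inE/= in_itv/= andbT => l0.
    by rewrite mem_set ?mule1//= /D/= /I01/= in_itv/= t0 t1.
  rewrite memNset ?mule0// => -[_ /= l0].
  by move/negP: lN; rewrite inE/= in_itv/= andbT.
have mJ : measurable_fun I01 (fun t => \int[leb]_l H (t, l))%E.
  apply: measurable_funTS.
  exact: (measurable_fun_fubini_tonelli_F (m2 := leb) H mH H0).
have J0 t : I01 t -> (0 <= \int[leb]_l H (t, l))%E.
  by move=> _; apply: integral_ge0 => l _; exact: H0.
have C0' : (0 <= C%:E)%E by rewrite lee_fin.
have -> : rearr_int psi x = (\int[stieltjes01 psi]_(s in I01) drearr x s)%E.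
  by rewrite rearr_int.unlock.
apply: (@le_trans _ _ (\int[stieltjes01 psi]_(t in I01) (C%:E * \int[leb]_l H (t, l))%E)%E).
  apply: ge0_le_integral.
  - exact: measurable_I01.
  - by move=> t _; exact: drearr_ge0.
  - by apply: measurable_drearr; exact: measurable_I01.
  - exact: measurable_funeM.
  - move=> t; rewrite /I01/= in_itv/= => t01; rewrite -calE//; exact: xy.
rewrite (ge0_integralZl (stieltjes01 psi) (@measurable_I01 R) mJ J0 C0').
rewrite EFinM -muleA; apply: lee_pmul; [exact: C0'|exact: integral_ge0|exact: lexx|].
have -> : (\int[stieltjes01 psi]_(t in I01) \int[leb]_l H (t, l) =
           \int[stieltjes01 psi]_t \int[leb]_l H (t, l))%E.
  rewrite integral_mkcond; apply: eq_integral => t _; rewrite patchE; case: ifPn => // tI.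
  apply/esym/integral0_eq => l _; rewrite /H indicE memNset ?mule0// => -[/= It _].
  by move/negP: tI; rewrite inE.
rewrite (fubini_tonelli (m1 := stieltjes01 psi) (m2 := leb) H mH H0).

rewrite (rearr_intE qphi my) -ge0_integralZl//; first last.
- by rewrite lee_fin addr_ge0// mulr_ge0.
- by move=> l _; rewrite lee_fin fundamental_ge0.
- exact: measurable_fundamental_distr.
rewrite [leRHS]integral_mkcond; apply: ge0_le_integral; first exact: measurableT.
- by move=> l _; exact: integral_ge0.
- exact: (measurable_fun_fubini_tonelli_G (m1 := stieltjes01 psi) H mH H0).
- apply/(measurable_restrictT _ (measurable_itv _)); apply: measurable_funeM.
  exact: measurable_fundamental_distr.
move=> l _; rewrite patchE; case: ifPn => [|lN]; last first.
  rewrite integral0_eq// => t _; rewrite /H indicE memNset ?mule0// => -[_ /= l0].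
  by move/negP: lN; rewrite inE/= in_itv/= andbT.
rewrite inE/= in_itv/= andbT => l0; rewrite -EFinM.
apply: le_trans (calderon_kernel_int (distr_ge0 _ _) (distr_le1 my _)).
rewrite [leRHS]integral_mkcond; apply: ge0_le_integral => //.
- by move: (measurableT_comp mH (measurable_pair2 l)).
- apply/(measurable_restrictT _ (@measurable_I01 R)); apply: measurable_funTS.
  by move: (measurableT_comp mK (measurable_pair2 l)).
- move=> t _; rewrite /H patchE indicE; case: ifPn => [tI|tN].
    by rewrite mem_set ?mule1//; split => //; rewrite inE in tI.
  by rewrite memNset ?mule0// => -[/= It _]; move/negP: tN; rewrite inE.
Qed.

End CalderonBound.

(** * Majorants of functions in the smaller space *)

Section Majorant.
Context (R : realType).
Local Notation leb := (@lebesgue_measure R).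
Variables (phi : R -> R).
Hypotheses (qphi : quasi_concave phi).

(** [Y] is the supremum of the functions [c k] on []0, v k[]. Its superlevel set at [l] is an
    initial interval, at most twice as long as a single []0, v k[] with [l < c k]; the factor 2
    allows for a supremum of lengths that is not attained. Summing over all such [k] and integrating
    in [l] gives [M]. *)
Lemma sup_of_steps (c v : nat -> R) (M : R) : c 0%N > 0 -> v 0%N = 1 ->
  (forall k, 0 <= c k) -> (forall k, 0 <= v k <= 1) ->
  (forall n, \sum_(k < n) c k * fundamental phi (v k) <= M) ->
  exists Y : R -> R, [/\ measurable_fun I01 Y, (rearr_int phi Y <= (2 * M)%:E)%E &
    forall k l, 0 <= l -> l < c k -> v k <= distr Y l].
Proof.
move=> c00 v01 c0 v0 cM.
have cM1 k : c k * fundamental phi (v k) <= M.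
  apply: le_trans (cM k.+1); rewrite big_ord_recr/= lerDr sumr_ge0// => i _.
  by rewrite mulr_ge0// fundamental_ge0.
pose A t := [set c k | k in [set k | t < v k]].
pose Y t := sup (A t).
have It (t : R) : I01 t -> 0 < t /\ t < 1 by rewrite /I01/= in_itv => /andP.
have A0 t : I01 t -> A t !=set0.
  by move=> /It[_ t1]; exists (c 0%N); exists 0%N; rewrite //= v01.
(* At [t > 0] only steps with [t < v k] count, and for these [c k * fundamental phi t <= M]; so the
   supremum is finite. *)
have Aub t : I01 t -> has_ubound (A t).
  move=> /It[t0 t1]; have ft : 0 < fundamental phi t by rewrite fundamental_gt0// ltW.
  exists (M / fundamental phi t) => _ [k /= tk <-]; rewrite ler_pdivlMr//.
  apply: le_trans (cM1 k); rewrite ler_wpM2l//.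
  by have /andP[_ vk] := v0 k; apply: fundamental_mono => //; exact: ltW.
have Y0 t : I01 t -> 0 <= Y t.
  move=> Ht; have [_ t1] := It _ Ht; apply: (le_trans (c0 0%N)).
  by apply: ub_le_sup; [exact: Aub|exists 0%N; rewrite //= v01].
have aY s t : I01 s -> I01 t -> s <= t -> Y t <= Y s.
  move=> Hs Ht st; apply: ge_sup; first exact: A0.
  move=> _ [k /= tk <-]; apply: ub_le_sup; first exact: Aub.
  by exists k => //=; exact: le_lt_trans tk.
have mY := antitone_measurable aY.
exists Y; split => //; last first.
  move=> k l l0 lk; have /andP[vk0 vk1] := v0 k.
  rewrite -lee_fin -distrE// -[(v k)%:E](_ : leb `]0, v k[%classic = _); last first.
    by rewrite leb_oo// subr0.
  apply: le_measure; rewrite ?inE; [exact: measurable_itv|exact: measurable_superlevel|].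
  move=> t /=; rewrite in_itv/= => /andP[t0 tv].
  have Ht : I01 t by rewrite /I01/= in_itv/= t0 (lt_le_trans tv).
  split => //; rewrite ger0_norm ?Y0//; apply: (lt_le_trans lk).
  by apply: ub_le_sup; [exact: Aub|exists k].
pose S k : set R := `]0, c k[%classic.
pose g k (l : R) : \bar R := ((2 * fundamental phi (v k))%:E * (\1_(S k) l)%:E)%E.
have g0 k l : (0 <= g k l)%E.
  by rewrite mule_ge0 ?lee_fin// mulr_ge0// fundamental_ge0.
have mg k (D : set R) : measurable_fun D (g k).
  apply: measurable_funeM; apply/measurable_EFinP; apply: measurable_indic.
  exact: measurable_itv.
rewrite rearr_intE//.
apply: (@le_trans _ _ (\int[leb]_(l in `]0%R, +oo[) (\sum_(k <oo) g k l))%E).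
  apply: ge0_le_integral => //.
  - by move=> l _; rewrite lee_fin fundamental_ge0.
  - exact: measurable_fundamental_distr.
  - by apply: ge0_emeasurable_sum => [k l _ _|k _]; [exact: g0|exact: mg].
  move=> l /=; rewrite in_itv/= andbT => l0.
  have := distr_ge0 Y l; rewrite le_eqVlt => /predU1P[<-|d0].
    by rewrite fundamental0// nneseries_ge0.
  have [k [ck vk]] : exists k, l < c k /\ distr Y l / 2 < v k.
    apply: contrapT => nk; have : distr Y l <= distr Y l / 2.
      rewrite -lee_fin -distrE//.
      have h0 : 0 <= distr Y l / 2 by rewrite divr_ge0// ltW.
      have <- : leb `]0, distr Y l / 2]%classic = (distr Y l / 2)%:E.
        by rewrite lebesgue_measure_itv/= lte_fin divr_gt0// sube0.
      apply: le_measure; rewrite ?inE; [exact: measurable_superlevel|exact: measurable_itv|].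
      move=> t [Ht]; rewrite ger0_norm ?Y0// => lY; rewrite /= in_itv/=.
      have [t0 _] := It _ Ht; rewrite t0/= leNgt; apply/negP => dt; apply: nk.
      have [_ [k /= tk <-] ck] := sup_gt (A0 _ Ht) lY.
      by exists k; split => //; exact: lt_trans tk.
    by rewrite leNgt ltr_pdivrMr// mulrC ltr_pMl// ltr1n.
  apply: (@le_trans _ _ (g k l)); last first.
    apply: (@le_trans _ _ (\sum_(0 <= i < k.+1) g i l)%E).
      by rewrite big_nat_recr//= leeDr// sume_ge0.
    exact: nneseries_lim_ge.
  have lS : l \in S k by rewrite inE /S/= in_itv/= l0.
  rewrite /g indicE lS mule1 lee_fin.
  have /andP[vk0 vk1] := v0 k.
  by apply: fundamental_dilation; rewrite ?ler1n ?distr_ge0 ?distr_le1//; lra.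
rewrite integral_nneseries//; last by move=> n; exact: mg.
have e k : (\int[leb]_(l in `]0%R, +oo[) g k l = 2%:E * (c k * fundamental phi (v k))%:E)%E.
  rewrite ge0_integralZl//; first last.
  - by rewrite lee_fin mulr_ge0// fundamental_ge0.
  - by apply/measurable_EFinP; apply: measurable_indic; exact: measurable_itv.
  rewrite integral_indic//; last exact: measurable_itv.
  have -> : S k `&` `]0%R, +oo[ = `]0%R, c k[%classic.
    by apply/setIidPl => l /=; rewrite !in_itv/= andbT => /andP[].
  rewrite [X in (_ * X)%E](leb_oo (c0 k)) subr0 -!EFinM; congr EFin; lra.
under eq_eseriesr do rewrite e.
rewrite nneseriesZl; last by move=> k _; rewrite lee_fin mulr_ge0// fundamental_ge0.
rewrite EFinM; apply: lee_pmul => //.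
  by apply: nneseries_ge0 => k _ _; rewrite lee_fin mulr_ge0// fundamental_ge0.
apply: lime_le; first by apply: is_cvg_nneseries => k _; rewrite lee_fin mulr_ge0// fundamental_ge0.
by apply: nearW => n; rewrite big_mkord sumEFin lee_fin.
Qed.

End Majorant.

Section MajorantExists.
Context (R : realType).
Local Notation leb := (@lebesgue_measure R).
Variables (phi psi : R -> R).
Hypotheses (qphi : quasi_concave phi) (qpsi : quasi_concave psi).
Hypothesis near_inf : forall u, 0 < u -> u < 1 ->
  exists v, [/\ u < v, v < 1 & phi v <= 2 * psi u * (1 + ln (v / u))].

(** The infimum only involves [v < 1], so the end point needs an argument: for [u >= 1/2] one has
    [1 + ln (v / u) <= 2], and near-optimality costs another factor 2. *)
Lemma fundamental1_le4 : fundamental phi 1 <= 4 * fundamental psi 1.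
Proof.
apply: fundamental1_le => // w w0 w1; pose u := Num.max w 2^-1.
have u2 : 2^-1 <= u by rewrite le_max lexx orbT.
have u0 : 0 < u by apply: lt_le_trans u2; rewrite invr_gt0.
have u1 : u < 1 by rewrite gt_max w1 invf_lt1// ltr1n.
have wu : w <= u by rewrite le_max lexx.
have [v [uv v1 h]] := near_inf u0 u1.
have pu : psi u <= fundamental psi 1.
  by rewrite -(fundamental_lt1 qpsi (ltW u0) u1) fundamental_mono// ltW.
have pu0 : 0 <= psi u by rewrite -(fundamental_lt1 qpsi (ltW u0) u1) fundamental_ge0.
have wv : phi w <= phi v.
  have wv : w <= v by apply: (le_trans wu); exact: ltW.
  rewrite -(fundamental_lt1 qphi w0 w1) -(fundamental_lt1 qphi (le_trans w0 wv) v1).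
  by apply: fundamental_mono => //; exact: ltW.
have lv : ln (v / u) <= 1.
  have -> : v / u = 1 + (v / u - 1) by lra.
  have vu0 : 0 < v / u by rewrite divr_gt0// (lt_trans u0).
  apply: (@le_trans _ _ (v / u - 1)); first by apply: le_ln1Dx; lra.
  have : v / u <= 2 by rewrite ler_pdivrMr//; lra.
  lra.
nra.
Qed.

(** For [0 < u < 1], [v] is nearly optimal for [psi u] and [a] is the reciprocal of
    [1 + ln (v / u)], the value of [calderon_kernel v] at [u]. The constant 4 is dictated by
    [u = 1], where [v = a = 1]. *)
Lemma step_choice u : 0 <= u -> u <= 1 -> exists v a, [/\ 0 <= v <= 1, 0 <= a,
  a * fundamental phi v <= 4 * fundamental psi u &
  forall t, 0 < t -> t < u -> 1 <= a * calderon_kernel v t].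
Proof.
rewrite le_eqVlt => /predU1P[<- _|u0].
  exists 1, 0; split => //; rewrite ?ler01 ?lexx//.
    by rewrite mul0r mulr_ge0// fundamental_ge0.
  by move=> t t0 /(lt_trans t0); rewrite ltxx.
rewrite le_eqVlt => /predU1P[->|u1].
  exists 1, 1; split => //; rewrite ?ler01 ?lexx//.
    by rewrite mul1r fundamental1_le4.
  move=> t t0 t1; rewrite mul1r /calderon_kernel min_l ?max_l ?(ltW t1)//.
  by rewrite mulfV ?gt_eqF// lerDl ln_ge0// ler_pdivlMr// mul1r ltW.
have [v [uv v1 h]] := near_inf u0 u1; have v0 := lt_trans u0 uv.
have L0 : 0 < 1 + ln (v / u).
  by apply: ltr_pwDl => //; rewrite ln_ge0// ler_pdivlMr// mul1r ltW.
have pu0 : 0 <= fundamental psi u by exact: fundamental_ge0.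
exists v, (1 + ln (v / u))^-1; split.
- by rewrite !ltW.
- by rewrite invr_ge0 ltW.
- rewrite (fundamental_lt1 qphi (ltW v0) v1) mulrC ler_pdivrMr//.
  apply: (le_trans h); rewrite (fundamental_lt1 qpsi (ltW u0) u1).
  rewrite ler_pM2r// ler_wpM2r ?ler_nat//.
  by rewrite -(fundamental_lt1 qpsi (ltW u0) u1).
- move=> t t0 tu; have tv := lt_trans tu uv.
  rewrite mulrC ler_pdivlMr// mul1r /calderon_kernel min_l ?max_l ?(ltW tv)//.
  rewrite mulfV ?gt_eqF// lerD2l ler_ln ?posrE ?divr_gt0//.
  by rewrite ler_pM2l// lef_pV2 ?posrE// ltW.
Qed.

Lemma calderon_ge (y : R -> R) (c v t : R) : measurable_fun I01 y -> 0 < t -> t < 1 ->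
  0 <= c -> 0 <= v -> (forall l, 0 <= l -> l < c -> v <= distr y l) ->
  ((c * calderon_kernel v t)%:E <= calderon (drearr y) t)%E.
Proof.
move=> my t0 t1 c0 v0 vy; rewrite calderonE//.
have mK : measurable_fun (`]0, +oo[ : set R) (fun l => (calderon_kernel (distr y l) t)%:E).
  apply: antitone_emeasurable => // a b _ _ ab; rewrite lee_fin.
  by apply: calderon_kernel_mono => //; exact: distr_anti.
have K0 l : (0 <= (calderon_kernel (distr y l) t)%:E)%E.
  by rewrite lee_fin calderon_kernel_ge0// distr_ge0.
have sub : `]0, c[%classic `<=` (`]0, +oo[%classic : set R).
  by move=> l /=; rewrite !in_itv/= => /andP[->].
apply: (@le_trans _ _ (\int[leb]_(l in `]0%R, c[) (calderon_kernel (distr y l) t)%:E)%E).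
  apply: (@le_trans _ _ (\int[leb]_(l in `]0%R, c[) (calderon_kernel v t)%:E)%E).
    rewrite integral_cst; last exact: measurable_itv.
    by rewrite [X in (_ * X)%E](leb_oo c0) subr0 -EFinM mulrC.
  apply: ge0_le_integral => //.
  - by move=> l _; rewrite lee_fin calderon_kernel_ge0.
  - exact: measurable_funS mK.
  - move=> l /=; rewrite in_itv/= => /andP[l0 lc]; rewrite lee_fin.
    by apply: calderon_kernel_mono => //; apply: vy => //; exact: ltW.
by apply: ge0_subset_integral => //.
Qed.

(** The heights from [A / 2 * 2 ^+ k] to [A * 2 ^+ k] form an interval of length [A * 2 ^+ k / 2],
    on which the decreasing integrand is at least its value at the right end. *)
Lemma geometric_layers (x : R -> R) (A : R) n : measurable_fun I01 x -> 0 < A ->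
  ((\sum_(k < n) A * 2 ^+ k * fundamental psi (distr x (A * 2 ^+ k)))%:E <=
   2%:E * \int[leb]_(l in `](A / 2)%R, (A / 2 * 2 ^+ n)%R[) (fundamental psi (distr x l))%:E)%E.
Proof.
move=> mx A0; have mf D : measurable D -> measurable_fun D (fun l => (fundamental psi (distr x l))%:E).
  exact: measurable_fundamental_distr.
have A2 : 0 < A / 2 by rewrite divr_gt0.
elim: n => [|n IH].
  by rewrite big_ord0 mule_ge0//; apply: integral_ge0 => l _; rewrite lee_fin fundamental_ge0.
have n0 : (0 : R) < 2 ^+ n by rewrite exprn_gt0.
have n1 : (1 : R) <= 2 ^+ n by rewrite exprn_ege1// ler1n.
rewrite big_ord_recr/= EFinD (@integral_oo_split _ _ (A / 2 * 2 ^+ n)).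
- rewrite ge0_muleDr//; [|by apply: integral_ge0 => l _; rewrite lee_fin fundamental_ge0..].
  apply: leeD; first exact: IH.
  apply: (@le_trans _ _ (2%:E * \int[leb]_(l in `](A / 2 * 2 ^+ n)%R, (A / 2 * 2 ^+ n.+1)%R[)
     (fundamental psi (distr x (A * 2 ^+ n)))%:E)%E).
    rewrite integral_cst; last exact: measurable_itv.
    have le_n : A / 2 * 2 ^+ n <= A / 2 * 2 ^+ n.+1 by rewrite exprS; nra.
    rewrite [X in (_ * (_ * X))%E](leb_oo le_n) -!EFinM lee_fin exprS.
    set f := fundamental _ _; rewrite le_eqVlt; apply/orP; left; apply/eqP; lra.
  apply: lee_pmul => //; first by apply: integral_ge0 => l _; rewrite lee_fin fundamental_ge0.
  apply: ge0_le_integral => //.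
  + by move=> l _; rewrite lee_fin fundamental_ge0.
  + by apply: mf; exact: measurable_itv.
  + move=> l /=; rewrite in_itv/= => /andP[_ lA]; rewrite lee_fin.
    apply: fundamental_mono; rewrite ?distr_ge0 ?distr_le1//; apply: distr_anti => //.
    by apply: (le_trans (ltW lA)); rewrite exprS; lra.
- by nra.
- by rewrite exprS; nra.
- by apply: mf; exact: measurable_itv.
- by move=> l _; rewrite lee_fin fundamental_ge0.
Qed.

Lemma majorant_exists (x : R -> R) (A : R) : measurable_fun I01 x -> 0 < A ->
  (rearr_int psi x <= A%:E)%E ->
  exists Y : R -> R, [/\ measurable_fun I01 Y, (rearr_int phi Y <= (34 * A)%:E)%E &
    forall t, 0 < t < 1 -> (drearr x t <= calderon (drearr Y) t)%E].
Proof.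
move=> mx A0 xA; pose u k := distr x (A * 2 ^+ k).
have /choice[va vaP] : forall k, exists va : R * R, [/\ 0 <= va.1 <= 1, 0 <= va.2,
    va.2 * fundamental phi va.1 <= 4 * fundamental psi (u k) &
    forall t, 0 < t -> t < u k -> 1 <= va.2 * calderon_kernel va.1 t].
  move=> k; have [v [a h]] := step_choice (distr_ge0 x (A * 2 ^+ k)) (distr_le1 mx _).
  by exists (v, a).
(* Where [drearr x] lies between [A * 2 ^+ k] and [A * 2 ^+ k.+1] one has [t < u k], so the step
   chosen for the lower height carries the larger factor. Index 0 is the constant [A] on (0,1), for
   the points with [drearr x t <= A]. *)
pose c k := if k is k'.+1 then A * 2 ^+ k'.+1 * (va k').2 else A.
pose v k := if k is k'.+1 then (va k').1 else 1.
have c_ge0 k : 0 <= c k.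
  case: k => [|k] /=; first exact: ltW.
  by have [_ a0 _ _] := vaP k; rewrite mulr_ge0// mulr_ge0 ?exprn_ge0// ltW.
have v01 k : 0 <= v k <= 1.
  by case: k => [|k] /=; [rewrite ler01 lexx|have [] := vaP k].
(* 17 is 1 for the constant step plus 16, the product of 2 from the index shift, 4 from
   [step_choice] and 2 from [geometric_layers]. [sup_of_steps] doubles it to 34. *)
have cM n : \sum_(k < n) c k * fundamental phi (v k) <= 17 * A.
  case: n => [|n]; first by rewrite big_ord0 mulr_ge0// ltW.
  rewrite big_ord_recl/=.
  have h1 : A * fundamental phi 1 <= A.
    by rewrite ger_pMr// fundamental_le1.
  suff h2 : \sum_(i < n) A * 2 ^+ i.+1 * (va i).2 * fundamental phi (va i).1 <= 16 * A.
    by move: h1 h2; rewrite /bump/=; lra.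
  apply: (@le_trans _ _ (8 * \sum_(i < n) A * 2 ^+ i * fundamental psi (u i))).
    rewrite mulr_sumr; apply: ler_sum => i _; have [_ a0 h _] := vaP i.
    have p0 : 0 <= A * 2 ^+ i by rewrite mulr_ge0 ?exprn_ge0// ltW.
    by rewrite exprS; have := ler_wpM2l p0 h; lra.
  have {}xA : \sum_(i < n) A * 2 ^+ i * fundamental psi (u i) <= 2 * A.
    rewrite -lee_fin; apply: le_trans (geometric_layers n mx A0) _.
    rewrite EFinM; apply: lee_pmul => //.
      by apply: integral_ge0 => l _; rewrite lee_fin fundamental_ge0.
    apply: le_trans xA; rewrite (rearr_intE qpsi mx); apply: ge0_subset_integral => //.
    - exact: measurable_fundamental_distr.
    - by move=> l _; rewrite lee_fin fundamental_ge0.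
    - move=> l /=; rewrite !in_itv/= => /andP[lA _]; rewrite andbT.
      by apply: lt_trans lA; rewrite divr_gt0.
  lra.
have [Y [mY NY Yc]] := sup_of_steps qphi A0 (erefl : v 0%N = 1) c_ge0 v01 cM.
exists Y; split => //.
  by rewrite [X in (_ <= X%:E)%E](_ : _ = 2 * (17 * A)) //; lra.
move=> t /andP[t0 t1].
have step k : ((c k * calderon_kernel (v k) t)%:E <= calderon (drearr Y) t)%E.
  by apply: calderon_ge => //; [have /andP[] := v01 k|exact: Yc].
rewrite -(fineK (drearr_fin mx t0)); set m := fine (drearr x t).
have [mA|Am] := leP m A.
  apply: le_trans (step 0%N); rewrite lee_fin; apply: (le_trans mA).
  rewrite ler_peMr ?(ltW A0)//= /calderon_kernel min_l ?max_l ?(ltW t1)//.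
  by rewrite mulfV ?gt_eqF// lerDl ln_ge0// ler_pdivlMr// mul1r ltW.
have exn : exists n, m <= A * 2 ^+ n.
  have [n] : exists n, m / A <= n%:R.
    by exists (Num.bound (m / A)); apply/ltW/archi_boundP; rewrite divr_ge0// ltW// (lt_trans A0).
  rewrite ler_pdivrMr// => h; exists n; apply: (le_trans h); rewrite mulrC ler_pM2l//.
  by rewrite -natrX ler_nat ltnW// ltn_expl.
(* Minimality gives [A * 2 ^+ k < m <= A * 2 ^+ k.+1]. *)
have := ex_minnP exn => -[[|k] h hmin]; first by move: h; rewrite expr0 mulr1 leNgt Am.
have tk : t < u k.
  rewrite /u -drearr_gtE// ?mulr_ge0 ?exprn_ge0// ?ltW//.
  rewrite -(fineK (drearr_fin mx t0)) lte_fin ltNge; apply/negP => /hmin.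
  by rewrite ltnn.
have [_ a0 _ /(_ _ t0 tk) ak] := vaP k.
apply: le_trans (step k.+1); rewrite lee_fin; apply: (le_trans h) => /=.
have p0 : 0 <= A * 2 ^+ k.+1 by rewrite mulr_ge0 ?exprn_ge0// ltW.
by have := ler_wpM2l p0 ak; lra.
Qed.

End MajorantExists.

(** * Quasi-concavity of [phi] and of [psi_of phi] *)

Section ConcavePhi.
Context (R : realType).
Variable phi : R -> R.
Hypotheses (phi01 : {in `[0, 1[, forall t, 0 <= phi t < 1})
  (phi_incr : {in `[0, 1[ &, {homo phi : s t / s <= t}})
  (phi_neq0 : exists2 t, t \in `[0, 1[ & phi t != 0)
  (phi_concave : convex_function (`[0, 1[%classic : set R^o) (fun t => - phi t))
  (phi0 : phi t @[t --> 0^'+] --> (0 : R)).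

(** The quotient clause is concavity between 0 and [t], using [phi 0 >= 0]. A single nonzero value
    makes [phi] positive on (0,1): to its left by the quotient clause, to its right by
    monotonicity. *)
Lemma concave_quasi_concave : quasi_concave phi.
Proof.
have phi_ge0 t : 0 <= t -> t < 1 -> 0 <= phi t.
  by move=> t0 t1; have /andP[] : 0 <= phi t < 1 by apply: phi01; rewrite in_itv/= t0.
have conc s t : 0 <= s -> s <= t -> t < 1 -> s * phi t <= t * phi s.
  move=> s0 st t1; have t0 := le_trans s0 st.
  have p0 := phi_ge0 _ (lexx 0) ltr01.
  move: t0; rewrite le_eqVlt => /predU1P[t0|t0].
    have -> : s = 0 by apply/eqP; rewrite eq_le s0 t0 st.
    by rewrite -t0 !mul0r.
  have q0 : 0 <= s / t by rewrite divr_ge0// ltW.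
  have q1 : s / t <= 1 by rewrite ler_pdivrMr// mul1r.
  have tD : t \in (`[0, 1[%classic : set R^o) by rewrite inE/= in_itv/= (ltW t0).
  have zD : (0 : R) \in (`[0, 1[%classic : set R^o) by rewrite inE/= in_itv/= lexx ltr01.
  have h : - phi (s / t * t + (1 - s / t) * 0) <= s / t * (- phi t) + (1 - s / t) * - phi 0.
    exact: (phi_concave (Itv01 q0 q1) tD zD).
  rewrite mulr0 addr0 divfK ?gt_eqF// in h.
  have : s / t * phi t <= phi s.
    have : 0 <= (1 - s / t) * phi 0 by rewrite mulr_ge0// subr_ge0.
    lra.
  by rewrite -(ler_pM2l t0) mulrA mulrCA mulfV ?gt_eqF// mulr1.
split => //.
move=> t /andP[t0 t1]; have [t1' + pt] := phi_neq0; rewrite in_itv/= => /andP[u0 u1].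
have pu : 0 < phi t1' by rewrite lt_neqAle eq_sym pt phi_ge0.
have [tu|ut] := leP t t1'.
  have := conc _ _ (ltW t0) tu u1 => h.
  have tu0 := lt_le_trans t0 tu.
  by rewrite -(pmulr_rgt0 _ tu0); apply: lt_le_trans h; rewrite mulr_gt0.
apply: (lt_le_trans pu); apply: phi_incr; rewrite ?in_itv/= ?u0 ?(ltW t0) ?t1//.
exact: ltW.
Qed.

End ConcavePhi.

Section PsiOf.
Context (R : realType).
Variable phi : R -> R.
Hypothesis qphi : quasi_concave phi.
Local Notation psi := (psi_of phi).

Let phi_ge0 t : 0 <= t -> t < 1 -> 0 <= phi t.
Proof.
by case: qphi => h _ _ _ _ t0 t1; have /andP[] : 0 <= phi t < 1 by apply: h; rewrite in_itv/= t0.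
Qed.

Let den_gt0 (u v : R) : 0 < u -> u <= v -> 0 < 1 + ln (v / u).
Proof. by move=> u0 uv; apply: ltr_pwDl => //; rewrite ln_ge0// ler_pdivlMr// mul1r. Qed.

(** The substitution [v = u * w], after which the denominator is [calderon_kernel v u]. *)
Let psiE (u : R) : 0 < u -> u < 1 ->
  psi u = inf [set phi v / (1 + ln (v / u)) | v in [set v : R | u < v /\ v < 1]].
Proof.
move=> u0 u1; congr inf; apply/seteqP; split => r /= [].
- move=> w [w1 /(_ u0) wu] <-; exists (u * w).
    split; first by rewrite ltr_pMr.
    by rewrite -ltr_pdivlMl// mulr1.
  by rewrite mulrAC mulfV ?gt_eqF// mul1r.
- move=> v [uv v1] <-; exists (v / u); last by rewrite mulrCA mulfV ?gt_eqF// mulr1.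
  split; first by rewrite ltr_pdivlMr// mul1r.
  by move=> _; rewrite ltr_pdivrMr// mulVf// gt_eqF.
Qed.

Let psi_lb (u : R) : 0 < u -> u < 1 ->
  has_inf [set phi v / (1 + ln (v / u)) | v in [set v : R | u < v /\ v < 1]].
Proof.
move=> u0 u1; split.
  by exists (phi ((u + 1) / 2) / (1 + ln ((u + 1) / 2 / u))), ((u + 1) / 2); rewrite //=; have [] := midf_lt u1.
exists 0 => _ [v [uv v1] <-]; have v0 := lt_trans u0 uv.
by apply: divr_ge0; [apply: phi_ge0 => //; exact: ltW|exact/ltW/den_gt0/ltW].
Qed.

Lemma psi_of_le (u v : R) : 0 < u -> u < v -> v < 1 -> psi u <= phi v / (1 + ln (v / u)).
Proof.
move=> u0 uv v1; have u1 := lt_trans uv v1; rewrite psiE//.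
by apply: ge_inf; [case: (psi_lb u0 u1)|exists v].
Qed.

Lemma psi_of_ge (u B : R) : 0 < u -> u < 1 ->
  (forall v, u < v -> v < 1 -> B <= phi v / (1 + ln (v / u))) -> B <= psi u.
Proof.
move=> u0 u1 H; rewrite psiE//; apply: lb_le_inf; first by case: (psi_lb u0 u1).
by move=> _ [v [uv v1] <-]; exact: H.
Qed.

Lemma psi_of_gt0 (u : R) : 0 < u -> u < 1 -> 0 < psi u.
Proof.
move=> u0 u1; have d1 := den_gt0 u0 (ltW u1).
have pu : 0 < phi u by case: qphi => _ _ _ _; apply; rewrite u0.
apply: (@lt_le_trans _ _ (phi u / (1 + ln (1 / u)))); first by rewrite divr_gt0.
apply: psi_of_ge => // v uv v1; have v0 := lt_trans u0 uv.
apply: ler_pM; [exact: ltW|by rewrite invr_ge0 ltW| |].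
  rewrite -(fundamental_lt1 qphi (ltW u0) u1) -(fundamental_lt1 qphi (ltW v0) v1).
  by apply: fundamental_mono => //; exact: ltW.
rewrite lef_pV2 ?posrE//; last exact/den_gt0/ltW.
rewrite lerD2l ler_ln ?posrE ?divr_gt0//.
by rewrite ler_pM2r ?invr_gt0// ltW.
Qed.

Lemma psi_of_le_phi (u : R) : 0 <= u -> u < 1 -> psi u <= phi u.
Proof.
rewrite le_eqVlt => /predU1P[<- _|u0 u1].
  rewrite (quasi_concave0 qphi) /psi_of.
  rewrite [X in inf X](_ : _ = [set 0]) ?inf1//; apply/seteqP; split => r /=.
    by move=> [w _ <-]; rewrite mul0r (quasi_concave0 qphi) mul0r.
  move=> ->; exists 2; last by rewrite mul0r (quasi_concave0 qphi) mul0r.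
  by split; [rewrite ltr1n|rewrite ltxx].
have pu : 0 < phi u by case: qphi => _ _ _ _; apply; rewrite u0.
rewrite leNgt; apply/negP => h.
(* For [u < v] below [psi u * u / phi u], the bound [phi v <= v / u * phi u] forces [phi v < psi u],
   against [psi_of_le]. This stands for letting [v] decrease to [u]. *)
pose b := Num.min 1 (psi u * u / phi u).
have ub : u < b.
  rewrite lt_min u1/= ltr_pdivlMr// mulrC ltr_pM2r//.
have [uv vb] := midf_lt ub; set v := (_ / 2) in uv vb.
have [v1 vp] : v < 1 /\ v < psi u * u / phi u.
  by move: vb; rewrite lt_min => /andP[].
have v0 := lt_trans u0 uv.
have := psi_of_le u0 uv v1; rewrite ler_pdivlMr; last exact/den_gt0/ltW.
case: qphi => _ _ /(_ u v (ltW u0) (ltW uv) v1) cv _ _.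
move: vp; rewrite ltr_pdivlMr// => vp h2.
have l0 : 0 <= ln (v / u) by rewrite ln_ge0// ler_pdivlMr// mul1r ltW.
have p0 : 0 < psi u by exact: psi_of_gt0.
have pL : 0 <= psi u * ln (v / u) by rewrite mulr_ge0// ltW.
have : psi u * u <= phi v * u by rewrite ler_pM2r//; lra.
lra.
Qed.

Lemma psi_of_0 : psi 0 = 0.
Proof.
apply/eqP; rewrite eq_le -{2}(quasi_concave0 qphi) psi_of_le_phi//=.
apply: lb_le_inf.
  by exists (phi (0 * 2) / (1 + ln 2)); exists 2 => //; split; [rewrite ltr1n|rewrite ltxx].
move=> _ [w [w1 _] <-]; rewrite mul0r divr_ge0 ?phi_ge0//.
by rewrite addr_ge0// ln_ge0// ltW.
Qed.

Lemma psi_of_near (u : R) : 0 < u -> u < 1 ->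
  exists v, [/\ u < v, v < 1 & phi v <= 2 * psi u * (1 + ln (v / u))].
Proof.
move=> u0 u1; have p0 := psi_of_gt0 u0 u1.
(* As [psi u] is positive it can itself be the tolerance, whence the factor 2. *)
have [_ [v [uv v1] <-]] := inf_adherent p0 (psi_lb u0 u1).
rewrite -psiE// => h; exists v; split => //.
by rewrite -ler_pdivrMr ?(den_gt0 u0 (ltW uv))//; lra.
Qed.

Lemma psi_of_quasi_concave : quasi_concave psi.
Proof.
have ge0 t : 0 <= t -> t < 1 -> 0 <= psi t.
  rewrite le_eqVlt => /predU1P[<- _|t0 t1]; first by rewrite psi_of_0.
  exact/ltW/psi_of_gt0.
split.
- move=> t; rewrite in_itv/= => /andP[t0 t1]; rewrite ge0//=.
  apply: (le_lt_trans (psi_of_le_phi t0 t1)).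
  by case: qphi => /(_ t); rewrite in_itv/= t0 t1 => /(_ isT) /andP[].
- move=> s t; rewrite !in_itv/= => /andP[s0 s1] /andP[t0 t1] st.
  move: s0; rewrite le_eqVlt => /predU1P[<-|s0]; first by rewrite psi_of_0 ge0.
  apply: psi_of_ge => //; first exact: lt_le_trans st.
  move=> v tv v1; have t0' := lt_le_trans s0 st; have v0 := lt_trans t0' tv.
  apply: (le_trans (psi_of_le s0 (le_lt_trans st tv) v1)).
  apply: ler_wpM2l; first by apply: phi_ge0 => //; exact: ltW.
  have dt := den_gt0 t0' (ltW tv); have ds := den_gt0 s0 (ltW (le_lt_trans st tv)).
  rewrite lef_pV2 ?posrE//.
  rewrite lerD2l ler_ln ?posrE ?divr_gt0// ler_pM2l// lef_pV2 ?posrE//.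
- move=> s t s0 st t1.
  move: s0; rewrite le_eqVlt => /predU1P[<-|s0].
    by rewrite mul0r psi_of_0 mulr0.
  have t0 := lt_le_trans s0 st; have s1 := le_lt_trans st t1.
  rewrite -ler_pdivrMl//; apply: psi_of_ge => // v sv v1.
  have v0 := lt_trans s0 sv; have dv := den_gt0 s0 (ltW sv).
  have pv : 0 <= phi v by apply: phi_ge0 => //; exact: ltW.
  have lnle (a : R) : 0 < a -> 1 + ln a <= a.
    by move=> a0; have := @le_ln1Dx R (a - 1); rewrite addrCA subrr addr0; lra.
  (* If [v <= t], use [psi t <= phi t <= t / v * phi v] and [1 + ln (v / s) <= v / s]. If [t < v],
     the same [v] competes in the infimum for [psi t], and [1 + ln (v / s) <= t / s * (1 + ln (v /
     t))]. *)
  rewrite ler_pdivlMr//; have [vt|tv] := leP v t.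
    have h1 := psi_of_le_phi (ltW t0) t1.
    have [_ _ /(_ v t (ltW v0) vt t1) h2 _ _] := qphi.
    have h3 := lnle _ (divr_gt0 v0 s0).
    have pt := ge0 _ (ltW t0) t1.
    rewrite -(ler_pM2l t0).
    apply: (@le_trans _ _ (s * psi t * (v / s))).
      have -> (X : R) : t * (t^-1 * (s * psi t) * X) = (t / t) * (s * psi t * X) by lra.
      rewrite mulfV ?gt_eqF// mul1r.
      by apply: ler_wpM2l => //; apply: mulr_ge0 => //; exact: ltW.
    have -> : s * psi t * (v / s) = v * psi t.
      have -> : s * psi t * (v / s) = (s / s) * (v * psi t) by lra.
      by rewrite mulfV ?gt_eqF// mul1r.
    by apply: le_trans h2; rewrite ler_pM2l.
  have h := psi_of_le t0 tv v1; have dt := den_gt0 t0 (ltW tv).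
  move: h; rewrite ler_pdivlMr// => h.
  have L0 : 0 <= ln (v / t) by rewrite ln_ge0// ler_pdivlMr// mul1r ltW.
  have h3 := lnle _ (divr_gt0 t0 s0).
  have e : ln (v / s) = ln (v / t) + ln (t / s).
    by rewrite -lnM ?posrE ?divr_gt0// mulrA divfK// gt_eqF.
  have r1 : 1 <= t / s by rewrite ler_pdivlMr// mul1r.
  have pt := ge0 _ (ltW t0) t1.
  apply: (@le_trans _ _ (t^-1 * (s * psi t) * (t / s * (1 + ln (v / t))))).
    apply: ler_wpM2l; first by rewrite mulr_ge0 ?invr_ge0 ?(ltW t0)// mulr_ge0// ltW.
    by rewrite e; nra.
  have -> : t^-1 * (s * psi t) * (t / s * (1 + ln (v / t))) =
      (t^-1 * t) * (s / s) * (psi t * (1 + ln (v / t))) by lra.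
  by rewrite mulVf ?gt_eqF// mulfV ?gt_eqF// !mul1r.
- case: qphi => _ _ _ cphi _.
  apply: (@squeeze_cvgr _ _ _ _ (cst 0) phi) => //; last exact: cvg_cst.
  near=> t.
  have t0 : 0 < t by near: t; exact: nbhs_right_gt.
  have t1 : t < 1 by near: t; exact: nbhs_right_lt.
  by rewrite ge0 ?(ltW t0)//= psi_of_le_phi// ltW.
- by move=> t /andP[t0 t1]; exact: psi_of_gt0.
Unshelve. all: by end_near. Qed.

End PsiOf.

(** * Equality of the two spaces with equivalent quasi-norms *)

Section SameSpace.
Context (R : realType).
Local Notation leb := (@lebesgue_measure R).
Variables (phi psi : R -> R) (c : R).
Hypotheses (qphi : quasi_concave phi) (qpsi : quasi_concave psi).
Hypothesis psi_le : forall u, 0 <= u -> u < 1 -> psi u <= phi u.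
Hypothesis hc : forall u : R, 0 < u < 1 ->
    (\int[leb]_(t in `]0%R, u[) (psi t / t)%:E
     + u%:E * \int[leb]_(t in `]u, 1%R[) (psi t / t ^+ 2)%:E
     <= (c * phi u)%:E)%E.
Hypothesis near_inf : forall u, 0 < u -> u < 1 ->
  exists v, [/\ u < v, v < 1 & phi v <= 2 * psi u * (1 + ln (v / u))].

(** Chebyshev bounds a height times [fundamental psi t], and the latter is at least
    [t * fundamental psi 1]. *)
Lemma lorentz_weak_L1 (x : R -> R) : lorentz_space psi x -> weak_L1 x.
Proof.
move=> Fx; have mx := lorentz_measurable Fx; split => //.
have p1 : 0 < fundamental psi 1 by apply: fundamental_gt0.
apply: (@le_lt_trans _ _ (lorentz_size psi x / fundamental psi 1)%:E); last exact: ltry.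
apply: ge_ereal_sup => _ [t /= + <-]; rewrite in_itv/= => /andP[t0 t1].
rewrite -(fineK (drearr_fin mx t0)) -EFinM lee_fin mulrC -ler_pdivlMr//.
apply/ler_addgt0Pl => e e0; rewrite -lerBlDl; set s := _ - e.
have [s0|s0] := ltP s 0.
  by apply: (le_trans (ltW s0)); rewrite !divr_ge0 ?lorentz_size_ge0 ?fundamental_ge0 ?ltW.
have : (s%:E < drearr x t)%E by rewrite -(fineK (drearr_fin mx t0)) lte_fin /s ltrBlDr ltrDl.
rewrite drearr_gtE// => td; rewrite ler_pdivlMr// ler_pdivlMr//.
have := lorentz_chebyshev qpsi mx s0; rewrite lorentz_sizeE// lee_fin; apply: le_trans.
rewrite -mulrA ler_wpM2l//.
apply: (@le_trans _ _ (fundamental psi t)).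
  by have := fundamental_concave qpsi (ltW t0) t1 (lexx 1); rewrite mul1r.
by apply: fundamental_mono; rewrite ?distr_le1 ?ltW.
Qed.

Lemma S_majorant_lorentz (x y : R -> R) : measurable_fun I01 x ->
  S_majorant (lorentz_space phi) x y ->
  lorentz_space psi x /\ lorentz_size psi x <= (2 * c + 1) * lorentz_size phi y.
Proof.
move=> mx [Fy xy]; have my := lorentz_measurable Fy.
apply: lorentz_bound => //.
have := rearr_int_calderon qphi qpsi psi_le hc ler01 mx my.
rewrite mul1r EFinM -lorentz_sizeE// => H; apply: H => t t01.
by rewrite mul1e; exact: xy.
Qed.

(** [A] is separate from the size of [x] because the heights [A * 2 ^+ k] require it to be positive,
    while the size may be 0. *)
Lemma lorentz_S_majorant (x : R -> R) (A : R) : lorentz_space psi x -> 0 < A ->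
  lorentz_size psi x <= A ->
  exists2 y, S_majorant (lorentz_space phi) x y & lorentz_size phi y <= 34 * A.
Proof.
move=> Fx A0 xA; have mx := lorentz_measurable Fx.
have [|Y [mY NY xY]] := majorant_exists qphi qpsi near_inf mx A0.
  by rewrite lorentz_sizeE// lee_fin.
have [FY sY] := lorentz_bound mY NY.
by exists Y.
Qed.

Lemma S_space_lorentz : same_space
  (S_space (lorentz_space phi)) (S_norm (lorentz_space phi) (lorentz_size phi))
  (lorentz_space psi) (lorentz_size psi).
Proof.
have c0 := hardy_constant_ge0 qphi qpsi hc.
have SL x : S_space (lorentz_space phi) x -> lorentz_space psi x.
  by move=> [[mx _] [y xy]]; have [] := S_majorant_lorentz mx xy.
split.
  apply/seteqP; split => x; first exact: SL.
  move=> Fx; split; first exact: lorentz_weak_L1.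
  have s0 := lorentz_size_ge0 psi x.
  have [y xy _] := @lorentz_S_majorant x (lorentz_size psi x + 1) Fx ltac:(lra) ltac:(lra).
  by exists y.
(* One constant for both directions, whose own constants are 34 and [2 * c + 1]. *)
exists (34 + (2 * c + 1)) => x Sx; have Fx := SL _ Sx; have [[mx _] [y0 xy0]] := Sx.
have s0 := lorentz_size_ge0 psi x.
have lbS : has_lbound [set lorentz_size phi y | y in S_majorant (lorentz_space phi) x].
  by exists 0 => _ [y _ <-]; exact: lorentz_size_ge0.
have neS : [set lorentz_size phi y | y in S_majorant (lorentz_space phi) x] !=set0.
  by exists (lorentz_size phi y0); exists y0.
have S0 : 0 <= S_norm (lorentz_space phi) (lorentz_size phi) x.
  by apply: lb_le_inf => // _ [y _ <-]; exact: lorentz_size_ge0.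
split.
  suff : S_norm (lorentz_space phi) (lorentz_size phi) x <= 34 * lorentz_size psi x by nra.
  apply/ler_addgt0Pr => e e0.
  have [y xy yA] := @lorentz_S_majorant x (lorentz_size psi x + e / 34) Fx ltac:(lra) ltac:(lra).
  apply: (@le_trans _ _ (lorentz_size phi y)); last lra.
  by apply: ge_inf => //; exists y.
have cp : 0 < 2 * c + 1 by lra.
suff : lorentz_size psi x <= (2 * c + 1) * S_norm (lorentz_space phi) (lorentz_size phi) x by nra.
rewrite mulrC -ler_pdivrMr//; apply: lb_le_inf => // _ [y xy <-].
rewrite ler_pdivrMr// mulrC.
by have [] := S_majorant_lorentz mx xy.
Qed.

End SameSpace.

(** * Dyadic martingales *)

Section DyadicMartingale.
Context (R : realType).
Implicit Types (a b : nat -> nat -> R) (g : nat -> R).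

(** [a n i] is the value on the [i]-th interval of level [n], whose halves have indices [i.*2] and
    [i.*2.+1]; nothing is required for [i >= 2 ^ n]. With arrays the martingale inequalities become
    inductions on the level. *)
Definition dyadic_martingale a := forall n i, (i < 2 ^ n)%N ->
  a n i = (a n.+1 i.*2 + a n.+1 i.*2.+1) / 2.

(* The sum of the differences of even order up to level [n], on the [j]-th
   dyadic interval of that level. *)
Fixpoint even_part a n j : R :=
  if n is n'.+1 then
    even_part a n' j./2 + (if odd n' then a n'.+1 j - a n' j./2 else 0)
  else a 0%N j.

Definition level_mean n g : R := 2 ^- n * \sum_(j < 2 ^ n) g j.

Lemma sum_double (m : nat) g :
  \sum_(j < m.*2) g j = \sum_(i < m) (g i.*2 + g i.*2.+1).
Proof.
elim: m => [|m IH]; first by rewrite !big_ord0.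
by rewrite doubleS !big_ord_recr/= IH addrA.
Qed.

Lemma level_meanS n g :
  level_mean n.+1 g = level_mean n (fun i => (g i.*2 + g i.*2.+1) / 2).
Proof.
by rewrite /level_mean expnS mul2n sum_double exprS invfM -mulr_suml; lra.
Qed.

Lemma level_mean0 g : level_mean 0 g = g 0%N.
Proof. by rewrite /level_mean expr0 invr1 mul1r big_ord_recl big_ord0 addr0. Qed.

Lemma le_level_mean n f g : (forall j, (j < 2 ^ n)%N -> f j <= g j) ->
  level_mean n f <= level_mean n g.
Proof.
move=> fg; apply: ler_wpM2l; first by rewrite invr_ge0 exprn_ge0.
by apply: ler_sum => j _; exact: fg.
Qed.

Lemma eq_level_mean n f g : (forall j, (j < 2 ^ n)%N -> f j = g j) ->
  level_mean n f = level_mean n g.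
Proof. by move=> fg; congr (_ * _); apply: eq_bigr => j _; exact: fg. Qed.

Lemma level_meanD n f g :
  level_mean n (fun j => f j + g j) = level_mean n f + level_mean n g.
Proof. by rewrite /level_mean big_split/= mulrDr. Qed.

Lemma level_meanZ n (k : R) f : level_mean n (fun j => k * f j) = k * level_mean n f.
Proof. by rewrite /level_mean -mulr_sumr mulrCA. Qed.

Lemma half_double1 i : (i.*2.+1)./2 = i.
Proof. by rewrite /= uphalf_double. Qed.

Section OneMartingale.
Variables (a : nat -> nat -> R) (ma : dyadic_martingale a).

Lemma children n i : (i < 2 ^ n)%N -> exists h,
  a n.+1 i.*2 = a n i + h /\ a n.+1 i.*2.+1 = a n i - h.
Proof. by move=> /ma e; exists (a n.+1 i.*2 - a n i); split; lra. Qed.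

Lemma even_part_children n i h : a n.+1 i.*2 = a n i + h -> a n.+1 i.*2.+1 = a n i - h ->
  even_part a n.+1 i.*2 = even_part a n i + (if odd n then h else 0) /\
  even_part a n.+1 i.*2.+1 = even_part a n i - (if odd n then h else 0).
Proof.
move=> e1 e2; rewrite /= doubleK uphalf_double e1 e2.
by case: ifP => _; split; lra.
Qed.

(** Passing to the next level adds the mean of [h ^+ 2] to the second moment of [a], and to that of
    [even_part a] the same or nothing. *)
Lemma even_part_sqr n :
  level_mean n (fun j => even_part a n j ^+ 2) <= level_mean n (fun j => a n j ^+ 2).
Proof.
suff : 0 <= level_mean n (fun j => a n j ^+ 2 - even_part a n j ^+ 2).
  rewrite (_ : (fun j => _) = fun j => a n j ^+ 2 + (-1) * even_part a n j ^+ 2).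
    by rewrite level_meanD level_meanZ; lra.
  by apply/funext => j; lra.
elim: n => [|n IH]; first by rewrite level_mean0 subrr.
apply: (le_trans IH); rewrite level_meanS; apply: le_level_mean => i ni.
have [h [e1 e2]] := children ni.
have [-> ->] := even_part_children e1 e2; rewrite e1 e2.
by have := sqr_ge0 h; case: ifP => _; lra.
Qed.

(** Orthogonality of increments; [iter k half j] is the ancestor of [j] at level [n]. In [G] both
    squares gain the same amount at each level, so its mean stays constant. *)
Lemma even_part_incr_sqr n k :
  level_mean (k + n) (fun j => (even_part a (k + n) j - even_part a n (iter k half j)) ^+ 2) =
  level_mean (k + n) (fun j => even_part a (k + n) j ^+ 2)
  - level_mean n (fun j => even_part a n j ^+ 2).
Proof.
pose G k j := (even_part a (k + n) j - even_part a n (iter k half j)) ^+ 2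
  - even_part a (k + n) j ^+ 2.
have GE m : level_mean (m + n) (G m) = - level_mean n (fun j => even_part a n j ^+ 2).
  elim: m => [|m IH].
    rewrite add0n -mulN1r -level_meanZ; apply: eq_level_mean => j _.
    by rewrite /G/= subrr expr0n /= sub0r mulN1r.
  rewrite -IH addSn level_meanS; apply: eq_level_mean => i ni.
  have [h [e1 e2]] := children ni.
  have [f1 f2] := even_part_children e1 e2.
  rewrite /G addSn f1 f2 !iterSr doubleK half_double1; lra.
have := GE k; rewrite (_ : G k = fun j =>
   (even_part a (k + n) j - even_part a n (iter k half j)) ^+ 2
   + (-1) * even_part a (k + n) j ^+ 2); last by apply/funext => j; rewrite /G; lra.
by rewrite level_meanD level_meanZ; lra.
Qed.

(* Burkholder's function for the weak type inequality between a martingale and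
   its transforms. *)
Let U (x y : R) := if `|x| + `|y| <= 1 then y ^+ 2 - x ^+ 2 else 1 - 2 * `|x|.

Let U_le_lin (x y : R) : U x y <= 1 - 2 * `|x|.
Proof.
rewrite /U; case: ifP => // h; rewrite -(real_normK (num_real x)) -(real_normK (num_real y)).
by have := normr_ge0 x; have := normr_ge0 y; nra.
Qed.

Let U_ge (x y : R) : (1 <= `|y|)%R%:R - 2 * `|x| <= U x y.
Proof.
have := normr_ge0 x; have := normr_ge0 y.
rewrite /U; case: ifP => h; rewrite -?(real_normK (num_real x)) -?(real_normK (num_real y)).
  by case: (leP 1 `|y|) => hy /=; nra.
by case: (1 <= `|y|) => /=; lra.
Qed.

Let U_le0 (x : R) : U x x <= 0.
Proof. by rewrite /U; case: ifPn; rewrite ?subrr// -ltNge; lra. Qed.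

Let U_tangent (x y h k : R) : `|x| + `|y| <= 1 -> `|k| <= `|h| ->
  U (x + h) (y + k) <= y ^+ 2 - x ^+ 2 + 2 * y * k - 2 * x * h.
Proof.
move=> xy kh.
have [k2 kh1] : k ^+ 2 <= h ^+ 2 /\ `|k| <= `|h|.
  split => //; rewrite -(real_normK (num_real k)) -(real_normK (num_real h)).
  by rewrite lerXn2r ?nnegrE.
rewrite /U; case: ifPn => [_|]; first by lra.
rewrite -ltNge => out.
wlog X0 : x h xy kh k2 kh1 out / 0 <= x + h.
  move=> W; have [/W|X0] := leP 0 (x + h); first exact.
  have := W (- x) (- h); rewrite -opprD !normrN !sqrrN => /(_ xy kh k2 kh1 out).
  by rewrite oppr_ge0 => /(_ (ltW X0)); lra.
move: out; rewrite (ger0_norm X0) => out.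
have xs : `|y| <= 1 - x by have := ler_norm x; lra.
move: xs kh1; rewrite !ler_norml => /andP[y1 y2].
(* The claim now reads [s ^+ 2 - y ^+ 2 <= 2 * (s * h + y * k)], whose right-hand side is
   [(s + y) * (h + k) + (s - y) * (h - k)], with [|y| <= s] and [s < h + |y + k|]. *)
set s := 1 - x in y1 y2 *.
have [h0|h0] := leP 0 h.
  rewrite (ger0_norm h0) => /andP[k3 k4].
  have [Y0|Y0] := leP 0 (y + k).
    by move: out; rewrite (ger0_norm Y0) => out; rewrite /s in y1 y2; nra.
  by move: out; rewrite (ltr0_norm Y0) => out; rewrite /s in y1 y2; nra.
rewrite (ltr0_norm h0) => /andP[k3 k4].
have [Y0|Y0] := leP 0 (y + k).
  by move: out; rewrite (ger0_norm Y0) => out; rewrite /s in y1 y2; nra.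
by move: out; rewrite (ltr0_norm Y0) => out; rewrite /s in y1 y2; nra.
Qed.

(** Concavity along directions of slope at most 1. In the region where [U] is quadratic, average two
    tangent bounds, whose linear terms cancel; elsewhere [U x y] is [1 - 2 * |x|], which is concave
    and dominates [U]. *)
Let U_concave (x y h k : R) : `|k| <= `|h| -> (U (x + h) (y + k) + U (x - h) (y - k)) / 2 <= U x y.
Proof.
move=> kh; have [xy|xy] := leP (`|x| + `|y|) 1.
  have h1 := U_tangent xy kh.
  have h2 := @U_tangent x y (- h) (- k) xy; rewrite !normrN in h2; have {}h2 := h2 kh.
  have -> : U x y = y ^+ 2 - x ^+ 2 by rewrite /U xy.
  lra.
have h1 := U_le_lin (x + h) (y + k); have h2 := U_le_lin (x - h) (y - k).
have h3 := ler_normD (x + h) (x - h).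
have e : `|x + h + (x - h)| = 2 * `|x|.
  have -> : x + h + (x - h) = 2 * x by lra.
  by rewrite normrM ger0_norm.
have -> : U x y = 1 - 2 * `|x| by rewrite /U leNgt xy.
lra.
Qed.

(** A difference of [even_part a] is that of [a] or 0, so by [U_concave] the mean of [U] does not
    increase with the level. It starts at some [U x x <= 0], and [U_ge] bounds the indicator from
    above by [U + 2 * |x|]. *)
Lemma even_part_weak_type n (l : R) : 0 < l ->
  level_mean n (fun j => (l < `|even_part a n j|)%R%:R) <=
  2 / l * level_mean n (fun j => `|a n j|).
Proof.
move=> l0; pose V n j := U (a n j / l) (even_part a n j / l).
have V0 : level_mean n (V n) <= 0.
  elim: n => [|m IH]; first by rewrite level_mean0 /V /= U_le0.
  apply: le_trans IH; rewrite level_meanS; apply: le_level_mean => i ni.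
  have [h [e1 e2]] := children ni.
  have [f1 f2] := even_part_children e1 e2.
  rewrite /V f1 f2 e1 e2 !mulrBl ![(_ + _) / l]mulrDl; apply: U_concave.
  by case: ifP => _ //; rewrite mul0r normr0.
have l1 : `|l^-1| = l^-1 by rewrite ger0_norm// invr_ge0 ltW.
have : level_mean n (fun j => (l < `|even_part a n j|)%R%:R + - (2 / l) * `|a n j|) <= 0.
  apply: le_trans V0; apply: le_level_mean => j _.
  apply: le_trans (U_ge _ _); rewrite !normrM l1.
  have -> : - (2 / l) * `|a n j| = - (2 * (`|a n j| / l)) by lra.
  rewrite lerD2r; case: ltP => [/ltW h|_]; last by rewrite ler0n.
  by rewrite ler_pdivlMr// mul1r h.
by rewrite level_meanD level_meanZ; lra.
Qed.

End OneMartingale.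

(** At a retained level both products gain [h * k] in the mean, at the other levels neither does. *)
Lemma even_part_adjoint a b n : dyadic_martingale a -> dyadic_martingale b ->
  level_mean n (fun j => even_part a n j * b n j) =
  level_mean n (fun j => a n j * even_part b n j).
Proof.
move=> ma mb; pose G n j := even_part a n j * b n j - a n j * even_part b n j.
have G0 : level_mean n (G n) = 0.
  elim: n => [|n IH]; first by rewrite level_mean0 /G /= subrr.
  rewrite -IH level_meanS; apply: eq_level_mean => i ni.
  have [h [e1 e2]] := children ma ni; have [k [g1 g2]] := children mb ni.
  have [f1 f2] := even_part_children e1 e2; have [k1 k2] := even_part_children g1 g2.
  by rewrite /G f1 f2 k1 k2 e1 e2 g1 g2; case: ifP => _; lra.
move: G0; rewrite (_ : G n = fun j => even_part a n j * b n j
   + (-1) * (a n j * even_part b n j)); last by apply/funext => j; rewrite /G; lra.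
by rewrite level_meanD level_meanZ; lra.
Qed.

Lemma even_partD a b n j :
  even_part (fun n j => a n j + b n j) n j = even_part a n j + even_part b n j.
Proof. by elim: n j => [|n IH] j //=; rewrite IH; case: ifP => _; lra. Qed.

End DyadicMartingale.

(** * Dyadic intervals and step functions *)

Section DyadicIntervals.
Context (R : realType).
Local Notation leb := (@lebesgue_measure R).
Implicit Types (f : R -> R) (g : nat -> R) (t : R).

Definition dyi (n j : nat) : set R := `](j%:R / 2 ^+ n), (j.+1%:R / 2 ^+ n)[%classic.

Let pow_gt0 n : (0 : R) < 2 ^+ n. Proof. exact: exprn_gt0. Qed.

Lemma double_dyadic (n j : nat) : j.*2%:R / 2 ^+ n.+1 = j%:R / 2 ^+ n :> R.
Proof. by rewrite -mul2n natrM exprS invfM mulrACA mulfV ?mul1r// pnatr_eq0. Qed.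

Lemma dyiP n j t : dyi n j t <-> j%:R < 2 ^+ n * t < j.+1%:R.
Proof. by rewrite /dyi /= in_itv/= ltr_pdivrMr// ltr_pdivlMr// mulrC. Qed.

Lemma dyi_inj n j k t : dyi n j t -> dyi n k t -> j = k.
Proof.
move=> /dyiP/andP[j1 j2] /dyiP/andP[k1 k2]; apply/eqP; rewrite eqn_leq -[(j <= k)%N]ltnS -[(k <= j)%N]ltnS.
by rewrite -2!(ltr_nat R) (lt_trans j1 k2) (lt_trans k1 j2).
Qed.

Lemma dyi_half n j t : dyi n.+1 j t -> dyi n j./2 t.
Proof.
move=> /dyiP/andP[j1 j2]; apply/dyiP; rewrite exprS in j1 j2.
have h1 : (j./2.*2%:R : R) <= j%:R by rewrite ler_nat -[leqRHS](odd_double_half j) leq_addl.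
have h2 : (j.+1%:R : R) <= (j./2.+1).*2%:R.
  by rewrite ler_nat -{1}(odd_double_half j) doubleS; case: (odd j).
by rewrite -!mul2n !natrM in h1 h2; apply/andP; split; lra.
Qed.

Lemma measurable_dyi n j : measurable (dyi n j).
Proof. exact: measurable_itv. Qed.

Lemma dyi00 : dyi 0 0 = I01.
Proof. by rewrite /dyi expr0 !divr1. Qed.

Lemma dyi_sub n j : (j < 2 ^ n)%N -> dyi n j `<=` I01.
Proof.
move=> jn t /dyiP/andP[h1 h2]; rewrite /I01/= in_itv/=; have p := pow_gt0 n.
have j0 : (0 : R) <= j%:R by [].
have jn' : (j.+1%:R : R) <= 2 ^+ n by rewrite -natrX ler_nat.
by apply/andP; split; nra.
Qed.

Lemma leb_dyi n j : leb (dyi n j) = (2 ^- n)%:E.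
Proof.
rewrite /dyi leb_oo; last by rewrite ler_pM2r ?invr_gt0// ler_nat.
by rewrite -mulrBl -natrB// subSnn mul1r.
Qed.

Definition dyadic_points : set R := [set p.1%:R / 2 ^+ p.2 | p in [set: nat * nat]].

Lemma dyadic_points_null : leb.-negligible dyadic_points.
Proof.
have c : countable dyadic_points := sub_countable (card_image_le _ _) (countableP _).
have m : measurable dyadic_points by exact: countable_measurable.
by exists dyadic_points; split => //; exact: countable_lebesgue_measure0.
Qed.

Lemma off_dyadic t : I01 t -> ~ dyadic_points t ->
  forall n, exists2 j, (j < 2 ^ n)%N & dyi n j t.
Proof.
rewrite /I01/= in_itv/= => /andP[t0 t1] nt n; have p := pow_gt0 n.
have x0 : 0 <= 2 ^+ n * t by rewrite mulr_ge0 ?ltW.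
have /andP[h1 h2] := truncn_itv x0; set j := Num.trunc _ in h1 h2.
exists j; last first.
  apply/dyiP; rewrite h2 andbT lt_neqAle h1 andbT; apply/eqP => e; apply: nt.
  by exists (j, n) => //=; rewrite e mulrC mulKf// gt_eqF.
rewrite -(ltr_nat R) natrX; apply: (le_lt_trans h1).
by rewrite -[ltRHS]mulr1 ltr_pM2l.
Qed.

Lemma dyi_iter_half n k j t : dyi (k + n) j t -> dyi n (iter k half j) t.
Proof.
elim: k j => [//|k IH] j; rewrite addSn => /dyi_half/IH; by rewrite -iterSr.
Qed.

Lemma half_lt n j : (j < 2 ^ n.+1)%N -> (j./2 < 2 ^ n)%N.
Proof.
rewrite expnS mul2n => h; rewrite -ltn_double; apply: leq_ltn_trans h.
by rewrite -[leqRHS](odd_double_half j) leq_addl.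
Qed.

Let dyi_split n i : (i.*2%:R / 2 ^+ n.+1 : R) < i.*2.+1%:R / 2 ^+ n.+1 /\
  (i.*2.+1%:R / 2 ^+ n.+1 : R) < i.*2.+2%:R / 2 ^+ n.+1.
Proof. by rewrite !ltr_pM2r ?invr_gt0// !ltr_nat. Qed.

Let dyi_child n i : dyi n i = `](i.*2%:R / 2 ^+ n.+1), (i.*2.+2%:R / 2 ^+ n.+1)[%classic.
Proof. by rewrite /dyi -doubleS !double_dyadic. Qed.

Lemma integral_dyi_half (h : R -> \bar R) n i : measurable_fun (dyi n i) h ->
  (forall t, dyi n i t -> (0 <= h t)%E) ->
  (\int[leb]_(t in dyi n i) h t =
   \int[leb]_(t in dyi n.+1 i.*2) h t + \int[leb]_(t in dyi n.+1 i.*2.+1) h t)%E.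
Proof.
rewrite dyi_child => mh h0; have [h1 h2] := dyi_split n i.
by apply: integral_oo_split => //; exact: ltW.
Qed.

Lemma sum_integral_dyi (h : R -> \bar R) n : measurable_fun I01 h ->
  (forall t, I01 t -> (0 <= h t)%E) ->
  (\int[leb]_(t in I01) h t = \sum_(j < 2 ^ n) \int[leb]_(t in dyi n j) h t)%E.
Proof.
move=> mh h0; elim: n => [|n ->]; first by rewrite big_ord_recl big_ord0 adde0 dyi00.
have sd (m : nat) (F : nat -> \bar R) :
    (\sum_(j < m.*2) F j = \sum_(i < m) (F i.*2 + F i.*2.+1))%E.
  elim: m => [|m IH]; first by rewrite !big_ord0.
  by rewrite doubleS !big_ord_recr/= IH addeA.
rewrite expnS mul2n (sd _ (fun j => \int[leb]_(t in dyi n.+1 j) h t)%E).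
apply: eq_bigr => i _; apply: integral_dyi_half.
  by apply: measurable_funS mh; [exact: measurable_I01|exact: dyi_sub].
by move=> t /dyi_sub-/(_ (ltn_ord i)); exact: h0.
Qed.

Lemma Rintegral_dyi_half f n i : leb.-integrable (dyi n i) (EFin \o f) ->
  \int[leb]_(t in dyi n i) f t =
   \int[leb]_(t in dyi n.+1 i.*2) f t + \int[leb]_(t in dyi n.+1 i.*2.+1) f t.
Proof.
rewrite dyi_child /dyi; have [] := dyi_split n i.
set a := _.*2%:R / _; set b := _.+1%:R / _; set c := _.+2%:R / _ => ab bc fi.
have e : `]a, c[%classic = `]a, b[%classic `|` `[b, c[%classic.
  apply/seteqP; split => x /=; rewrite !in_itv/=.
    by move=> /andP[ax xc]; have [xb|bx] := ltP x b; [left; rewrite ax|right].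
  move=> [/andP[-> xb]|/andP[bx ->]]; first by rewrite (lt_trans xb).
  by rewrite (lt_le_trans ab).
rewrite [X in _ = _ + X]Rintegral_itv_obnd_cbnd; last first.
  apply: integrableS fi; [exact: measurable_itv|exact: measurable_itv|].
  by move=> x /=; rewrite !in_itv/= => /andP[bx ->]; rewrite (lt_trans ab bx).
rewrite [in LHS]e; apply: Rintegral_setU.
- exact: measurable_itv.
- exact: measurable_itv.
- by rewrite -e.
- apply/disj_setPS => x []; rewrite /= !in_itv/= => /andP[_ xb] /andP[bx _].
  by move: xb; rewrite ltNge bx.
Qed.

Definition dyadic_mean f (n j : nat) : R := 2 ^+ n * \int[leb]_(t in dyi n j) f t.

Lemma integrable_dyi f n j : L1 f -> (j < 2 ^ n)%N -> leb.-integrable (dyi n j) (EFin \o f).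
Proof.
move=> Lf jn; apply: integrableS Lf; [exact: measurable_I01|exact: measurable_dyi|].
exact: dyi_sub.
Qed.

Lemma dyadic_mean_martingale f : L1 f -> dyadic_martingale (dyadic_mean f).
Proof.
move=> Lf n i ni; rewrite /dyadic_mean (Rintegral_dyi_half (integrable_dyi Lf ni)) exprS.
lra.
Qed.

Definition step_fun n g t : R := \sum_(j < 2 ^ n) g j * \1_(dyi n j) t.

Lemma step_funE n g j t : (j < 2 ^ n)%N -> dyi n j t -> step_fun n g t = g j.
Proof.
move=> jn tj; rewrite /step_fun (bigD1 (Ordinal jn))//= indicE mem_set// mulr1.
rewrite big1 ?addr0// => k kj; rewrite indicE memNset ?mulr0// => tk.
by move/eqP: kj; apply; apply: val_inj; exact: dyi_inj tk tj.
Qed.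

Lemma step_fun_out n g t : (forall j, (j < 2 ^ n)%N -> ~ dyi n j t) -> step_fun n g t = 0.
Proof.
by move=> h; rewrite /step_fun big1// => k _; rewrite indicE memNset ?mulr0//; exact: h.
Qed.

Lemma measurable_step_fun n g (D : set R) : measurable_fun D (step_fun n g).
Proof.
apply: measurable_sum => j; apply: measurable_funM => //.
by apply: measurable_indic; exact: measurable_dyi.
Qed.

Lemma level_mean_integral n g (h : R -> R) : measurable_fun I01 h ->
  (forall t, I01 t -> 0 <= h t) ->
  (forall j t, (j < 2 ^ n)%N -> dyi n j t -> h t = g j) ->
  (\int[leb]_(t in I01) (h t)%:E = (level_mean n g)%:E)%E.
Proof.
move=> mh h0 hg; rewrite (sum_integral_dyi n); first last.
- by move=> t /h0; rewrite lee_fin.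
- exact/measurable_EFinP.
rewrite /level_mean mulr_sumr -sumEFin; apply: eq_bigr => j _.
transitivity (\int[leb]_(t in dyi n j) (g j)%:E)%E.
  by apply: eq_integral => t; rewrite inE => tj; rewrite (hg j).
rewrite integral_cst; last exact: measurable_dyi.
by rewrite [X in (_ * X)%E](leb_dyi n j) -EFinM mulrC.
Qed.

Lemma dyadic_mean_step n g j : (j < 2 ^ n)%N -> dyadic_mean (step_fun n g) n j = g j.
Proof.
move=> jn; rewrite /dyadic_mean (@eq_Rintegral _ _ _ _ _ (cst (g j))); last first.
  by move=> t; rewrite inE => tj; rewrite (step_funE g jn tj).
rewrite Rintegral_cst; last exact: measurable_dyi.
by rewrite [X in fine X](leb_dyi n j)/= mulrCA mulfV ?mulr1// gt_eqF.
Qed.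

Lemma step_fun_bounded n g t : `|step_fun n g t| <= \sum_(j < 2 ^ n) `|g j|.
Proof.
apply: le_trans (ler_norm_sum _ _ _) _; apply: ler_sum => j _.
rewrite normrM ler_piMr// indicE; case: (_ \in _); rewrite ?normr1// normr0 ler01//.
Qed.

Lemma bounded_L1 (h : R -> R) (M : R) : measurable_fun I01 h ->
  (forall t, I01 t -> `|h t| <= M) -> L1 h.
Proof.
move=> mh hM; apply: measurable_bounded_integrable => //.
- exact: measurable_I01.
- by rewrite [X in (X < _)%E]leb_I01 ltry.
- exists M; split; first exact: num_real.
  by move=> x Mx t /= It; apply: le_trans (hM t It) _; exact: ltW.
Qed.

Lemma L1_step n g : L1 (step_fun n g).
Proof.
apply: bounded_L1; first exact: measurable_step_fun.
by move=> t _; exact: step_fun_bounded.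
Qed.

Lemma sum_Rintegral_dyi f n : L1 f ->
  \int[leb]_(t in I01) f t = \sum_(j < 2 ^ n) \int[leb]_(t in dyi n j) f t.
Proof.
move=> Lf; elim: n => [|n ->]; first by rewrite big_ord_recl big_ord0 addr0 dyi00.
rewrite expnS mul2n (@sum_double R _ (fun j => \int[leb]_(t in dyi n.+1 j) f t)).
by apply: eq_bigr => i _; apply: Rintegral_dyi_half; exact: integrable_dyi.
Qed.

Lemma step_pairing f n g : L1 f -> L1 (fun t => f t * step_fun n g t) ->
  \int[leb]_(t in I01) (f t * step_fun n g t) = level_mean n (fun j => dyadic_mean f n j * g j).
Proof.
move=> Lf Lfg; rewrite (sum_Rintegral_dyi n Lfg) /level_mean mulr_sumr.
apply: eq_bigr => j _; transitivity (\int[leb]_(t in dyi n j) (f t * g j)).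
  by apply: eq_Rintegral => t; rewrite inE => tj; rewrite (step_funE g (ltn_ord j) tj).
rewrite RintegralZr; [|exact: measurable_dyi|exact: integrable_dyi].
by rewrite /dyadic_mean !mulrA mulVf ?mul1r// gt_eqF.
Qed.

Lemma dyadic_mean_abs f n : L1 f ->
  ((level_mean n (fun j => `|dyadic_mean f n j|))%:E <= \int[leb]_(t in I01) `|f t|%:E)%E.
Proof.
move=> Lf; have mf : measurable_fun I01 f by apply/measurable_EFinP; exact: measurable_int Lf.
rewrite (sum_integral_dyi n); first last.
- by move=> t _; rewrite lee_fin.
- by apply/measurable_EFinP; exact: measurableT_comp.
rewrite /level_mean mulr_sumr -sumEFin; apply: lee_sum => j _.
have If := integrable_dyi Lf (ltn_ord j).
rewrite /dyadic_mean normrM ger0_norm ?exprn_ge0// mulrA mulVf ?gt_eqF// mul1r.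
have fin : (\int[leb]_(t in dyi n j) (f t)%:E)%E \is a fin_num.
  by apply: integrable_fin_num; [exact: measurable_dyi|exact: If].
rewrite -abse_EFin [X in `|X|%E](fineK fin).
by apply: le_abse_integral; [exact: measurable_dyi|exact: measurable_int If].
Qed.

Lemma distr_step n g (l : R) : 0 <= l ->
  distr (step_fun n g) l = level_mean n (fun j => (l < `|g j|)%R%:R).
Proof.
move=> l0; apply: EFin_inj; rewrite -distrE; last exact: measurable_step_fun.
have mS : measurable [set t | I01 t /\ l < `|step_fun n g t|].
  by apply: measurable_superlevel; exact: measurable_step_fun.
rewrite -(@level_mean_integral n _ (fun t => \1_[set t | I01 t /\ l < `|step_fun n g t|] t)).
- rewrite integral_indic//; last exact: measurable_I01.
  by congr (leb _); apply/esym/setIidPl => t [].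
- exact: measurable_indic.
- by move=> t _; rewrite indicE ler0n.
- move=> j t jn tj; rewrite indicE -(step_funE g jn tj); congr ((_ : bool)%:R).
  apply/idP/idP; first by rewrite inE => -[].
  by move=> h'; rewrite inE; split => //; exact: dyi_sub tj.
Qed.

Lemma distr_ae x y (mx : measurable_fun I01 x) (my : measurable_fun I01 y) n :
  (forall j t, (j < 2 ^ n)%N -> dyi n j t -> x t = y t) -> forall l, distr x l = distr y l.
Proof.
move=> xy l; have ae u v : (forall j t, (j < 2 ^ n)%N -> dyi n j t -> u t = v t) ->
    {ae leb, forall t, I01 t -> `|v t| <= `|u t|}.
  move=> uv; apply: negligibleS dyadic_points_null => t /= h.
  apply: contrapT => nt; apply: h => It.
  by have [j jn tj] := off_dyadic It nt n; rewrite (uv _ _ jn tj).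
apply/eqP; rewrite eq_le; apply/andP; split; apply: distr_le => //; apply: ae => // j t jn tj.
by rewrite (xy _ _ jn tj).
Qed.

End DyadicIntervals.

(** * The martingale transform *)

Section ConditionalExpectation.
Context (R : realType).
Local Notation leb := (@lebesgue_measure R).
Implicit Types (f e : R -> R) (n j : nat) (A : set R).

(** The sets with these three properties form a sigma-algebra on (0,1) containing the generators. *)
Lemma dyadic_algebra_atom n A : dyadic_algebra n A ->
  [/\ A `<=` I01, measurable A &
    forall j, (j < 2 ^ n)%N -> dyi n j `<=` A \/ dyi n j `<=` ~` A].
Proof.
move=> hA; apply: (hA [set A | [/\ A `<=` I01, measurable A &
    forall j, (j < 2 ^ n)%N -> dyi n j `<=` A \/ dyi n j `<=` ~` A]]).
split; first split.
- by split => [//||j _]; [exact: measurable0|right=> t _ []].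
- move=> B [BI mB hB]; split => [t []//| |j jn].
    by apply: measurableD => //; exact: measurable_I01.
  have [jB|jB] := hB _ jn; [right=> t /jB Bt []//|left=> t tj].
  by split; [exact: dyi_sub tj|exact: jB].
- move=> B hB; split => [t [k _]|| j jn]; first by have [+ _ _] := hB k; apply.
    by apply: bigcup_measurable => k _; have [_ + _] := hB k.
  have [[k jB]|h] := pselect (exists k, dyi n j `<=` B k).
    by left => t /jB Bt; exists k.
  right => t tj [k _ Bt]; apply: h; exists k.
  have [_ _ /(_ _ jn)[//|jB]] := hB k; by have := jB _ tj.
move=> _ [j /= jn <-]; split; [exact: dyi_sub|exact: measurable_dyi|].
move=> k kn; have [->|kj] := eqVneq k j; first by left.
by right=> t tk tj; move/eqP: kj; apply; exact: dyi_inj tk tj.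
Qed.

Lemma dyadic_algebra_dyi n j : (j < 2 ^ n)%N -> dyadic_algebra n (dyi n j : set R).
Proof. by move=> jn; apply: sub_sigma_algebra; exists j. Qed.

Lemma dyadic_algebra_union n (P : nat -> Prop) :
  dyadic_algebra n (\bigcup_(j in [set j | (j < 2 ^ n)%N /\ P j]) (dyi n j : set R)).
Proof.
rewrite bigcup_mkcond; apply: sigma_algebra_bigcup => j; case: ifPn => [|_].
  by rewrite inE => -[jn _]; exact: dyadic_algebra_dyi.
exact: sigma_algebra0.
Qed.

(** Outside the intervals of level [n] the step function takes the default value 0, so these points
    belong to the preimage all together or not at all. According to [B 0], the preimage is a union
    of intervals or the complement of one. *)
Lemma dyadic_algebra_step n (g : nat -> R) (B : set R) :
  dyadic_algebra n (I01 `&` step_fun n g @^-1` B).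
Proof.
pose U := \bigcup_(j in [set j | (j < 2 ^ n)%N /\ B (g j)]) (dyi n j : set R).
pose V := \bigcup_(j in [set j | (j < 2 ^ n)%N /\ True]) (dyi n j : set R).
have out t : ~ V t -> step_fun n g t = 0.
  by move=> Vt; apply: step_fun_out => j jn tj; apply: Vt; exists j.
have [B0|B0] := pselect (B 0); last first.
  rewrite [X in dyadic_algebra n X](_ : _ = U); first exact: dyadic_algebra_union.
  apply/seteqP; split => [t [It /= Bt]|t [j [jn Bj] tj]]; last first.
    by split; [exact: dyi_sub tj|rewrite /= (step_funE g jn tj)].
  have [[j [jn _] tj]|/out t0] := pselect (V t); last by rewrite t0 in Bt.
  by exists j => //; split => //; rewrite -(step_funE g jn tj).
pose W := \bigcup_(j in [set j | (j < 2 ^ n)%N /\ ~ B (g j)]) (dyi n j : set R).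
rewrite [X in dyadic_algebra n X](_ : _ = I01 `\` W).
  by apply: sigma_algebraCD; exact: dyadic_algebra_union.
apply/seteqP; split => [t [It /= Bt]|t [It Wt]]; split => //.
  by move=> [j [jn nB] tj]; apply: nB; rewrite -(step_funE g jn tj).
rewrite /=; have [[j [jn _] tj]|/out ->//] := pselect (V t).
by apply: contrapT => nB; apply: Wt; exists j => //; rewrite (step_funE g jn tj) in nB.
Qed.

Lemma integral_dyadic_algebra h n A : L1 h -> dyadic_algebra n A ->
  (\int[leb]_(t in A) (h t)%:E =
   (\sum_(j < 2 ^ n) (if `[< dyi n j `<=` A >] then \int[leb]_(t in dyi n j) h t else 0)%R)%:E)%E.
Proof.
move=> Lh /dyadic_algebra_atom[AI mA Aj].
have mI := @measurable_I01 R.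
pose u t := h t * \1_A t.
have Lu : L1 u.
  rewrite /L1/=; apply: (@le_integrable _ _ R leb I01 mI _ (EFin \o h)) => //.
    apply/measurable_EFinP; apply: measurable_funM.
      by apply/measurable_EFinP; exact: measurable_int Lh.
    exact: measurable_indic.
  move=> t _ /=; rewrite lee_fin /u indicE normrM ler_piMr//.
  by case: (_ \in _); rewrite ?normr1 ?normr0.
transitivity (\int[leb]_(t in I01) (u t)%:E)%E.
  rewrite -[in LHS](setIidr AI) integral_mkcondr; apply: eq_integral => t _.
  by rewrite patchE /u indicE; case: (_ \in _); rewrite ?mulr1 ?mulr0.
have fin : (\int[leb]_(t in I01) (u t)%:E)%E \is a fin_num.
  by apply: integrable_fin_num; [exact: mI|exact: Lu].
rewrite -(fineK fin); congr EFin; rewrite -/(Rintegral leb I01 u) (sum_Rintegral_dyi n Lu).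
apply: eq_bigr => j _; case: asboolP => [jA|njA].
  apply: eq_Rintegral => t; rewrite inE => /jA At.
  by rewrite /u indicE mem_set// mulr1.
have [//|jA] := Aj _ (ltn_ord j).
transitivity (\int[leb]_(t in dyi n j) (cst 0 t : R)); last first.
  by rewrite Rintegral_cst ?mul0r//; exact: measurable_dyi.
by apply: eq_Rintegral => t; rewrite inE => /jA At; rewrite /u indicE memNset// mulr0.
Qed.

Lemma cond_exp_step f n : L1 f ->
  is_cond_exp (dyadic_algebra n) f (step_fun n (dyadic_mean f n)).
Proof.
move=> Lf; split; [exact: L1_step|by move=> B _; exact: dyadic_algebra_step|].
move=> A hA; rewrite (integral_dyadic_algebra (L1_step _ _) hA) (integral_dyadic_algebra Lf hA).
congr EFin; apply: eq_bigr => j _; case: ifP => // _.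
have := dyadic_mean_step (dyadic_mean f n) (ltn_ord j); rewrite {1 3}/dyadic_mean.
by apply: mulfI; rewrite gt_eqF// exprn_gt0.
Qed.

(** The set where [e] takes the value [e t] lies in the algebra and meets the interval, hence
    contains it. So the formula holds at every point of the interval, not only almost everywhere. *)
Lemma cond_exp_dyi f n e j t : L1 f -> is_cond_exp (dyadic_algebra n) f e ->
  (j < 2 ^ n)%N -> dyi n j t -> e t = dyadic_mean f n j.
Proof.
move=> Lf [Le me ie] jn tj.
have /dyadic_algebra_atom[_ _ /(_ _ jn)[h|h]] := me [set e t] (measurable_set1 _); last first.
  by have := h _ tj; case; split => //; exact: dyi_sub tj.
have := ie _ (dyadic_algebra_dyi jn).
rewrite (_ : \int[leb]_(t in dyi n j) (e t)%:E = \int[leb]_(s in dyi n j) (e t)%:E)%E; last first.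
  by apply: eq_integral => s; rewrite inE => /h[_ /= ->].
rewrite integral_cst; last exact: measurable_dyi.
rewrite [X in (_ * X)%E](leb_dyi R n j) -EFinM => /(congr1 (@fine R))/= eq.
rewrite /dyadic_mean /Rintegral -eq mulrC mulfVK// gt_eqF// exprn_gt0//.
Qed.

Lemma transform_partial_sum f (e : nat -> R -> R) m j t : L1 f ->
  (forall n, is_cond_exp (dyadic_algebra n) f (e n)) ->
  (j < 2 ^ m.*2)%N -> dyi m.*2 j t ->
  \sum_(i < m.+1) (e i.*2 t - (if i == 0%N :> nat then 0 else e i.*2.-1 t)) =
  even_part (dyadic_mean f) m.*2 j.
Proof.
move=> Lf he; elim: m j => [|m IH] j jn tj.
  by rewrite big_ord_recl big_ord0 addr0 subr0 (cond_exp_dyi Lf (he _) jn tj).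
rewrite big_ord_recr/=; have jn1 := half_lt jn; have tj1 := dyi_half tj.
have jn2 := half_lt jn1; have tj2 := dyi_half tj1.
rewrite (IH _ jn2 tj2) odd_double/= addr0.
by rewrite (cond_exp_dyi Lf (he _) jn tj) (cond_exp_dyi Lf (he _) jn1 tj1).
Qed.

End ConditionalExpectation.

(** * Rearrangement estimate for the partial transforms *)

Section TransformEstimate.
Context (R : realType).
Local Notation leb := (@lebesgue_measure R).
Implicit Types (f g w : R -> R) (n j : nat) (t l : R).

Lemma L1_measurable f : L1 f -> measurable_fun I01 f.
Proof. by move=> Lf; apply/measurable_EFinP; exact: measurable_int Lf. Qed.

Lemma eq_even_part (a b : nat -> nat -> R) n j :
  (forall m i, (i < 2 ^ m)%N -> a m i = b m i) -> (j < 2 ^ n)%N ->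
  even_part a n j = even_part b n j.
Proof.
move=> ab; elim: n j => [|n IH] j jn /=; first exact: ab.
by rewrite (IH _ (half_lt jn)) (ab _ _ jn) (ab _ _ (half_lt jn)).
Qed.

Lemma dyadic_meanD f g n j : L1 f -> L1 g -> (j < 2 ^ n)%N ->
  dyadic_mean (f \+ g) n j = dyadic_mean f n j + dyadic_mean g n j.
Proof.
move=> Lf Lg jn; rewrite /dyadic_mean -mulrDr; congr (_ * _).
by apply: RintegralD; [exact: measurable_dyi|exact: integrable_dyi|exact: integrable_dyi].
Qed.

Definition dyadic_transform f n := step_fun n (even_part (dyadic_mean f) n).

Lemma dyadic_transformD f g n t : L1 f -> L1 g ->
  dyadic_transform (f \+ g) n t = dyadic_transform f n t + dyadic_transform g n t.
Proof.
move=> Lf Lg; rewrite /dyadic_transform /step_fun -big_split; apply: eq_bigr => j _ /=.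
rewrite -mulrDl -even_partD; congr (_ * _); apply: eq_even_part (ltn_ord j).
by move=> m i im; exact: dyadic_meanD.
Qed.

Lemma dyadic_transform_weak_type f n l : L1 f -> 0 < l ->
  ((l * distr (dyadic_transform f n) l)%:E <= 2%:E * \int[leb]_(t in I01) `|f t|%:E)%E.
Proof.
move=> Lf l0; apply: (@le_trans _ _ (2 * level_mean n (fun j => `|dyadic_mean f n j|))%:E).
  rewrite lee_fin distr_step ?(ltW l0)//.
  have := even_part_weak_type (dyadic_mean_martingale Lf) n l0.
  by rewrite mulrAC ler_pdivlMr// mulrC.
rewrite EFinM; apply: lee_wpmul2l; first by rewrite lee_fin.
exact: dyadic_mean_abs.
Qed.

Lemma integral_distr f : measurable_fun I01 f ->
  (\int[leb]_(t in I01) `|f t|%:E = \int[leb]_(l in `]0%R, +oo[) (distr f l)%:E)%E.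
Proof.
move=> mf; rewrite (layer_cake1 leb (@measurable_I01 R)); first last.
- by move=> s _; rewrite lee_fin.
- by apply/measurable_EFinP; exact: measurableT_comp.
by apply: eq_integral => l _; rewrite -distrE.
Qed.

Lemma distr_sub f g l m : measurable_fun I01 f -> measurable_fun I01 g ->
  (forall t, I01 t -> l < `|f t| -> m < `|g t|) -> distr f l <= distr g m.
Proof.
move=> mf mg h; rewrite -lee_fin -!distrE//; apply: le_measure.
- by rewrite inE; exact: measurable_superlevel.
- by rewrite inE; exact: measurable_superlevel.
- by move=> t [It lt]; split => //; exact: h.
Qed.

Definition clip (A x : R) : R := Num.max (- A) (Num.min A x).

Lemma clipP A x : 0 <= A -> [/\ `|clip A x| <= A, `|clip A x| <= `|x| &
  forall l, 0 <= l -> l < `|x - clip A x| -> l + A < `|x|].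
Proof.
move=> A0; rewrite /clip; have [Ax|xA] := ltP A x.
  rewrite max_r; last by lra.
  rewrite !ger0_norm; [|lra..]; split; [lra|lra|move=> l _; lra].
have [Ax|xA'] := leP (- A) x.
  rewrite subrr normr0; split; [by rewrite ler_norml Ax|by []|].
  by move=> l l0 /(le_lt_trans l0); rewrite ltxx.
by rewrite normrN (ger0_norm A0) !ltr0_norm; [split; [lra|lra|move=> l _; lra]|lra..].
Qed.

Lemma measurable_clip A f : measurable_fun I01 f -> measurable_fun I01 (fun t => clip A (f t)).
Proof.
by move=> mf; apply: measurable_maxr => //; apply: measurable_minr.
Qed.

Lemma L1_clip A f : 0 <= A -> L1 f ->
  L1 (fun t => clip A (f t)) /\ L1 (fun t => f t - clip A (f t)).
Proof.
move=> A0 Lf; have mf := L1_measurable Lf.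
have Lc : L1 (fun t => clip A (f t)).
  apply: (@bounded_L1 _ _ A); first exact: measurable_clip.
  by move=> t _; have [] := clipP (f t) A0.
split=> //; rewrite /L1/=.
have -> : EFin \o (fun t => f t - clip A (f t)) =
  (fun t => (EFin \o f) t - (EFin \o fun t => clip A (f t)) t)%E by [].
by apply: integrableB; [exact: measurable_I01|exact: Lf|exact: Lc].
Qed.

(* Split [min(|w|,1)] at the height [t / (2 v)]: below it use the measure of
   [E], above it the weak type bound. *)
Lemma integral_capped w (E : set R) b v t : measurable_fun I01 w ->
  measurable E -> E `<=` I01 -> (leb E <= v%:E)%E -> 0 < t -> t < v -> t < 2 * b ->
  (forall l, 0 < l -> l * distr w l <= 2 * b) ->
  (\int[leb]_(s in I01) (w s ^+ 2)%:E <= b%:E)%E ->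
  (\int[leb]_(s in E) `|w s|%:E <= (4 * b * (1 + ln (v / t)))%:E)%E.
Proof.
move=> mw mE EI Ev t0 tv tb wt wb.
have v0 := lt_trans t0 tv; have b0 : 0 < b by lra.
have mwE : measurable_fun E w by exact: measurable_funS (@measurable_I01 R) EI mw.
pose s := t / (2 * v); have s0 : 0 < s by rewrite divr_gt0// mulr_gt0.
have s1 : s < 1 by rewrite ltr_pdivrMr ?mulr_gt0//; lra.
pose m r := Num.min `|w r| 1.
have mm : measurable_fun E (fun r => (m r)%:E).
  by apply/measurable_EFinP; apply: measurable_minr => //; exact: measurableT_comp.
have m0 r : (0 <= (m r)%:E)%E by rewrite lee_fin le_min normr_ge0 ler01.
have mw2 (D : set R) : measurable_fun D w -> measurable_fun D (fun r => (w r ^+ 2)%:E).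
  by move=> h; apply/measurable_EFinP; exact: measurable_funX.
have w20 r : (0 <= (w r ^+ 2)%:E)%E by rewrite lee_fin sqr_ge0.
(* Use [|w| <= min(|w|, 1) + w ^+ 2]: values above 1 are paid for by the L2 bound. *)
apply: (@le_trans _ _ (\int[leb]_(r in E) ((m r)%:E + (w r ^+ 2)%:E))%E).
  apply: ge0_le_integral => //.
  - by apply/measurable_EFinP; exact: measurableT_comp.
  - by apply: emeasurable_funD => //; exact: mw2.
  - move=> r _; rewrite -EFinD lee_fin /m -real_normK ?num_real//.
    by have n0 := normr_ge0 (w r); case: (leP `|w r| 1) => h; nra.
rewrite (ge0_integralD leb mE)//; last exact: mw2.
have le_w2 : (\int[leb]_(r in E) (w r ^+ 2)%:E <= b%:E)%E.
  apply: le_trans wb; apply: ge0_subset_integral => //; first exact: measurable_I01.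
  exact: mw2.
have le_m : (\int[leb]_(r in E) (m r)%:E <= (t / 2 + 2 * b * (- ln s))%:E)%E.
  rewrite (layer_cake1 leb mE)//.
  (* [G] bounds the measure of the part of [E] where [m > l]: by [v] up to [s], by the weak type
     estimate from [s] to 1, and by 0 beyond. *)
  pose G (l : R) : \bar R := (((fun=> v%:E) \_ `]0%R, s]) l + ((fun l => (2 * b / l)%:E) \_ `]s, 1%R[) l)%E.
  have m2 : measurable_fun (`]s, 1[ : set R) (fun l : R => (2 * b / l)%:E).
    apply/measurable_EFinP; apply: measurable_funM => //.
    by apply: measurable_funS (@measurable_invr R).
  have G1 : measurable_fun (`]0, +oo[ : set R) ((fun=> v%:E) \_ `]0, s] : R -> \bar R).
    by apply: measurable_funTS; apply/(measurable_restrictT _ (measurable_itv _)).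
  have G2 : measurable_fun (`]0, +oo[ : set R) ((fun l => (2 * b / l)%:E) \_ `]s, 1[ : R -> \bar R).
    by apply: measurable_funTS; apply/(measurable_restrictT _ (measurable_itv _)).
  have g1 l : (0 <= ((fun=> v%:E) \_ `]0%R, s]) l)%E.
    by rewrite patchE; case: ifP => // _; rewrite lee_fin ltW.
  have g2 l : (0 <= ((fun l => (2 * b / l)%:E) \_ `]s, 1%R[) l)%E.
    rewrite patchE; case: ifPn => //; rewrite inE/= in_itv/= => /andP[sl _].
    by rewrite lee_fin divr_ge0//; lra.
  apply: (@le_trans _ _ (\int[leb]_(l in `]0%R, +oo[) G l)%E).
    apply: ge0_le_integral => //.
    + apply: antitone_emeasurable => // l l' _ _ ll'; apply: le_measure.
      * by rewrite inE; apply: emeasurable_fun_o_infty.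
      * by rewrite inE; apply: emeasurable_fun_o_infty.
      * by move=> r [Er] /= h; split => //=; apply: le_lt_trans h; rewrite lee_fin.
    + exact: emeasurable_funD.
    + move=> l /=; rewrite in_itv/= andbT => l0.
      have [ls|sl] := leP l s.
        apply: (@le_trans _ _ v%:E).
          apply: le_trans Ev; apply: le_measure; rewrite ?inE//.
          by apply: emeasurable_fun_o_infty.
        rewrite /G patchE mem_set; last by rewrite /= in_itv/= l0.
        by rewrite leeDl.
      have [l1|l1] := ltP l 1.
        apply: (@le_trans _ _ (2 * b / l)%:E); last first.
          rewrite /G [X in (_ + X)%E]patchE [X in (_ + if X then _ else _)%E]mem_set.
            by rewrite leeDr.
          by rewrite /= in_itv/= sl.
        apply: (@le_trans _ _ (distr w l)%:E).
          rewrite -distrE//; apply: le_measure.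
          * by rewrite inE; apply: emeasurable_fun_o_infty.
          * by rewrite inE; exact: measurable_superlevel.
          * move=> r [Er /=]; rewrite lte_fin /m lt_min => /andP[h _].
            by split => //; exact: EI.
        by rewrite lee_fin ler_pdivlMr// mulrC wt.
      rewrite [X in leb X](_ : _ = set0) ?measure0 ?adde_ge0//.
      apply/seteqP; split => r // [_] /=; rewrite lte_fin lt_min => /andP[_ h].
      by move: h; rewrite ltNge l1.
  rewrite (ge0_integralD leb)// -!integral_mkcondr.
  rewrite (_ : `]0, +oo[ `&` `]0, s] = `]0, s])%classic; last first.
    by apply/setIidPr => l /=; rewrite !in_itv/= => /andP[->].
  rewrite (_ : `]0, +oo[ `&` `]s, 1[ = `]s, 1[)%classic; last first.
    by apply/setIidPr => l /=; rewrite !in_itv/= => /andP[/(lt_trans s0)->].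
  rewrite integral_cst; last exact: measurable_itv.
  have ls : leb `]0%R, s]%classic = s%:E by rewrite lebesgue_measure_itv/= lte_fin s0 sube0.
  rewrite [X in (_ * X + _)%E]ls -EFinM.
  under eq_integral do rewrite EFinM.
  rewrite (ge0_integralZl leb (measurable_itv _))//; first last.
  - by rewrite lee_fin mulr_ge0// ltW.
  - by move=> l /=; rewrite in_itv/= => /andP[sl _]; rewrite lee_fin invr_ge0 ltW// (lt_trans s0).
  - by apply/measurable_EFinP; apply: measurable_funS (@measurable_invr R).
  rewrite [X in (_ * X)%E](integral_inv s0 (ltW s1)) ln1 sub0r -EFinM -EFinD lee_fin lerD2r.
  have vv : v * v^-1 = 1 by rewrite mulfV// gt_eqF.
  by rewrite /s invfM; have := congr1 (fun z => z * t) vv; lra.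
(* The total is [t / 2 + 2 * b * (ln 2 + ln (v / t)) + b], and both [t / 2 <= b] and [ln 2 <= 1]
   hold. *)
apply: (le_trans (leeD le_m le_w2)); rewrite -EFinD lee_fin.
have -> : - ln s = ln 2 + ln (v / t).
  rewrite -lnV ?posrE// /s invf_div -mulrA lnM ?posrE//; exact: divr_gt0.
have l2 : ln 2 <= 1 :> R by have := @le_ln1Dx R 1; rewrite (_ : 1 + 1 = 2)//; apply; lra.
have l3 : 0 <= ln (v / t) by apply: ln_ge0; rewrite ler_pdivlMr// mul1r ltW.
nra.
Qed.

End TransformEstimate.

Section TransformRearrangement.
Context (R : realType).
Local Notation leb := (@lebesgue_measure R).
Variables (f : R -> R) (Lf : L1 f) (t Q : R) (t0 : 0 < t) (t1 : t < 1).
Hypothesis cQ : (calderon (drearr f) t < Q%:E)%E.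
Implicit Types (n j : nat) (l : R).

Let mf : measurable_fun I01 f := L1_measurable Lf.
Let kernel l := calderon_kernel (distr f l) t.
Let A := fine (drearr f t).

Let kernel_ge0 l : 0 <= kernel l.
Proof. by apply: calderon_kernel_ge0 => //; exact: distr_ge0. Qed.

Let mkernel : measurable_fun (`]0, +oo[ : set R) (fun l => (kernel l)%:E).
Proof.
apply: antitone_emeasurable => // a b _ _ ab; rewrite lee_fin.
by apply: calderon_kernel_mono => //; exact: distr_anti.
Qed.

Let int_kernel : (\int[leb]_(l in `]0%R, +oo[) (kernel l)%:E < Q%:E)%E.
Proof. by rewrite -calderonE. Qed.

Let Q0 : 0 < Q.
Proof.
rewrite -lte_fin; apply: le_lt_trans int_kernel; apply: integral_ge0 => l _.
by rewrite lee_fin.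
Qed.

Let AE : drearr f t = A%:E. Proof. by rewrite fineK// drearr_fin. Qed.

Let A0 : 0 <= A. Proof. by rewrite -lee_fin -AE drearr_ge0. Qed.

Let distr_above l : A <= l -> distr f l <= t.
Proof.
move=> Al; rewrite leNgt -(drearr_gtE mf t (le_trans A0 Al)) AE lte_fin.
by rewrite -leNgt.
Qed.

Let distr_below l : 0 <= l -> l < A -> t < distr f l.
Proof. by move=> l0 lA; rewrite -(drearr_gtE mf t l0) AE lte_fin. Qed.

Let f1 s := f s - clip A (f s).
Let f2 s := clip A (f s).
Let Lf1 : L1 f1. Proof. by have [] := L1_clip A0 Lf. Qed.
Let Lf2 : L1 f2. Proof. by have [] := L1_clip A0 Lf. Qed.

Let mT n (h : R -> R) : measurable_fun I01 (dyadic_transform h n).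
Proof. exact: measurable_step_fun. Qed.

(** Above the truncation height the distribution function is at most [t], where the kernel equals
    [distr / t]. So the integral of [distr f1] is at most [t] times the integral of the kernel. *)
Lemma upper_part_integral : (\int[leb]_(s in I01) `|f1 s|%:E <= (t * Q)%:E)%E.
Proof.
rewrite (integral_distr (L1_measurable Lf1)).
apply: (@le_trans _ _ (\int[leb]_(l in `]0%R, +oo[) (t%:E * (kernel l)%:E))%E); last first.
  rewrite (ge0_integralZl leb (measurable_itv _) mkernel); first last.
  - by rewrite lee_fin ltW.
  - by move=> l _; rewrite lee_fin.
  by rewrite EFinM; apply: lee_wpmul2l; rewrite ?lee_fin; exact: ltW.
apply: ge0_le_integral => //.
- by move=> l _; rewrite lee_fin distr_ge0.
- apply: antitone_emeasurable => // a b _ _ ab; rewrite lee_fin.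
  by apply: distr_anti ab; exact: (L1_measurable Lf1).
- exact: measurable_funeM.
move=> l /=; rewrite in_itv/= andbT => l0; rewrite -EFinM lee_fin.
have h1 : distr f1 l <= distr f (l + A).
  apply: distr_sub => //; first exact: (L1_measurable Lf1).
  by move=> s _; have [_ _ h] := clipP (f s) A0; exact: h (ltW l0).
have h2 : distr f (l + A) <= t by apply: distr_above; rewrite lerDr ltW.
apply: (le_trans h1); rewrite mulrC -ler_pdivrMr//.
apply: (@le_trans _ _ (calderon_kernel (distr f (l + A)) t)).
  by rewrite /calderon_kernel min_r// max_r// mulfV ?gt_eqF// ln1 addr0.
by apply: calderon_kernel_mono => //; apply: distr_anti => //; rewrite lerDl.
Qed.

(** At a height [l < A] one has [t < distr f l], and [integral_capped] with [v = distr f l] gives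
    exactly [4 * b] times the kernel; integrate over the heights. The inequality is strict because
    [cQ] is. *)
Lemma lower_pairing (w : R -> R) (b : R) : measurable_fun I01 w -> t < 2 * b ->
  (forall l, 0 < l -> l * distr w l <= 2 * b) ->
  (\int[leb]_(s in I01) (w s ^+ 2)%:E <= b%:E)%E ->
  (\int[leb]_(s in I01) `|f2 s * w s|%:E < (4 * b * Q)%:E)%E.
Proof.
move=> mw tb wt wb; have b0 : 0 < b by have := t0; lra.
have mf2 := L1_measurable Lf2; have mI := @measurable_I01 R.
have maf2 : measurable_fun I01 (fun s => `|f2 s|%:E).
  by apply/measurable_EFinP; exact: measurableT_comp.
have maw : measurable_fun I01 (fun s => `|w s|%:E).
  by apply/measurable_EFinP; exact: measurableT_comp.
have mE l : measurable (I01 `&` [set s | l%:E < `|f2 s|%:E]%E) by exact: emeasurable_fun_o_infty.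
under eq_integral do rewrite normrM EFinM.
rewrite (layer_cake leb mI maf2 maw); first last.
- by move=> s _; rewrite lee_fin.
- by move=> s _; rewrite lee_fin.
apply: (@le_lt_trans _ _ (\int[leb]_(l in `]0%R, +oo[) ((4 * b)%:E * (kernel l)%:E))%E); last first.
  rewrite (ge0_integralZl leb (measurable_itv _) mkernel); first last.
  - by rewrite lee_fin; lra.
  - by move=> l _; rewrite lee_fin.
  by rewrite (EFinM (4 * b)) lte_pmul2l// lte_fin; lra.
apply: ge0_le_integral => //.
- by move=> l _; apply: integral_ge0 => s _; rewrite lee_fin.
- apply: antitone_emeasurable => // l l' _ _ ll'; apply: ge0_subset_integral => //.
  + exact: mE.
  + exact: mE.
  + by apply: measurable_funS maw => // s [].
  + by move=> s [Is] /= h; split => //=; apply: le_lt_trans h; rewrite lee_fin.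
- exact: measurable_funeM.
move=> l /=; rewrite in_itv/= andbT => l0; have k0 := kernel_ge0 l.
have [Al|lA] := leP A l.
  rewrite [X in (\int[leb]_(s in X) _)%E](_ : _ = set0).
    by rewrite integral_set0 -EFinM lee_fin mulr_ge0//; lra.
  apply/seteqP; split => s // [_] /=; rewrite lte_fin ltNge.
  by have [h _ _] := clipP (f s) A0; rewrite (le_trans h Al).
have tv := distr_below (ltW l0) lA.
apply: le_trans (integral_capped mw (mE l) _ _ t0 tv tb wt wb) _.
- by move=> s [].
- rewrite -distrE//; apply: le_measure.
    by rewrite inE; exact: mE.
    by rewrite inE; exact: measurable_superlevel.
  move=> s [Is] /=; rewrite lte_fin => h; split => //; apply: lt_le_trans h _.
  by have [_ + _] := clipP (f s) A0.
- rewrite /kernel /calderon_kernel -EFinM lee_fin min_l ?(ltW tv)// max_l ?(ltW tv)//.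
  by rewrite mulfV// gt_eqF.
Qed.

(* Test against the sign of the transform on the set where it exceeds [4 Q] and
   use self-adjointness. *)
Lemma lower_part_distr n : distr (dyadic_transform f2 n) (4 * Q) <= t / 2.
Proof.
rewrite leNgt; apply/negP; set b := distr _ _ => tb.
pose a := dyadic_mean f2; pose ep := even_part a n.
pose h j := if 4 * Q < `|ep j| then Num.sg (ep j) else 0.
pose H := dyadic_mean (step_fun n h); pose w := dyadic_transform (step_fun n h) n.
have ma : dyadic_martingale a by exact: dyadic_mean_martingale.
have mH : dyadic_martingale H by apply: dyadic_mean_martingale; exact: L1_step.
have bE : b = level_mean n (fun j => (4 * Q < `|ep j|)%R%:R).
  by rewrite /b distr_step// mulr_ge0// ltW.
have Hh j : (j < 2 ^ n)%N -> H n j = h j by exact: dyadic_mean_step.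
have h_abs j : `|h j| = (4 * Q < `|ep j|)%R%:R.
  rewrite /h; case: ifPn => [c|_]; last by rewrite normr0.
  rewrite normr_sg -normr_gt0 (lt_trans _ c)// mulr_gt0//.
(* [h] takes only the values -1, 0 and 1, so its mean absolute value and its mean square are both
   [b]; they supply the weak type and L2 bounds for [w]. *)
have absH : level_mean n (fun j => `|H n j|) = b.
  by rewrite bE; apply: eq_level_mean => j jn; rewrite Hh.
have sqrH : level_mean n (fun j => H n j ^+ 2) = b.
  rewrite bE; apply: eq_level_mean => j jn; rewrite Hh// -real_normK ?num_real// h_abs.
  by case: (_ < _); rewrite ?expr1n ?expr0n.
have mw : measurable_fun I01 w by exact: mT.
have wt l : 0 < l -> l * distr w l <= 2 * b.
  move=> l0; rewrite distr_step ?(ltW l0)// -absH.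
  by have := even_part_weak_type mH n l0; rewrite mulrAC ler_pdivlMr// mulrC.
have wb : (\int[leb]_(s in I01) (w s ^+ 2)%:E <= b%:E)%E.
  rewrite (level_mean_integral (n := n) (g := fun j => even_part H n j ^+ 2)).
  - by rewrite lee_fin -sqrH; exact: even_part_sqr.
  - exact: measurable_funX.
  - by move=> s _; exact: sqr_ge0.
  - by move=> j s jn sj; rewrite /w /dyadic_transform (step_funE _ jn sj).
have tb' : t < 2 * b by lra.
have := lower_pairing mw tb' wt wb; apply/negP; rewrite -leNgt.
have Lw : L1 (fun s => f2 s * w s).
  apply: (@bounded_L1 _ _ (A * \sum_(j < 2 ^ n) `|even_part H n j|)).
    by apply: measurable_funM => //; exact: (L1_measurable Lf2).
  move=> s _; rewrite normrM; apply: ler_pM => //; last exact: step_fun_bounded.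
  by have [] := clipP (f s) A0.
apply: (@le_trans _ _ `|\int[leb]_(s in I01) (f2 s * w s)%:E|%E); last first.
  by apply: le_abse_integral; [exact: measurable_I01|exact: measurable_int Lw].
have fin : (\int[leb]_(s in I01) (f2 s * w s)%:E)%E \is a fin_num.
  by apply: integrable_fin_num; [exact: measurable_I01|exact: Lw].
rewrite -[X in `|X|%E](fineK fin) abse_EFin lee_fin; apply: le_trans (ler_norm _).
rewrite -/(Rintegral leb I01 _) (step_pairing Lf2 Lw) -/a -(even_part_adjoint n ma mH).
rewrite bE mulrAC -level_meanZ; apply: le_level_mean => j jn; rewrite Hh// -/ep /h.
case: ifPn => c; last by rewrite !mulr0.
by rewrite mulr1 [ep j * _]mulrC -normrEsg ltW.
Qed.

(** Each part gets the level [4 * Q] and the measure [t / 2]; for the unbounded part this is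
    [2 * (t * Q) / (4 * Q)] from the weak type inequality. *)
Lemma dyadic_transform_distr n : distr (dyadic_transform f n) (8 * Q) <= t.
Proof.
have fE : f = (f2 \+ f1)%R by apply/funext => s /=; rewrite addrC subrK.
rewrite [in dyadic_transform _ _]fE (_ : dyadic_transform _ n =
    dyadic_transform f2 n \+ dyadic_transform f1 n); last first.
  by apply/funext => s; exact: dyadic_transformD.
have -> : 8 * Q = 4 * Q + 4 * Q by lra.
apply: le_trans (distr_add (mT _ _) (mT _ _) _ _) _.
have Q4 : 0 < 4 * Q by rewrite mulr_gt0.
have := dyadic_transform_weak_type n Lf1 Q4.
move=> /le_trans/(_ (lee_wpmul2l _ upper_part_integral)).
rewrite lee_fin => /(_ (ler0n _ _)); rewrite -EFinM lee_fin => h1.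
have h2 := lower_part_distr n; have := Q0; nra.
Qed.

End TransformRearrangement.

(** * Convergence of the partial transforms *)

Section TransformExistence.
Context (R : realType).
Local Notation leb := (@lebesgue_measure R).
Implicit Types (f g : R -> R) (n j k : nat) (l : R).

Let mT n f : measurable_fun I01 (dyadic_transform f n).
Proof. exact: measurable_step_fun. Qed.

Lemma L1_truncation f (d : R) : L1 f -> 0 < d ->
  exists2 A : R, 0 <= A & (\int[leb]_(s in I01) `|f s - clip A (f s)|%:E <= d%:E)%E.
Proof.
move=> Lf d0; have mI := @measurable_I01 R; have mf := L1_measurable Lf.
have h : (\int[leb]_(s in I01) `|f s - clip n%:R (f s)|%:E)%E @[n --> \oo]
    --> (\int[leb]_(s in I01) cst 0%E s)%E.
  apply: (@dominated_cvg _ _ R leb I01 mI _ _ (fun s => `|f s|%:E)).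
  - move=> n; apply/measurable_EFinP; apply: measurableT_comp => //.
    by apply: measurable_funB => //; exact: measurable_clip.
  - move=> s _; apply: cvg_near_cst; near=> n; congr EFin; apply/eqP.
    rewrite normr_eq0 -normr_le0 leNgt; apply/negP.
    have [_ _ c] := clipP (f s) (ler0n R n); move/(c _ (lexx 0)).
    rewrite add0r ltNge => /negP; apply.
    by near: n; exact: nbhs_infty_ger.
  - by [].
  - have := integrable_abse Lf; apply: eq_integrable => // s _.
  - move=> n s _; rewrite lee_fin normr_id leNgt; apply/negP.
    have [_ _ c] := clipP (f s) (ler0n R n); move/(c _ (normr_ge0 _)).
    by rewrite ltNge lerDl ler0n.
move: h; rewrite integral_cst// mul0e.
have : (forall n : nat, (0 <= \int[leb]_(s in I01) `|f s - clip n%:R (f s)|%:E)%E).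
  by move=> n; apply: integral_ge0 => s _; rewrite lee_fin.
move=> /ge0_cvge0P h0 /h0/(_ _ d0)[N /(_ N (leqnn N)) hN].
by exists N%:R.
Unshelve. all: by end_near. Qed.

Lemma dyadic_mean_bounded f (A : R) n j : L1 f -> (forall t, I01 t -> `|f t| <= A) ->
  (j < 2 ^ n)%N -> `|dyadic_mean f n j| <= A.
Proof.
move=> Lf fA jn; have If := integrable_dyi Lf jn.
rewrite /dyadic_mean normrM ger0_norm ?exprn_ge0// mulrC -ler_pdivlMr ?exprn_gt0//.
have fin : (\int[leb]_(s in dyi n j) (f s)%:E)%E \is a fin_num.
  by apply: integrable_fin_num; [exact: measurable_dyi|exact: If].
rewrite -lee_fin -abse_EFin [X in `|X|%E](fineK fin).
apply: (@le_trans _ _ (\int[leb]_(s in dyi n j) `|(f s)%:E|)%E).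
  by apply: le_abse_integral; [exact: measurable_dyi|exact: measurable_int If].
apply: (@le_trans _ _ (\int[leb]_(s in dyi n j) (cst A%:E s))%E).
  apply: ge0_le_integral; first exact: measurable_dyi.
  - by move=> s _; rewrite abse_ge0.
  - by apply: measurableT_comp => //; exact: measurable_int If.
  - exact: measurable_cst.
  - by move=> s /(dyi_sub jn) Is; rewrite lee_fin fA.
rewrite integral_cst; last exact: measurable_dyi.
by rewrite [X in (_ * X)%E](leb_dyi R n j) -EFinM.
Qed.

Definition second_moment f n := level_mean n (fun j => even_part (dyadic_mean f) n j ^+ 2).

Lemma transform_increment_distr f n k l : L1 f -> 0 < l ->
  distr (dyadic_transform f (k + n) \- dyadic_transform f n) l * l ^+ 2 <=
  second_moment f (k + n) - second_moment f n.
Proof.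
move=> Lf l0; rewrite -(even_part_incr_sqr (dyadic_mean_martingale Lf)).
pose z j := even_part (dyadic_mean f) (k + n) j - even_part (dyadic_mean f) n (iter k half j).
rewrite -[leRHS]/(level_mean (k + n) (fun j => z j ^+ 2)).
have -> : distr (dyadic_transform f (k + n) \- dyadic_transform f n) l =
    distr (step_fun (k + n) z) l.
  apply: (@distr_ae _ _ _ _ _ (k + n)).
  - exact: measurable_funB.
  - exact: measurable_step_fun.
  move=> j t jn tj; rewrite /= (step_funE _ jn tj) /dyadic_transform (step_funE _ jn tj).
  rewrite /z (step_funE _ _ (dyi_iter_half tj))//.
  by elim: k j jn {z tj} => // k IH j jn; rewrite iterSr; apply: IH; exact: half_lt.
rewrite distr_step ?(ltW l0)// mulrC -level_meanZ; apply: le_level_mean => j _.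
rewrite -/(z j); case: ltP => lz; rewrite ?mulr0 ?sqr_ge0// mulr1 -(real_normK (num_real (z j))).
by rewrite lerXn2r ?nnegrE// ltW.
Qed.

(** Second moments of a bounded function are at most [A ^+ 2]; [N] is chosen where they come within
    [d] of their supremum. *)
Lemma second_moment_cauchy f (A d : R) : L1 f -> 0 <= A -> (forall t, I01 t -> `|f t| <= A) ->
  0 < d -> exists N, forall k, second_moment f (k + N) - second_moment f N < d.
Proof.
move=> Lf A0 fA d0; have mean1 n : level_mean n (fun=> A ^+ 2) = A ^+ 2.
  by rewrite /level_mean sumr_const card_ord -[X in _ * X]mulr_natl natrX mulKf// gt_eqF// exprn_gt0.
have bd n : second_moment f n <= A ^+ 2.
  apply: le_trans (even_part_sqr (dyadic_mean_martingale Lf) n) _.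
  rewrite -[leRHS](mean1 n); apply: le_level_mean => j jn.
  by rewrite -(real_normK (num_real _)) lerXn2r ?nnegrE//; exact: dyadic_mean_bounded.
have hs : has_sup (range (second_moment f)).
  by split; [exists (second_moment f 0), 0%N|exists (A ^+ 2) => _ [n _ <-]].
have [_ [N _ <-] hN] := sup_adherent d0 hs; exists N => k.
have : second_moment f (k + N) <= sup (range (second_moment f)).
  by apply: ub_le_sup; [case: hs|exists (k + N)%N].
by move: hN; lra.
Qed.

Lemma dyadic_transform_cauchy f (e : R) : L1 f -> 0 < e -> exists N, forall n, (N <= n)%N ->
  distr (dyadic_transform f n \- dyadic_transform f N) e <= e.
Proof.
move=> Lf e0; have e3 : 0 < e / 3 by lra.
(* Three pieces get the level [e / 3] and the measure [e / 3] each. The weak type bound for an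
   unbounded part gives [2 * (e ^+ 2 / 18) / (e / 3) = e / 3]; Chebyshev for the bounded part needs
   an increment below [(e / 3) ^+ 3]. *)
have e18 : 0 < e ^+ 2 / 18 by rewrite divr_gt0// exprn_gt0.
have [A A0 fA] := L1_truncation Lf e18.
pose f2 s := clip A (f s); pose f1 s := f s - clip A (f s).
have [Lf2 Lf1] := L1_clip A0 Lf; rewrite -/f2 in Lf2; rewrite -/f1 in Lf1.
have e27 : 0 < (e / 3) ^+ 3 by exact: exprn_gt0.
have f2A t : I01 t -> `|f2 t| <= A by move=> _; have [] := clipP (f t) A0.
have [N hN] := second_moment_cauchy Lf2 A0 f2A e27; exists N => n Nn.
have fE : f = (f2 \+ f1)%R by apply/funext => s /=; rewrite addrC subrK.
have TE m : dyadic_transform f m = dyadic_transform f2 m \+ dyadic_transform f1 m.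
  by apply/funext => s; rewrite {1}fE; exact: dyadic_transformD.
have -> : dyadic_transform f n \- dyadic_transform f N =
    (dyadic_transform f2 n \- dyadic_transform f2 N) \+
    (dyadic_transform f1 n \+ (fun s => -1 * dyadic_transform f1 N s)).
  by apply/funext => s; rewrite !TE /=; lra.
have weak m : distr (dyadic_transform f1 m) (e / 3) <= e / 3.
  have := dyadic_transform_weak_type m Lf1 e3.
  move=> /le_trans/(_ (lee_wpmul2l _ fA)).
  rewrite lee_fin => /(_ (ler0n _ _)); rewrite -EFinM lee_fin.
  by move=> h; rewrite -(ler_pM2l e3); lra.
have e3E : e = e / 3 + (e / 3 + e / 3) by lra.
have m1 : measurable_fun I01 (dyadic_transform f2 n \- dyadic_transform f2 N).
  exact: measurable_funB.
have m2 : measurable_fun I01 (fun s => -1 * dyadic_transform f1 N s) by exact: measurable_scale.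
rewrite {1}e3E; apply: le_trans (distr_add m1 (measurable_funD (mT _ _) m2) _ _) _.
have := distr_add (mT n f1) m2 (e / 3) (e / 3).
have n1 : (-1 : R) != 0 by rewrite oppr_eq0 oner_eq0.
rewrite (distr_scale (mT N f1) _ n1) normrN1 divr1.
have := le_lt_trans (transform_increment_distr N (n - N) Lf2 e3) (hN _); rewrite subnK//.
have e9 : 0 < (e / 3) ^+ 2 by exact: exprn_gt0.
rewrite [X in _ < X]exprS ltr_pM2r//.
by have := weak n; have := weak N; lra.
Qed.

End TransformExistence.

Section TransformBounded.
Context (R : realType).
Implicit Types (f g : R -> R) (n j k : nat) (l t : R).

Definition transform_sum (e : nat -> R -> R) n t : R :=
  \sum_(m < n) (e m.*2 t - (if m == 0%N :> nat then 0 else e m.*2.-1 t)).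

Lemma measurable_transform_sum (e : nat -> R -> R) n :
  (forall n, measurable_fun I01 (e n)) -> measurable_fun I01 (transform_sum e n).
Proof.
move=> me; apply: measurable_sum => m; apply: measurable_funB => //.
by case: (m == 0%N :> nat).
Qed.

Lemma transform_sum_ae f (e : nat -> R -> R) n t : L1 f ->
  (forall n, is_cond_exp (dyadic_algebra n) f (e n)) -> I01 t -> ~ dyadic_points t ->
  transform_sum e n.+1 t = dyadic_transform f n.*2 t.
Proof.
move=> Lf he It nt; have [j jn tj] := off_dyadic It nt n.*2.
by rewrite /transform_sum (transform_partial_sum Lf he jn tj) /dyadic_transform (step_funE _ jn tj).
Qed.

Lemma distr_ae_le f g : measurable_fun I01 f -> measurable_fun I01 g ->
  (forall t, I01 t -> ~ dyadic_points t -> f t = g t) -> forall l, distr f l <= distr g l.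
Proof.
move=> mf mg fg; apply: distr_le => //; apply: negligibleS (dyadic_points_null R).
move=> t /= h; apply: contrapT => nt; apply: h => It.
by rewrite fg.
Qed.

Lemma martingale_transform_exists f : L1 f -> exists g, martingale_transform f g /\
  forall t, 0 < t < 1 -> (drearr g t <= 8%:E * calderon (drearr f) t)%E.
Proof.
move=> Lf; pose e n := step_fun n (dyadic_mean f n).
have he n : is_cond_exp (dyadic_algebra n) f (e n) by exact: cond_exp_step.
have mS n : measurable_fun I01 (transform_sum e n).
  by apply: measurable_transform_sum => m; exact: measurable_step_fun.
have mT n : measurable_fun I01 (dyadic_transform f n) by exact: measurable_step_fun.
have n1 : (-1 : R) != 0 by rewrite oppr_eq0 oner_eq0.
have [d d0|g [mg Sg]] := cauchy_in_measure_cvg mS.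
  have d2 : 0 < d / 2 by lra.
  have [N hN] := dyadic_transform_cauchy Lf d2; exists N.+1 => -[//|m] [//|n] Nm Nn.
  have le2 k : (N < k.+1)%N -> (N <= k.*2)%N.
    by rewrite ltnS => /leq_trans; apply; rewrite -addnn leq_addr.
  have mD k : measurable_fun I01 (dyadic_transform f k \- dyadic_transform f N).
    exact: measurable_funB.
  rewrite (distrE (x := transform_sum e m.+1 \- transform_sum e n.+1)); last exact: measurable_funB.
  rewrite lee_fin; apply: (@le_trans _ _ (distr ((dyadic_transform f m.*2 \- dyadic_transform f N)
      \+ (fun s => -1 * (dyadic_transform f n.*2 \- dyadic_transform f N) s)) (d / 2 + d / 2))).
    rewrite (_ : d / 2 + d / 2 = d); last by lra.
    apply: distr_ae_le.
    - exact: measurable_funB.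
    - by apply: measurable_funD => //; exact: measurable_scale.
    - by move=> t It nt; rewrite /= !(transform_sum_ae _ Lf he It nt); lra.
  apply: le_trans (distr_add (mD _) (measurable_scale _ (mD _)) _ _) _.
  rewrite (distr_scale (mD _) _ n1) normrN1 divr1.
  by have := hN _ (le2 _ Nm); have := hN _ (le2 _ Nn); lra.
exists g; split; first by split => //; exists e.
move=> t /andP[t0 t1].
(* [Q], [l] and [d] carry the losses in the limit: strictness of the bound, level of the error,
   measure of the error. *)
have key Q l d : (calderon (drearr f) t < Q%:E)%E -> 0 < l -> 0 < d ->
    distr g (8 * Q + l) <= t + d.
  move=> cQ l0 d0; have [M hM] := cvg_in_measure_small Sg l0 d0.
  have mB : measurable_fun I01 (transform_sum e M.+1 \- g) by exact: measurable_funB.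
  have -> : g = transform_sum e M.+1 \+ (fun s => -1 * (transform_sum e M.+1 \- g) s).
    by apply/funext => s /=; lra.
  apply: le_trans (distr_add (mS _) (measurable_scale _ mB) _ _) _; apply: lerD.
    apply: le_trans (dyadic_transform_distr Lf t0 t1 cQ M.*2).
    by apply: distr_ae_le => // s Is ns; exact: transform_sum_ae.
  rewrite (distr_scale mB _ n1) normrN1 divr1 -lee_fin -distrE//.
  exact: hM.
have c0 : (0 <= calderon (drearr f) t)%E.
  rewrite calderonE//; first by apply: integral_ge0 => l _; rewrite lee_fin calderon_kernel_ge0 ?distr_ge0.
  exact: L1_measurable.
move: c0 key; case: (calderon _ t) => [q| |//]; last first.
  by move=> _ _; rewrite gt0_muley ?lte_fin// leey.
rewrite lee_fin => q0 key; rewrite -EFinM; apply/lee_addgt0Pr => d d0.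
rewrite -EFinD leNgt; apply/negP; rewrite (drearr_gtE mg); last by lra.
apply/negP; rewrite -leNgt; apply/ler_addgt0Pr => d' d'0.
(* Half of [d] makes [q + d / 16] a strict bound, the other half is the level of the error in
   measure. *)
have -> : 8 * q + d = 8 * (q + d / 16) + d / 2 by lra.
by apply: key; rewrite ?lte_fin; lra.
Qed.

End TransformBounded.

Section LorentzBounded.
Context (R : realType).
Local Notation leb := (@lebesgue_measure R).
Variables (phi psi : R -> R) (qphi : quasi_concave phi).

Lemma lorentz_L1 (x : R -> R) : lorentz_space phi x -> L1 x.
Proof.
move=> Fx; have mx := lorentz_measurable Fx.
have F1 : 0 < fundamental phi 1 by apply: fundamental_gt0.
apply/integrableP; split; first exact/measurable_EFinP.
have -> : (\int[leb]_(t in I01) `|(EFin \o x) t| = \int[leb]_(l in `]0%R, +oo[) (distr x l)%:E)%E.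
  by rewrite -integral_distr.
apply: (@le_lt_trans _ _ ((fundamental phi 1)^-1%:E * rearr_int phi x)%E); last first.
  by rewrite lorentz_sizeE// -EFinM ltry.
rewrite rearr_intE// -(ge0_integralZl leb (measurable_itv _)); first last.
- by rewrite lee_fin invr_ge0 ltW.
- by move=> l _; rewrite lee_fin fundamental_ge0.
- exact: measurable_fundamental_distr.
apply: ge0_le_integral => //.
- by move=> l _; rewrite lee_fin distr_ge0.
- by apply: antitone_emeasurable => // a b _ _ ab; rewrite lee_fin distr_anti.
- by apply: measurable_funeM; exact: measurable_fundamental_distr.
move=> l _; rewrite -EFinM lee_fin mulrC ler_pdivlMr//.
have := fundamental_concave qphi (distr_ge0 x l) (distr_le1 mx l) (lexx 1).
by rewrite mul1r.
Qed.

End LorentzBounded.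

(** * Optimality *)

Section Lacunary.
Context (R : realType).
Local Notation leb := (@lebesgue_measure R).
Variable Y : R -> R.
Hypotheses (Y0 : forall s, I01 s -> 0 <= Y s)
  (Yanti : forall s t, I01 s -> I01 t -> s <= t -> Y t <= Y s)
  (LY : L1 Y).
Implicit Types (n j k m : nat) (s t l : R).

Let pow_gt0 n : (0 : R) < 2 ^+ n. Proof. exact: exprn_gt0. Qed.

(** The [k]-th block is []2 ^- k.+1, 2 ^- k[]. Points in no block get the default index 0, for which
    [lacunary_bounds] still holds. *)
Definition dyadic_block t : nat := xget 0%N [set k | dyi k.+1 1 t].

(** Even blocks carry the value of [Y] at their left end. The zeros on odd blocks prevent
    cancellation: the mean over []0, 2 ^- n[] is halved when [n] goes from [i.*2] to [i.*2.-1], so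
    the even difference there is half the mean at level [i.*2]. *)
Definition block_value k : R := if odd k then 0 else Y (2 ^- k.+1).

Definition lacunary t : R := block_value (dyadic_block t).

Let pow_I01 k : I01 (2 ^- k.+1 : R).
Proof.
rewrite /I01/= in_itv/= invr_gt0 pow_gt0/= invf_lt1//.
by rewrite exprn_egt1 ?ltr1n.
Qed.

Let block_in k t : dyi k.+1 1 t <-> 2 ^- k.+1 < t < 2 ^- k.
Proof.
rewrite /dyi /= in_itv/= div1r; have -> : 2 / 2 ^+ k.+1 = 2 ^- k :> R; last by [].
by rewrite exprS invfM mulrA mulfV ?mul1r// pnatr_eq0.
Qed.

Lemma dyadic_block_eq k t : dyi k.+1 1 t -> dyadic_block t = k.
Proof.
move=> tk; rewrite /dyadic_block; case: xgetP => [k' _ /= tk'|/(_ k)//].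
have le a b : dyi a.+1 1 t -> dyi b.+1 1 t -> (b <= a)%N.
  move=> /block_in/andP[h _] /block_in/andP[_ h']; rewrite leqNgt; apply/negP => ab.
  have := lt_trans h h'; rewrite ltf_pV2 ?posrE// ltNge => /negP; apply.
  by rewrite ler_weXn2l// ler1n.
by apply/eqP; rewrite eqn_leq !le.
Qed.

Lemma lacunary_block k t : dyi k.+1 1 t -> lacunary t = block_value k.
Proof. by move=> tk; rewrite /lacunary (dyadic_block_eq tk). Qed.

Lemma block_value_ge0 k : 0 <= block_value k.
Proof. by rewrite /block_value; case: ifP => // _; exact: Y0. Qed.

Lemma measurable_lacunary : measurable_fun I01 lacunary.
Proof.
have mb k : measurable [set t : R | dyadic_block t = k].
  rewrite (_ : [set t | _] = dyi k.+1 1 `|`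
      (if k == 0%N then ~` (\bigcup_k dyi k.+1 1) else set0)).
    apply: measurableU; first exact: measurable_dyi.
    case: ifP => // _; apply: measurableC; apply: bigcup_measurable => i _.
    exact: measurable_dyi.
  apply/seteqP; split => t /=.
    rewrite /dyadic_block; case: xgetP => [k' _ /= tk' <-|nk <-]; first by left.
    by right => -[i _]; exact: nk.
  move=> [/dyadic_block_eq//|]; case: eqP => // -> nt.
  by rewrite /dyadic_block; case: xgetP => // i _ /= ti; case: nt; exists i.
move=> _ B mB; apply: measurableI; first exact: measurable_I01.
rewrite (_ : _ @^-1` _ = \bigcup_(k in [set k | B (block_value k)]) [set t | dyadic_block t = k]).
  exact: bigcup_measurable.
apply/seteqP; split => t /= => [Bt|[k /= Bk tk]]; first by exists (dyadic_block t).
by rewrite /lacunary tk.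
Qed.

Lemma lacunary_bounds t : I01 t -> 0 <= lacunary t <= Y (t / 2).
Proof.
move=> It; have /andP[t0 t1] : 0 < t < 1 by move: It; rewrite /I01/= in_itv.
have It2 : I01 (t / 2) by rewrite /I01/= in_itv/=; apply/andP; split; lra.
rewrite block_value_ge0/= /lacunary /block_value.
case: ifP => _; first exact: Y0.
apply: Yanti => //; rewrite /dyadic_block; case: xgetP => [k _ /=|_].
  by move=> /block_in/andP[_ /ltW h]; rewrite exprS invfM; lra.
(* Default index 0: the value is [Y] at 1/2, and [t / 2 <= 1 / 2]. *)
by rewrite expr1; lra.
Qed.

Lemma distr_lacunary l : 0 < l -> distr lacunary l <= 2 * distr Y l.
Proof.
move=> l0; have mY := L1_measurable LY.
have d0 := distr_ge0 Y l.
rewrite -lee_fin -distrE; last exact: measurable_lacunary.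
apply: (@le_trans _ _ (leb `]0%R, (2 * distr Y l)%R]%classic)).
  apply: le_measure.
  - by rewrite inE; apply: measurable_superlevel; exact: measurable_lacunary.
  - by rewrite inE; exact: measurable_itv.
  move=> t [It lt] /=; have /andP[f0 fY] := lacunary_bounds It.
  have /andP[t0 t1] : 0 < t < 1 by move: It; rewrite /I01/= in_itv.
  rewrite in_itv/= t0/=; rewrite ger0_norm// in lt.
  suff : t / 2 <= distr Y l by lra.
  rewrite -lee_fin -distrE//; apply: (@le_trans _ _ (leb `]0%R, (t / 2)%R[%classic)).
    by rewrite [X in (_ <= X)%E]leb_oo ?subr0//; lra.
  apply: le_measure.
  - by rewrite inE; exact: measurable_itv.
  - by rewrite inE; exact: measurable_superlevel.
  move=> s /=; rewrite in_itv/= => /andP[s0 st].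
  have Is : I01 s by rewrite /I01/= in_itv/= s0; lra.
  split => //; rewrite ger0_norm ?Y0//; apply: (lt_le_trans lt); apply: (le_trans fY).
  by apply: Yanti => //; [rewrite /I01/= in_itv/=; apply/andP; split; lra|exact: ltW].
rewrite le_eqVlt in d0; case/predU1P: d0 => [<-|d0].
  by rewrite mulr0 set_itvoc0 measure0.
by rewrite lebesgue_measure_itv/= lte_fin mulr_gt0// sube0.
Qed.

End Lacunary.

Section LacunaryMeans.
Context (R : realType).
Local Notation leb := (@lebesgue_measure R).
Implicit Types (h : R -> R) (i j k m n : nat).

Let pow_gt0 n : (0 : R) < 2 ^+ n. Proof. exact: exprn_gt0. Qed.

Lemma dyadic_mean_cst h n j (v : R) : (forall t, dyi n j t -> h t = v) -> dyadic_mean h n j = v.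
Proof.
move=> hv; rewrite /dyadic_mean (@eq_Rintegral _ _ _ _ _ (cst v)); last first.
  by move=> t; rewrite inE => /hv.
rewrite Rintegral_cst; last exact: measurable_dyi.
by rewrite [X in fine X](leb_dyi R n j)/= mulrCA mulfV ?mulr1// gt_eqF.
Qed.

Lemma dyadic_mean_le h n j (v : R) : L1 h -> (j < 2 ^ n)%N ->
  (forall t, dyi n j t -> h t <= v) -> dyadic_mean h n j <= v.
Proof.
move=> Lh jn hv; rewrite -[leRHS](@dyadic_mean_cst (cst v) n j)//.
rewrite /dyadic_mean ler_pM2l//; apply: le_Rintegral.
- exact: measurable_dyi.
- exact: integrable_dyi.
- by apply: integrable_dyi jn; apply: (@bounded_L1 _ _ `|v|).
- exact: hv.
Qed.

Lemma dyadic_mean_ge0 h n j : (forall t, dyi n j t -> 0 <= h t) -> 0 <= dyadic_mean h n j.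
Proof. by move=> h0; rewrite mulr_ge0 ?exprn_ge0//; apply: Rintegral_ge0. Qed.

Lemma dyi0 n : dyi n 0 = (`]0, 2 ^- n[%classic : set R).
Proof. by rewrite /dyi mul0r div1r. Qed.

Lemma integral_dyi0_small h (e : R) : L1 h -> (forall t, I01 t -> 0 <= h t) -> 0 < e ->
  exists N, forall n, (N <= n)%N -> \int[leb]_(t in dyi n 0) h t <= e.
Proof.
move=> Lh h0 e0; have mI := @measurable_I01 R; have mh := L1_measurable Lh.
have sub n : dyi n 0 `<=` (I01 : set R) by apply: dyi_sub; rewrite expn_gt0.
have lim : (\int[leb]_(t in I01) (h t * \1_(dyi n 0) t)%:E)%E @[n --> \oo]
    --> (\int[leb]_(s in I01) cst 0%E s)%E.
  apply: (@dominated_cvg _ _ R leb I01 mI _ _ (fun s => `|h s|%:E)).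
  - move=> n; apply/measurable_EFinP; apply: measurable_funM => //.
    by apply: measurable_indic; exact: measurable_dyi.
  - move=> s; rewrite /I01/= in_itv/= => /andP[s0 s1]; apply: cvg_near_cst; near=> n.
    rewrite indicE memNset ?mulr0// dyi0/= in_itv/= s0/=; apply/negP.
    rewrite -leNgt -[leRHS]invrK lef_pV2 ?posrE ?invr_gt0//.
    apply: (@le_trans _ _ (n%:R)); first by near: n; exact: nbhs_infty_ger.
    by rewrite -natrX ler_nat ltnW// ltn_expl.
  - by [].
  - by have := integrable_abse Lh; apply: eq_integrable.
  - move=> n s _; rewrite lee_fin normrM ler_piMr// indicE.
    by case: (_ \in _); rewrite ?normr1 ?normr0.
move: lim; rewrite integral_cst// mul0e.
have : (forall n, (0 <= \int[leb]_(t in I01) (h t * \1_(dyi n 0) t)%:E)%E).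
  by move=> n; apply: integral_ge0 => s Is; rewrite lee_fin mulr_ge0// ?h0// indicE.
move=> /ge0_cvge0P p /p/(_ _ e0)[N hN]; exists N => n /hN; rewrite -lee_fin.
have -> : (\int[leb]_(t in I01) (h t * \1_(dyi n 0) t)%:E =
    \int[leb]_(t in dyi n 0) (h t)%:E)%E.
  rewrite -[in RHS](setIidr (sub n)) integral_mkcondr; apply: eq_integral => t _.
  by rewrite patchE indicE; case: (_ \in _); rewrite ?mulr1 ?mulr0.
rewrite fineK//; apply: integrable_fin_num; first exact: measurable_dyi.
by apply: (integrable_dyi Lh); rewrite expn_gt0.
Unshelve. all: by end_near. Qed.

Variable Y : R -> R.
Hypotheses (Y0 : forall s, I01 s -> 0 <= Y s)
  (Yanti : forall s t, I01 s -> I01 t -> s <= t -> Y t <= Y s)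
  (LY : L1 Y) (Lf : L1 (lacunary Y)).

Local Notation D i := (dyadic_mean (lacunary Y) i 0).
Local Notation V m := (dyadic_mean Y m.*2.+1 0).
Local Notation c m := (Y (2 ^- m.*2.+1)).

Let pow_I01 k : I01 (2 ^- k.+1 : R).
Proof.
rewrite /I01/= in_itv/= invr_gt0 pow_gt0/= invf_lt1//.
by rewrite exprn_egt1 ?ltr1n.
Qed.

Let dyi1_gt k (t : R) : dyi k.+1 1 t -> I01 t /\ 2 ^- k.+1 < t.
Proof.
move=> tk; split; first by apply: dyi_sub tk; rewrite -[1%N](expn0 2) ltn_exp2l.
by move: tk; rewrite /dyi/= in_itv/= div1r => /andP[].
Qed.

Lemma lacunary_mean_half k : D k = (D k.+1 + block_value Y k) / 2.
Proof.
have /(_ k 0%N) := dyadic_mean_martingale Lf; rewrite expn_gt0 => /(_ isT) ->.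
by congr ((_ + _) / 2); apply: dyadic_mean_cst => t; exact: lacunary_block.
Qed.

Lemma lacunary_mean_ge0 k : 0 <= D k.
Proof.
apply: dyadic_mean_ge0 => t tk.
have It : I01 t by apply: dyi_sub tk; rewrite expn_gt0.
by have /andP[] := lacunary_bounds Y0 Yanti It.
Qed.

Let block_even m : block_value Y m.*2 = c m.
Proof. by rewrite /block_value odd_double. Qed.

Let block_odd m : block_value Y m.*2.+1 = 0.
Proof. by rewrite /block_value /= odd_double. Qed.

Lemma lacunary_mean_even m : D m.*2 = D m.+1.*2 / 4 + c m / 2.
Proof.
by rewrite lacunary_mean_half (lacunary_mean_half m.*2.+1) block_even block_odd; lra.
Qed.

Let c_ge0 m : 0 <= c m. Proof. exact: Y0. Qed.

Lemma initial_mean_step m : V m <= V m.+1 / 4 + 3 / 4 * c m.+1.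
Proof.
have half k : dyadic_mean Y k 0 = (dyadic_mean Y k.+1 0 + dyadic_mean Y k.+1 1) / 2.
  by have /(_ k 0%N) := dyadic_mean_martingale LY; rewrite expn_gt0 => /(_ isT).
have le k : (k <= m.+1.*2)%N -> dyadic_mean Y k.+1 1 <= c m.+1.
  move=> km; apply: dyadic_mean_le => //; first by rewrite -[1%N](expn0 2) ltn_exp2l.
  move=> t /dyi1_gt[It tk]; apply: Yanti => //; apply: le_trans (ltW tk).
  by rewrite lef_pV2 ?posrE// ler_weXn2l// ler1n.
have h1 := le m.*2.+1; have h2 := le m.*2.+2.
rewrite half (half m.*2.+2) doubleS.
by have := h1 (leqnSn _); have := h2 (leqnn _); lra.
Qed.

(** The factor 3/2 makes the terms in [c] cancel between [initial_mean_step] and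
    [lacunary_mean_even], leaving [d n <= d n.+1 / 4]. After [N] iterations the right side is at
    most a fixed multiple of the integral of [Y] over a shrinking interval at 0. *)
Lemma initial_mean_le m : V m <= 3 / 2 * D m.+1.*2.
Proof.
pose d n := V n - 3 / 2 * D n.+1.*2.
have dS n : d n <= d n.+1 / 4.
  by rewrite /d; have := initial_mean_step n; have := lacunary_mean_even n.+1; lra.
have dn k : d m <= 4 ^- k * d (m + k)%N.
  elim: k => [|k IH]; first by rewrite expr0 invr1 mul1r addn0.
  apply: (le_trans IH); rewrite exprS invfM addnS -mulrA mulrCA ler_pM2l ?invr_gt0 ?exprn_gt0//.
  by have := dS (m + k)%N; lra.
rewrite -subr_le0; apply/ler_addgt0Pr => e e0; rewrite add0r.
have e1 : 0 < e / 2 ^+ m.*2.+1 by rewrite divr_gt0.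
have [N hN] := integral_dyi0_small LY Y0 e1; apply: (le_trans (dn N)).
apply: (@le_trans _ _ (4 ^- N * V (m + N)%N)).
  rewrite ler_pM2l ?invr_gt0 ?exprn_gt0// /d; have := lacunary_mean_ge0 (m + N).+1.*2; lra.
have -> : 4 ^- N * V (m + N)%N = 2 ^+ m.*2.+1 * \int[leb]_(t in dyi (m + N).*2.+1 0) Y t.
  rewrite /dyadic_mean mulrA; congr (_ * _).
  rewrite doubleD -addSn exprD -[N.*2]mul2n exprM (_ : 2 ^+ 2 = 4 :> R); last by lra.
  by rewrite mulrCA mulVf ?mulr1// gt_eqF// exprn_gt0.
rewrite mulrC -ler_pdivlMr//; apply: hN.
by apply: (leq_trans (leq_addl m N)); rewrite leqW// -addnn leq_addr.
Qed.

Lemma tail_integral_step (a b : R) : 0 < a -> a < b -> b <= 1 ->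
  (\int[leb]_(s in `]a, b[) ((Y s)%:E * (s^-1)%:E) <= (Y a * (b / a - 1))%:E)%E.
Proof.
move=> a0 ab b1; have a1 := lt_le_trans ab b1.
have Ia : I01 a by rewrite /I01/= in_itv/= a0.
have Is s : `]a, b[%classic s -> I01 s.
  rewrite /I01/= !in_itv/= => /andP[h1 h2]; rewrite (lt_trans a0 h1).
  exact: lt_le_trans h2 b1.
have mi : measurable_fun (`]a, b[ : set R) (fun s : R => (s^-1)%:E).
  by apply/measurable_EFinP; apply: measurable_funTS; exact: measurable_invr.
have i0 s : `]a, b[%classic s -> (0 <= (s^-1)%:E)%E.
  by move=> /= /[!in_itv]/= /andP[h _]; rewrite lee_fin invr_ge0 ltW// (lt_trans a0).
apply: (@le_trans _ _ (\int[leb]_(s in `]a, b[) ((Y a)%:E * (s^-1)%:E))%E).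
  apply: ge0_le_integral; first exact: measurable_itv.
  - by move=> s sab; rewrite mule_ge0 ?i0// lee_fin Y0//; exact: Is.
  - apply: emeasurable_funM => //; apply/measurable_EFinP.
    by apply: measurable_funS (L1_measurable LY); [exact: measurable_I01|exact: Is].
  - exact: measurable_funeM.
  move=> s sab; apply: lee_wpmul2r; first exact: i0.
  by rewrite lee_fin; apply: Yanti => //; [exact: Is|move: sab; rewrite /= in_itv/= => /andP[/ltW]].
rewrite (ge0_integralZl leb (measurable_itv _) mi); first last.
- by rewrite lee_fin Y0.
- exact: i0.
rewrite [X in (_ * X)%E](integral_inv a0 (ltW ab)) -EFinM lee_fin ler_wpM2l ?Y0//.
have b0 := lt_trans a0 ab; rewrite -ln_div ?posrE//.
rewrite -[X in ln X](subrK 1) addrC; apply: le_trans (le_ln1Dx _) _; last by [].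
by rewrite ltrBrDl subrr divr_gt0.
Qed.

(** Consecutive end points have ratio 4, so by [tail_integral_step] each interval contributes at
    most [4 - 1] times the value of [Y] at its left end. *)
Lemma tail_integral_le n :
  (\int[leb]_(s in `]2 ^- n.*2.+1, 1%R[) ((Y s)%:E * (s^-1)%:E) <=
   (3 * \sum_(j < n.+1) c j)%:E)%E.
Proof.
have p k : 0 < 2 ^- k :> R by rewrite invr_gt0.
elim: n => [|n IH].
  rewrite big_ord_recl big_ord0 addr0.
  apply: le_trans (tail_integral_step _ _ (lexx 1)) _; rewrite ?invr_gt0//.
    by rewrite invf_lt1// exprn_egt1 ?ltr1n.
  by rewrite lee_fin div1r invrK expr1; have := c_ge0 0; rewrite expr1; lra.
have q : 2 ^- n.+1.*2.+1 < 2 ^- n.*2.+1 :> R.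
  by rewrite ltf_pV2 ?posrE// ltr_eXn2l ?ltr1n// doubleS.
have q1 : 2 ^- n.*2.+1 < 1 :> R by rewrite invf_lt1// exprn_egt1 ?ltr1n.
rewrite (integral_oo_split (ltW q) q1).
- apply: le_trans (leeD (tail_integral_step (p _) q (ltW q1)) IH) _.
  have -> : 2 ^- n.*2.+1 / 2 ^- n.+1.*2.+1 = 4 :> R.
    have := mulVf (lt0r_neq0 (pow_gt0 n.*2.+1)); rewrite invrK doubleS.
    by rewrite (exprS _ n.*2.+2) (exprS _ n.*2.+1); lra.
  rewrite -EFinD lee_fin [X in _ <= _ * X]big_ord_recr/=.
  by have := c_ge0 n.+1; lra.
- apply: emeasurable_funM.
    apply/measurable_EFinP; apply: measurable_funS (L1_measurable LY); first exact: measurable_I01.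
    by move=> s /=; rewrite /I01/= !in_itv/= => /andP[/(lt_trans (p _))-> ->].
  by apply/measurable_EFinP; apply: measurable_funTS; exact: measurable_invr.
move=> s /andP[s0 s1]; have s0' := lt_trans (p _) s0.
by rewrite -EFinM lee_fin mulr_ge0 ?invr_ge0 ?(ltW s0')// Y0// /I01/= in_itv/= s0' s1.
Qed.

(** The value of the transform on block [m.*2]: up to level [m.*2] the dyadic interval containing
    that block starts at 0, and all later even differences vanish there because the function is
    constant on the block. *)
Definition lacunary_value m : R :=
  \sum_(i < m.+1) (D i.*2 - (if i == 0%N :> nat then 0 else D i.*2.-1)).

Lemma lacunary_value_ge m : \sum_(i < m.+1) D i.*2 <= 2 * lacunary_value m.
Proof.
rewrite /lacunary_value mulr_sumr; apply: ler_sum => -[[|i] im] _ /=.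
  by rewrite subr0; have := lacunary_mean_ge0 0; rewrite double0; lra.
by rewrite doubleS (lacunary_mean_half i.*2.+1) block_odd; lra.
Qed.

(** Let S be the sum of [D j.*2] for [j <= m]. The initial mean is at most [3 / 2 * 16] times
    [D m.*2], the tail sum at most 6 S plus 24 times [D m.*2]; together 54 S, and S is at most twice
    [lacunary_value m]. *)
Lemma calderon_lacunary m :
  (calderon (EFin \o Y) (2 ^- m.+1.*2.+1) <= (108 * lacunary_value m)%:E)%E.
Proof.
have -> : calderon (EFin \o Y) (2 ^- m.+1.*2.+1) = ((V m.+1)%:E +
    \int[leb]_(s in `]2 ^- m.+1.*2.+1, 1%R[) ((Y s)%:E * (s^-1)%:E))%E.
  have fin : (\int[leb]_(s in dyi m.+1.*2.+1 0) (Y s)%:E)%E \is a fin_num.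
    apply: integrable_fin_num; first exact: measurable_dyi.
    by apply: (integrable_dyi LY); rewrite expn_gt0.
  have -> : (V m.+1)%:E = ((2 ^+ m.+1.*2.+1)%:E * \int[leb]_(s in dyi m.+1.*2.+1 0) (Y s)%:E)%E.
    by rewrite -[X in (_ * X)%E](fineK fin) -EFinM.
  by rewrite dyi0 /calderon invrK.
apply: le_trans (leeD (lexx _) (tail_integral_le m.+1)) _; rewrite -EFinD lee_fin.
have cD j : c j <= 2 * D j.*2.
  by have := lacunary_mean_even j; have := lacunary_mean_ge0 j.+1.*2; lra.
have sc : \sum_(j < m.+1) c j <= 2 * \sum_(j < m.+1) D j.*2.
  by rewrite mulr_sumr; apply: ler_sum => j _.
have D4 j : D j.+1.*2 <= 4 * D j.*2 by have := lacunary_mean_even j; have := c_ge0 j; lra.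
have Ds : D m.*2 <= \sum_(j < m.+1) D j.*2.
  by rewrite big_ord_recr/= lerDr; apply: sumr_ge0 => j _; exact: lacunary_mean_ge0.
rewrite big_ord_recr/=.
have := lacunary_value_ge m; have := initial_mean_le m.+1.
by have := cD m.+1; have := D4 m; have := D4 m.+1; lra.
Qed.

End LacunaryMeans.

Section Optimality.
Context (R : realType).
Local Notation leb := (@lebesgue_measure R).
Implicit Types (x y g Y : R -> R).

(** From [m.+1] terms on, every partial sum equals [W] on [J] off the dyadic points, and [J] has
    length [2 ^- m.*2.+1]. Convergence in measure then gives [|g|] at least that distribution at
    each level below [W]. *)
Lemma lacunary_transform Y g m t :
  L1 (lacunary Y) -> martingale_transform (lacunary Y) g ->
  0 < t < 2 ^- m.*2.+1 -> ((lacunary_value Y m)%:E <= drearr g t)%E.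
Proof.
move=> Lf [_ mg [e he Sg]] /andP[t0 tm]; set W := lacunary_value Y m.
pose J : set R := dyi m.*2.+1 1.
have JI : J `<=` I01 by apply: dyi_sub; rewrite -[1%N](expn0 2) ltn_exp2l.
have mS n : measurable_fun I01 (transform_sum e n).
  by apply: measurable_transform_sum => i; have [/L1_measurable] := he i.
have e_low i s : (i <= m.*2)%N -> J s -> e i s = dyadic_mean (lacunary Y) i 0.
  move=> im /dyi_half/= sJ; apply: (cond_exp_dyi Lf (he i)); first by rewrite expn_gt0.
  move: sJ; rewrite !dyi0/= !in_itv/= => /andP[-> /lt_le_trans]; apply.
  by rewrite lef_pV2 ?posrE ?exprn_gt0// ler_weXn2l// ler1n.
have e_high i s : (m.*2 < i)%N -> J s -> ~ dyadic_points s -> e i s = block_value Y m.*2.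
  move=> mi sJ ns; have [j jn sj] := off_dyadic (JI _ sJ) ns i.
  rewrite (cond_exp_dyi Lf (he i) jn sj); apply: dyadic_mean_cst => r rj.
  apply: lacunary_block; move: sj rj; rewrite -(subnK mi).
  by move=> /dyi_iter_half/dyi_inj/(_ sJ) <- /dyi_iter_half.
have SE n s : J s -> ~ dyadic_points s -> transform_sum e (n + m.+1) s = W.
  move=> sJ ns; elim: n => [|n IH].
    apply: eq_bigr => i _; have im : (i.*2 <= m.*2)%N by rewrite leq_double -ltnS.
    rewrite (e_low _ _ im sJ); case: eqP => // _.
    by rewrite (e_low _ _ (leq_trans (leq_pred _) im) sJ).
  rewrite /transform_sum addSn big_ord_recr/= -[X in X + _]/(transform_sum e (n + m.+1) s) IH.
  have h1 : (m.*2 < (n + m).+1.*2)%N by rewrite ltn_double ltnS leq_addl.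
  have h2 : (m.*2 < (n + m).*2.+1)%N by rewrite ltnS leq_double leq_addl.
  by rewrite addnS/= (e_high _ _ h1 sJ ns) (e_high _ _ h2 sJ ns) subrr addr0.
have key l : 0 <= l -> l < W -> 2 ^- m.*2.+1 <= distr g l.
  move=> l0 lW; apply/ler_addgt0Pr => d d0; pose d' := (W - l) / 2.
  have d'0 : 0 < d' by rewrite /d'; lra.
  have [M hM] := cvg_in_measure_small Sg d'0 d0; pose n := (M + m.+1)%N.
  pose h s : R := W * \1_J s.
  have mh : measurable_fun I01 h.
    by apply: measurable_funM => //; apply: measurable_indic; exact: measurable_dyi.
  apply: (@le_trans _ _ (distr h (l + d'))).
    rewrite -lee_fin -distrE// -[X in (X <= _)%E](leb_dyi R m.*2.+1 1); apply: le_measure.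
    - by rewrite inE; exact: measurable_dyi.
    - by rewrite inE; exact: measurable_superlevel.
    move=> s sJ; split; first exact: JI.
    rewrite /h indicE mem_set// mulr1; apply: lt_le_trans (ler_norm _).
    by rewrite /d'; lra.
  apply: (@le_trans _ _ (distr (transform_sum e n) (l + d'))).
    apply: distr_le => //; apply: negligibleS (dyadic_points_null R) => s /= hs.
    apply: contrapT => ns; apply: hs => Is; rewrite /h indicE.
    have [sJ|_] := boolP (s \in J); last by rewrite mulr0 normr0.
    by rewrite inE in sJ; rewrite mulr1 SE.
  have mB : measurable_fun I01 (transform_sum e n \- g) by exact: measurable_funB.
  have {1}-> : transform_sum e n = g \+ (transform_sum e n \- g).
    by apply/funext => s /=; rewrite addrC subrK.
  apply: le_trans (distr_add mg mB _ _) _; rewrite lerD2l -lee_fin -distrE//.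
  by apply: hM; rewrite /n leq_addr.
rewrite leNgt; apply/negP; have fin := drearr_fin mg t0.
have a0 : 0 <= fine (drearr g t) by rewrite fine_ge0// drearr_ge0.
rewrite -{1}(fineK fin) lte_fin => aW; have := lt_le_trans tm (key _ a0 aW).
by rewrite -(drearr_gtE mg t a0) fineK// ltxx.
Qed.

(** Solidity compares functions pointwise, so pass to both decreasing rearrangements, compare there,
    and return by symmetry. *)
Lemma qbs_drearr_le (F : set (R -> R)) NF x g : quasi_banach_symmetric F NF ->
  F g -> measurable_fun I01 x ->
  (forall t, 0 < t < 1 -> (drearr x t <= drearr g t)%E) -> F x.
Proof.
move=> qF Fg mx xg; have mg := qbs_measurable qF Fg.
have [x0 _ mX xE] := drearr_idem mx; have [g0 _ mG gE] := drearr_idem mg.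
have FG : F (fine \o drearr g) by have [] := qbs_symmetric qF Fg mG gE.
have [|FX _] := qbs_solid qF FG mX.
  apply: nearW => t It; rewrite !ger0_norm ?x0 ?g0//= fine_le ?xg ?drearr_fin//.
  - by move: It; rewrite /I01/= in_itv/= => /andP[].
  - by move: It; rewrite /I01/= in_itv/= => /andP[].
have xX t : 0 < t < 1 -> drearr x t = drearr (fine \o drearr x) t by move=> t01; rewrite xE.
by have [] := qbs_symmetric qF FX mx xX.
Qed.

Variables (phi psi : R -> R) (c : R).
Hypotheses (qphi : quasi_concave phi) (qpsi : quasi_concave psi).
Hypothesis psi_le : forall u, 0 <= u -> u < 1 -> psi u <= phi u.
Hypothesis hc : forall u : R, 0 < u < 1 ->
    (\int[leb]_(t in `]0%R, u[) (psi t / t)%:E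
     + u%:E * \int[leb]_(t in `]u, 1%R[) (psi t / t ^+ 2)%:E
     <= (c * phi u)%:E)%E.
Hypothesis near_inf : forall u, 0 < u -> u < 1 ->
  exists v, [/\ u < v, v < 1 & phi v <= 2 * psi u * (1 + ln (v / u))].

Lemma transform_bounded : bounded_op martingale_transform
  (lorentz_space phi) (lorentz_size phi) (lorentz_space psi) (lorentz_size psi).
Proof.
exists (8 * (2 * c + 1)) => f Ff; have mf := lorentz_measurable Ff.
have [g [Tg gf]] := martingale_transform_exists (lorentz_L1 qphi Ff).
have [_ mg _] := Tg; exists g.
have gb : (rearr_int psi g <= (8 * (2 * c + 1) * lorentz_size phi f)%:E)%E.
  rewrite EFinM -lorentz_sizeE//.
  exact: (rearr_int_calderon qphi qpsi psi_le hc (ler0n R 8) mg mf gf).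
by have [Fg sg] := lorentz_bound mg gb.
Qed.

Lemma lorentz_lacunary Y : (forall s, I01 s -> 0 <= Y s) ->
  (forall s t, I01 s -> I01 t -> s <= t -> Y t <= Y s) ->
  lorentz_space phi Y -> lorentz_space phi (lacunary Y).
Proof.
move=> Y0 Ya FY; have mY := lorentz_measurable FY; have LY := lorentz_L1 qphi FY.
have mf := measurable_lacunary Y.
suff fb : (rearr_int phi (lacunary Y) <= (2 * lorentz_size phi Y)%:E)%E.
  by have [] := lorentz_bound mf fb.
rewrite EFinM -lorentz_sizeE// !rearr_intE// -(ge0_integralZl leb (measurable_itv _)); first last.
- by rewrite lee_fin.
- by move=> l _; rewrite lee_fin fundamental_ge0.
- exact: measurable_fundamental_distr.
apply: ge0_le_integral => //.
- by move=> l _; rewrite lee_fin fundamental_ge0.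
- exact: measurable_fundamental_distr.
- by apply: measurable_funeM; exact: measurable_fundamental_distr.
move=> l /=; rewrite in_itv/= andbT => l0; rewrite -EFinM lee_fin.
apply: fundamental_dilation => //; rewrite ?ler1n ?distr_ge0 ?distr_le1//.
exact: distr_lacunary.
Qed.

(* Both parts of [x], on ]0, 1/2[ and on its complement, have a rearrangement that
   vanishes on [1/2, 1[, so the comparison is only needed below 1/2. *)
Lemma transform_optimal (F : set (R -> R)) NF : quasi_banach_symmetric F NF ->
  bounded_op martingale_transform (lorentz_space phi) (lorentz_size phi) F NF ->
  lorentz_space psi `<=` F.
Proof.
move=> qF [C bd] x Fx; have mx := lorentz_measurable Fx.
have s0 := lorentz_size_ge0 psi x.
have [y [Fy xy] _] := @lorentz_S_majorant _ phi psi qphi qpsi near_inf x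
  (lorentz_size psi x + 1) Fx ltac:(lra) ltac:(lra).
have my := lorentz_measurable Fy; pose Y := fine \o drearr y.
have [Y0 Ya mY YE] := drearr_idem my; rewrite -/Y in Y0 Ya mY YE.
have FY : lorentz_space phi Y.
  by have [] := qbs_symmetric (lorentz_quasi_banach qphi) Fy mY YE.
have LY := lorentz_L1 qphi FY.
have Ff : lorentz_space phi (lacunary Y) by exact: lorentz_lacunary Y0 Ya FY.
have Lf := lorentz_L1 qphi Ff; have [g [Tg Fg _]] := bd _ Ff.
have mg := qbs_measurable qF Fg.
pose g' t := 108 * g t; have Fg' : F g' by exact: qbs_scale qF _ _ Fg.
have calE t : 0 < t < 1 -> calderon (drearr y) t = calderon (EFin \o Y) t.
  move=> /andP[t0 t1]; rewrite /calderon; congr (_ * _ + _)%E; apply: eq_integral => s.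
    rewrite inE/= in_itv/= => /andP[s0' _].
    by rewrite /Y/= fineK// drearr_fin.
  rewrite inE/= in_itv/= => /andP[ts _].
  by rewrite /Y/= fineK// drearr_fin// (lt_trans t0).
have half_le t : 0 < t -> t < 1 / 2 -> (drearr x t <= drearr g' t)%E.
  move=> t0 t2.
  have ex : exists n, 2 ^- n.*2.+1 <= t.
    have ti : 0 <= t^-1 by rewrite invr_ge0 ltW.
    have /andP[_ h1] := truncn_itv ti; exists (Num.trunc t^-1).
    rewrite invf_ple ?posrE ?exprn_gt0//; apply: (le_trans (ltW h1)).
    rewrite -natrX ler_nat; apply: leq_trans (ltnW (ltn_expl _ (isT : (1 < 2)%N))) _.
    by rewrite leq_exp2l// ltnS -addnn leq_addr.
  (* Minimality places [t] between [2 ^- m.+1.*2.+1], where the Calderon operator is evaluated, and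
     [2 ^- m.*2.+1], the length of the block. Index 0 is ruled out by [t < 1 / 2]. *)
  case: (ex_minnP ex) => -[|m] mt min.
    by move: mt; rewrite double0 expr1 leNgt -div1r t2.
  have tm : t < 2 ^- m.*2.+1.
    by rewrite ltNge; apply/negP => /min; rewrite ltnn.
  have p0 : 0 < (2 ^- m.+1.*2.+1 : R) by rewrite invr_gt0 exprn_gt0.
  have p1 : 0 < (2 ^- m.+1.*2.+1 : R) < 1 by rewrite p0 (le_lt_trans mt)//; lra.
  apply: (le_trans (drearr_anti x mt)); apply: (le_trans (xy _ p1)).
  rewrite calE//; apply: le_trans (calderon_lacunary Y0 Ya LY Lf m) _.
  rewrite /g' (drearr_scale mg) // ger0_norm// EFinM; apply: lee_wpmul2l => //.
  by apply: lacunary_transform => //; rewrite t0.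
have part (A B : set R) : measurable A -> I01 `&` A `<=` B -> measurable B -> (leb B <= (1 / 2)%:E)%E ->
    F (fun t => x t * \1_A t).
  move=> mA AB mB B2; have mxA : measurable_fun I01 (fun t => x t * \1_A t).
    by apply: measurable_funM => //; exact: measurable_indic.
  apply: (qbs_drearr_le qF Fg' mxA) => t /andP[t0 t1].
  have [t2|t2] := ltP t (1 / 2).
    apply: le_trans (half_le _ t0 t2); apply: drearr_le => // l _; apply: distr_leW => // s _.
    by rewrite normrM ler_piMr// indicE; case: (_ \in _); rewrite ?normr1 ?normr0.
  apply: (@le_trans _ _ 0%E); last exact: drearr_ge0.
  rewrite leNgt (drearr_gtE mxA t (lexx 0)) -leNgt; apply: le_trans t2.
  rewrite -lee_fin -distrE//; apply: le_trans B2; apply: le_measure; rewrite ?inE//.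
    exact: measurable_superlevel.
  move=> s [Is]; rewrite normr_gt0 mulf_eq0 negb_or indicE => /andP[_].
  by case: (boolP (_ \in _)); rewrite ?eqxx// inE => As _; exact: AB.
have -> : x = (fun t => x t * \1_(`]0, (1 / 2)%R[%classic : set R) t) \+
    (fun t => x t * \1_(~` `]0, (1 / 2)%R[%classic : set R) t).
  apply/funext => t /=; rewrite !indicE in_setC.
  by case: (_ \in _); rewrite ?mulr1 ?mulr0 ?addr0 ?add0r.
apply: (qbs_add qF).
  apply: (part _ `]0, (1 / 2)%R[%classic) => //.
  by rewrite [X in (X <= _)%E]leb_oo ?subr0//; lra.
apply: (part _ `[(1 / 2)%R, 1%R[%classic).
- exact: measurableC.
- move=> s [] /=; rewrite /I01/= !in_itv/= => /andP[s0' s1].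
  by rewrite s0' s1 andbT/= => /negP; rewrite -leNgt.
- exact: measurable_itv.
- by rewrite lebesgue_measure_itv/= lte_fin ifT ?lee_fin; lra.
Qed.

Lemma lorentz_optimal : optimal_range martingale_transform
  (lorentz_space phi) (lorentz_size phi) (lorentz_space psi) (lorentz_size psi).
Proof.
split; [exact: lorentz_quasi_banach|exact: transform_bounded|].
by move=> F NF qF bd; exact: transform_optimal bd.
Qed.

End Optimality.

Theorem corollary20 (R : realType) (phi : R -> R)
  (phi01 : {in `[0, 1[, forall t, 0 <= phi t < 1})
  (phi_incr : {in `[0, 1[ &, {homo phi : s t / s <= t}})
  (phi_neq0 : exists2 t, t \in `[0, 1[ & phi t != 0)
  (phi_concave : convex_function (`[0, 1[%classic : set R^o) (fun t => - phi t))
  (phi0 : phi t @[t --> 0^'+] --> (0 : R))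
  (c : R)
  (hc : forall u : R, 0 < u < 1 ->
    (\int[lebesgue_measure]_(t in `]0%R, u[) (psi_of phi t / t)%:E
     + u%:E * \int[lebesgue_measure]_(t in `]u, 1%R[) (psi_of phi t / t ^+ 2)%:E
     <= (c * phi u)%:E)%E) :
  same_space
    (S_space (lorentz phi)) (S_norm (lorentz phi) (lorentz_norm phi))
    (lorentz (psi_of phi)) (lorentz_norm (psi_of phi))
  /\ optimal_range martingale_transform
       (lorentz phi) (lorentz_norm phi)
       (lorentz (psi_of phi)) (lorentz_norm (psi_of phi)).
Proof.
have qphi := concave_quasi_concave phi01 phi_incr phi_neq0 phi_concave phi0.
have qpsi := psi_of_quasi_concave qphi.
have psi_le := psi_of_le_phi qphi; have near_inf := psi_of_near qphi.
have same := S_space_lorentz qphi qpsi psi_le hc near_inf.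
have opt := lorentz_optimal qphi qpsi psi_le hc near_inf.
by rewrite lorentz_space.unlock lorentz_size.unlock in same opt.
Qed.
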